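(* Let $m>0$, $\beta>0$. (a) (Periodic case.) Let $L>0$ and let $V,O:\mathbb R\to\mathbb R$ be $L$-periodic $C^2$ functions with $V\ge0$ and, for some $K>0$, $\sup_{x\in[0,L]}\big(1+|V(x)|+|V'(x)|+|V''(x)|+|O(x)|+|O'(x)|+|O''(x)|\big)\le K$. Then there is a constant $C>0$, depending on $\beta$, $m$ and the assumption constants but independent of $N$, such that for every integer $N\ge1$, $$\big|\langle\hat O\rangle_N-\langle\hat O\rangle\big|\le\frac{C}{N^2}.$$ (b) (Confining case.) Let $V,O:\mathbb R\to\mathbb R$ be $C^2$ functions such that, for some $a,K>0$, $V(x)\ge\frac a2x^2$ for all $x\in\mathbb R$ and $\sup_{x\in\mathbb R}\big(1+|V(0)|+\frac{|V'(x)|}{|x|+1}+|V''(x)|+|O(x)|+|O'(x)|+|O''(x)|\big)\le K$. Then there is a constant $C>0$, depending on $\beta$, $m$ and the assumption constants but independent of $N$, such that for every integer $N\ge1$, $$\big|\langle\hat O\rangle_N-\langle\hat O\rangle\big|\le\frac{C(\log N+1)^{3/2}}{N^2}.$$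
   Context: $\hat H_0=-\frac{1}{2m}\frac{d^2}{dx^2}$ on $L^2(\mathbb R)$, $\hat V$ and $\hat O$ are multiplication by $V$ and $O$, and $\hat H=\hat H_0+\hat V$. Let $D=[0,L]$ in the periodic case and $D=\mathbb R$ in the confining case; for an operator $A$ with continuous integral kernel $\langle x|A|y\rangle$ on the real line, $\mathrm{tr}[A]:=\int_D\langle x|A|x\rangle\,dx$ (so in the periodic case the trace is taken over one period). Here $\langle x|e^{-t\hat H_0}|y\rangle=\sqrt{\frac{m}{2\pi t}}\,e^{-m(x-y)^2/(2t)}$. Thermal averages: $$\langle\hat O\rangle=\frac{\mathrm{tr}[e^{-\beta\hat H}\hat O]}{\mathrm{tr}[e^{-\beta\hat H}]},\qquad \langle\hat O\rangle_N=\frac{\mathrm{tr}\big[(e^{-\frac{\beta}{N}\hat H_0}e^{-\frac{\beta}{N}\hat V})^N\hat O\big]}{\mathrm{tr}\big[(e^{-\frac{\beta}{N}\hat H_0}e^{-\frac{\beta}{N}\hat V})^N\big]}.$$ Explicitly, with $x_N:=x_0$, the numerator of $\langle\hat O\rangle_N$ is $$\Big(\frac{mN}{2\pi\beta}\Big)^{N/2}\int_D dx_0\int_{\mathbb R^{N-1}}O(x_0)\exp\Big(-\frac{\beta}{N}\sum_{j=0}^{N-1}V(x_j)-\frac{mN}{2\beta}\sum_{j=0}^{N-1}(x_{j+1}-x_j)^2\Big)dx_1\cdots dx_{N-1},$$ and by the Feynman--Kac formula the numerator of $\langle\hat O\rangle$ is $$\sqrt{\frac{m}{2\pi\beta}}\int_D\mathbb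 E\Big[\int_0^1O(x(\tau))\,d\tau\,\exp\Big(-\beta\int_0^1V(x(\tau))\,d\tau\Big)\Big]dx_0,$$ where $x(\tau)=x_0+\sqrt{\beta/m}\,(B_\tau-\tau B_1)$ and $B$ is a standard one-dimensional Brownian motion. The denominators are the same expressions with $O\equiv1$. *)

(* Defs.v *)
From HB Require Import structures.
From mathcomp Require Import all_boot all_order all_algebra.
From mathcomp Require Import all_classical all_reals all_analysis.
Set Implicit Arguments.
Unset Strict Implicit.
Unset Printing Implicit Defensive.
Import Order.TTheory GRing.Theory Num.Theory.
Import numFieldNormedType.Exports.
Local Open Scope ring_scope.
Local Open Scope classical_set_scope.

Definition C2 (R : realType) (f : R -> R) : Prop :=
  [/\ forall x, derivable f x 1,
      forall x, derivable f^`() x 1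
    & continuous f^`(2)].

(* Taking some [A i] to be [setT] gives the product rule for every subfamily. *)
Definition mutually_independent (R : realType) (d : measure_display)
    (T : measurableType d) (P : probability T R) (n : nat)
    (X : 'I_n -> T -> R) : Prop :=
  forall A : 'I_n -> set R, (forall i, measurable (A i)) ->
    P (\bigcap_i (X i @^-1` A i)) = (\prod_(i < n) P (X i @^-1` A i))%E.

(* Only the values [B t] with [0 <= t] are meaningful. The second parameter of
   [normal_prob] is the standard deviation, not the variance. *)
Record standard_brownian_motion (R : realType) (d : measure_display)
    (T : measurableType d) (P : probability T R) (B : R -> T -> R) : Prop :=
  StandardBrownianMotion {
    bm_measurable : forall t, 0 <= t -> measurable_fun [set: T] (B t);
    bm_start : forall w, B 0 w = 0;
    bm_increments_normal : forall s t, 0 <= s -> s < t ->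
      forall A : set R, measurable A ->
        P ((B t \- B s) @^-1` A) = normal_prob 0 (Num.sqrt (t - s)) A;
    bm_increments_independent : forall (n : nat) (t : nat -> R),
      0 <= t 0%N -> (forall i, t i <= t i.+1) ->
      mutually_independent P (fun i : 'I_n => B (t i.+1) \- B (t i));
    bm_continuous : forall w, {within `[0, +oo[, continuous (fun t => B t w)}
  }.

(* The integral over [R^n], as an iterated Lebesgue integral. *)
Fixpoint tuple_integral (R : realType) (n : nat) :
    (n.-tuple R -> \bar R) -> \bar R :=
  match n return (n.-tuple R -> \bar R) -> \bar R with
  | 0%N => fun F => F [tuple]
  | n'.+1 => fun F => (\int[@lebesgue_measure R]_x
      tuple_integral (fun s : n'.-tuple R => F [tuple of x :: s]))%E
  end.

(* The nodes [x_0, x_1, .., x_(N-1)] with [xs = (x_1, .., x_(N-1))]; the default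
   value of [nth] gives [x_N = x_0]. *)
Definition loop_node (R : realType) (x0 : R) (xs : seq R) (j : nat) : R :=
  nth x0 (x0 :: xs) j.

Definition loop_action (R : realType) (m beta : R) (N : nat) (V : R -> R)
    (x : nat -> R) : R :=
  beta / N%:R * \sum_(j < N) V (x j)
  + m * N%:R / (2 * beta) * \sum_(j < N) (x j.+1 - x j) ^+ 2.

(* [tr[(e^(-beta/N H_0) e^(-beta/N V))^N O]], the trace being over [D]. *)
Definition trotter_trace (R : realType) (m beta : R) (D : set R) (N : nat)
    (V O : R -> R) : R :=
  (m * N%:R / (2 * pi * beta)) `^ (N%:R / 2)
  * fine (\int[@lebesgue_measure R]_(x0 in D)
      tuple_integral (fun xs : N.-1.-tuple R =>
        (O x0 * expR (- loop_action m beta N V (loop_node x0 xs)))%:E))%E.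

Definition trotter_average (R : realType) (m beta : R) (D : set R) (N : nat)
    (V O : R -> R) : R :=
  trotter_trace m beta D N V O / trotter_trace m beta D N V (fun=> 1).

(* The Brownian loop [x_0 + sqrt (beta / m) (B_tau - tau B_1)]. *)
Definition brownian_loop (R : realType) (T : Type) (m beta : R)
    (B : R -> T -> R) (x0 : R) (w : T) (tau : R) : R :=
  x0 + Num.sqrt (beta / m) * (B tau w - tau * B 1 w).

Definition loop_time_average (R : realType) (T : Type) (m beta : R)
    (B : R -> T -> R) (f : R -> R) (x0 : R) (w : T) : R :=
  \int[@lebesgue_measure R]_(tau in `[0, 1])
    f (brownian_loop m beta B x0 w tau).

(* [tr[e^(-beta H) O]] over [D], in its Feynman-Kac form; its value does not
   depend on the Brownian motion used to write it. *)
Definition thermal_trace (R : realType) (d : measure_display)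
    (T : measurableType d) (P : probability T R) (B : R -> T -> R)
    (m beta : R) (D : set R) (V O : R -> R) : R :=
  Num.sqrt (m / (2 * pi * beta))
  * fine (\int[@lebesgue_measure R]_(x0 in D)
      'E_P[fun w => (loop_time_average m beta B O x0 w
                     * expR (- (beta * loop_time_average m beta B V x0 w)))%R])%E.

Definition thermal_average (R : realType) (d : measure_display)
    (T : measurableType d) (P : probability T R) (B : R -> T -> R)
    (m beta : R) (D : set R) (V O : R -> R) : R :=
  thermal_trace P B m beta D V O / thermal_trace P B m beta D V (fun=> 1).

(* Main.v *)
Require Import Defs.
From HB Require Import structures.
From mathcomp Require Import all_boot all_order all_algebra.
From mathcomp Require Import all_classical all_reals all_analysis.
From mathcomp Require Import measurable_realfun fingroup perm.
From mathcomp Require Import ring lra.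
Set Implicit Arguments.
Unset Strict Implicit.
Unset Printing Implicit Defensive.
Import Order.TTheory GRing.Theory Num.Theory.
Import numFieldNormedType.Exports.
Local Open Scope ring_scope.
Local Open Scope classical_set_scope.

(** Write y_j for the Brownian loop at time j/N and <F> for the integral over x_0 in D
    of E[F]. Integrating out the increments turns the Trotter trace into
    sqrt(m / (2 pi beta)) <O(y_0) exp(-beta S_N)>, where S_N is the mean of V over the
    nodes. The measure <.> is invariant under rotation of the loop, so O(y_0) may be
    replaced by the mean of O over the nodes.

    Now compare N with 2N. Both the even and the odd nodes of a loop with 2N nodes give
    back the trace J_N, and J_2N takes the mean of the two families of nodes inside the
    exponential, so that |J_N - J_2N| is at most a constant times
    <((S_odd - S_even)^2 + (O_odd - O_even)^2) exp(-beta S_even)>. The difference of the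
    two means is N^-1 times a sum over the odd nodes. Reflecting an odd node about the
    midpoint of its neighbours preserves the law of the loop and the even nodes, and
    splits each summand into an odd part, of order N^-1/2, and an even part, which is a
    second difference of order N^-1. The odd parts are orthogonal for the weight
    exp(-beta S_even), so that both sums are O(1) in mean square and
    |J_N - J_2N| = O(N^-2). Along N, 2N, 4N, ... these errors form a geometric series,
    and Riemann sums and dominated convergence identify the limit as the thermal trace.
    Denominators are bounded below by Jensen's inequality. *)

(** * Substitutions in Lebesgue integrals *)

(** The first-order effect of doubling vanishes exactly, not by an estimate: the even and the odd
    nodes contribute the same trace, so only the convexity defect of the exponential remains,
    quadratic in the difference of the two means. Without orthogonality of the odd parts, their sum
    would only be bounded by N^1/2 in mean square norm, and the error by N^-1.

    The other obstacle is integrability over x_0 when D is the line and V' is unbounded. The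
    Boltzmann weight is bounded by a profile H(x_0) times a quartic polynomial in the bridge, a tame
    function costs a factor 1 + x_0^2, and what remains depends on the bridge alone. Eighth moments
    suffice because products are split by the arithmetic-geometric inequality. The record
    [confinement] collects what is needed, so that both cases share one argument, and the constants
    see V only through G, K and a quadratic upper bound.

    Most integrals are kept nonnegative to work with extended values: orthogonality goes through the
    parallelogram identity, and a signed observable is shifted by a multiple of the constant
    observable. *)

Definition image_measure d d' (T1 : measurableType d) (T2 : measurableType d')
    (R : realType) (m : {measure set T1 -> \bar R}) (f : T1 -> T2)
    (mf : measurable_fun setT f) : {measure set T2 -> \bar R} :=
  measure_function_pushforward__canonical__measure_function_Measure m mf.

Lemma ge0_integral_image d d' (T1 : measurableType d) (T2 : measurableType d')
    (R : realType) (m : {measure set T1 -> \bar R}) (f : T1 -> T2)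
    (mf : measurable_fun setT f) (D : set T2) (g : T2 -> \bar R) :
  measurable D -> measurable_fun D g -> (forall y, D y -> 0 <= g y)%E ->
  (\int[image_measure m mf]_(y in D) g y
   = \int[m]_(x in f @^-1` D) g (f x))%E.
Proof.
move=> mD mg g0; apply: (ge0_integral_pushforward mf) => //.
by move=> y /set_mem; exact: g0.
Qed.

Section affine_substitution.
Context {R : realType}.

Definition affine (s c : R) (x : measurableTypeR R) : measurableTypeR R :=
  s * x + c.

Lemma measurable_affine s c : measurable_fun setT (affine s c).
Proof. by apply: measurable_funD => //; exact: measurable_funM. Qed.

(** Lebesgue measure is determined by its values on the intervals []a, b]], and the preimage of []a,
    b]] under [affine s c] has length (b - a) / s. *)
Lemma lebesgue_measure_affine (s c : R) (s0 : 0 < s) (A : set R) :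
  measurable A ->
  lebesgue_measure A
  = mscale (NngNum (ltW s0)) (image_measure lebesgue_measure (measurable_affine s c)) A.
Proof.
move=> mA.
apply: lebesgue_measure_unique => //= _ [[a b]] _ <-.
rewrite /mscale/= /pushforward/=.
have -> : affine s c @^-1` `]a, b] = `](a - c) / s, (b - c) / s]%classic.
  apply/seteqP; split => x /=; rewrite !in_itv/= /affine ltr_pdivrMr// ler_pdivlMr//;
  by rewrite ltrBlDr lerBrDr [x * s]mulrC.
rewrite !lebesgue_measure_itv/= !lte_fin ltr_pM2r ?invr_gt0// ltrD2r.
case: ifPn => _; last by rewrite mule0.
by rewrite -!EFinD -EFinM; congr EFin; field; rewrite gt_eqF.
Qed.

Lemma ge0_integral_affine (s c : R) (D : set R) (f : R -> \bar R) :
  0 < s -> measurable D -> measurable_fun D f ->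
  (forall x, D x -> 0 <= f x)%E ->
  (\int[lebesgue_measure]_(x in D) f x
   = s%:E * \int[lebesgue_measure]_(x in affine s c @^-1` D) f (s * x + c)%R)%E.
Proof.
move=> s0 mD mf f0.
transitivity (\int[mscale (NngNum (ltW s0))
    (image_measure lebesgue_measure (measurable_affine s c))]_(x in D) f x)%E.
  by apply: eq_measure_integral => A mA _; exact: lebesgue_measure_affine.
rewrite ge0_integral_mscale//; congr (_ * _)%E.
exact: (ge0_integral_image lebesgue_measure (measurable_affine s c)).
Qed.

Lemma ge0_integralT_affine (s c : R) (f : R -> \bar R) :
  0 < s -> measurable_fun setT f -> (forall x, 0 <= f x)%E ->
  (\int[lebesgue_measure]_x f (s * x + c)%R
   = s^-1%:E * \int[lebesgue_measure]_x f x)%E.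
Proof.
move=> s0 mf f0; rewrite [in RHS](@ge0_integral_affine s c setT)// (_ : _ @^-1` _ = setT)//.
by rewrite muleA -EFinM mulVf ?gt_eqF// mul1e.
Qed.

Lemma ge0_integralT_shift (c : R) (f : R -> \bar R) :
  measurable_fun setT f -> (forall x, 0 <= f x)%E ->
  (\int[lebesgue_measure]_x f (x + c)%R = \int[lebesgue_measure]_x f x)%E.
Proof.
move=> mf f0; have /= := @ge0_integralT_affine 1 c _ ltr01 mf f0.
by rewrite invr1 mul1e => <-; apply: eq_integral => x _; rewrite mul1r.
Qed.

Lemma ge0_integral_itv_shift (a b c : R) (f : R -> \bar R) :
  measurable_fun setT f -> (forall x, 0 <= f x)%E ->
  (\int[lebesgue_measure]_(x in `[a, b]) f (x + c)%R
   = \int[lebesgue_measure]_(x in `[(a + c)%R, (b + c)%R]) f x)%E.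
Proof.
move=> mf f0; rewrite (@ge0_integral_affine 1 c `[a + c, b + c]%classic)//; last first.
  exact: measurable_funTS.
rewrite mul1e (_ : affine 1 c @^-1` _ = `[a, b]%classic).
  by apply: eq_integral => x _; rewrite mul1r.
by apply/seteqP; split => x /=; rewrite !in_itv/= /affine mul1r !lerD2r.
Qed.

End affine_substitution.

(** The codomain is arbitrary: the lemma serves both real functions and extended-real integrands. *)
Lemma periodic_intz (R : realType) (T : Type) (f : R -> T) (L : R) (k : int) :
  (forall x, f (x + L) = f x) -> forall x, f (x + k%:~R * L) = f x.
Proof.
move=> fL; have fn n x : f (x + n%:R * L) = f x.
  elim: n => [|n ih] in x *; first by rewrite mul0r addr0.
  by rewrite -natr1 mulrDl mul1r addrA fL.
case: k => n x; first exact: fn.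
by rewrite NegzE mulrNz mulNr -[LHS](fn n.+1) -pmulrn subrK.
Qed.

(* [L = 0] is allowed when [D] is the line; the hypothesis on [f] is then void. *)
Definition period_domain (R : realType) (D : set R) (L : R) : Prop :=
  measurable D /\
  forall f : R -> \bar R, measurable_fun setT f -> (forall x, 0 <= f x)%E ->
    (forall x, f (x + L)%R = f x) -> forall c,
    (\int[lebesgue_measure]_(x in D) f (x + c)%R
     = \int[lebesgue_measure]_(x in D) f x)%E.

Lemma period_domain_setT (R : realType) : period_domain [set: R] 0.
Proof.
by split=> [//|f mf f0 _ c]; exact: ge0_integralT_shift.
Qed.

(** With c = r + kL and 0 <= r <= L, periodicity leaves the integral over [r, L + r]. It is cut at
    L, and the part beyond L is moved back onto [0, r]. *)
Lemma period_domain_itv (R : realType) (L : R) : 0 < L ->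
  period_domain `[0, L]%classic L.
Proof.
move=> L0; split=> [|f mf f0 fL c]; first exact: measurable_itv.
pose k := Num.floor (c / L); pose r := c - k%:~R * L.
have cE : c = r + k%:~R * L by rewrite /r subrK.
have r0 : 0 <= r.
  by rewrite subr_ge0 -ler_pdivlMr// floor_le.
have rL : r <= L.
  rewrite lerBlDr -[X in X + _]mul1r -mulrDl -ler_pdivrMr// ltW//.
  by rewrite -[1]/(1%:~R) -intrD addrC floorD1_gt.
transitivity (\int[lebesgue_measure]_(x in `[0%R, L]) f (x + r)%R)%E.
  by apply: eq_integral => x _; rewrite cE addrA (periodic_intz k fL).
rewrite ge0_integral_itv_shift// add0r.
have split_at (a b d : R) : a <= b -> b <= d ->
    (\int[lebesgue_measure]_(x in `[a, d]) f x
     = \int[lebesgue_measure]_(x in `[a, b]) f x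
       + \int[lebesgue_measure]_(x in `[b, d]) f x)%E.
  move=> ab bd; rewrite (@itv_bndbnd_setU _ _ (BLeft a) (BRight b) (BRight d))//.
  rewrite ge0_integral_setU//=; last 2 first.
  - exact: measurable_funTS.
  - apply/disj_setPLR => x /=; rewrite !in_itv/= => /andP[_ xb] /andP[].
    by rewrite ltNge xb.
  congr +%E; rewrite -[RHS]integral_itv_obnd_cbnd//.
  exact: measurable_funTS.
rewrite (split_at r L (L + r)) ?lerDl//.
rewrite (split_at 0 r L)// addeC; congr +%E.
have := @ge0_integral_itv_shift _ 0 r L f mf f0.
rewrite add0r [r + L]addrC => <-.
by apply: eq_integral => x _; rewrite fL.
Qed.

(** * Integration against a density *)

Section density.
Context d (T : measurableType d) {R : realType}.
Variables (mu nu : {measure set T -> \bar R}) (g : T -> R).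
Hypothesis mg : measurable_fun setT g.
Hypothesis g0 : forall x, 0 <= g x.
Hypothesis nuE : forall A, measurable A ->
  nu A = (\int[mu]_(x in A) (g x)%:E)%E.

Import HBNNSimple.

Let mge : measurable_fun setT (fun x => (g x)%:E).
Proof. exact/measurable_EFinP. Qed.

Let density_indic (A : set T) : measurable A ->
  (\int[nu]_x (\1_A x)%:E = \int[mu]_x ((\1_A x)%:E * (g x)%:E))%E.
Proof.
move=> mA; rewrite integral_indic// setIT nuE// integral_mkcond.
apply: eq_integral => x _; rewrite patchE indicE.
by case: ifPn => _; rewrite ?mul1e ?mul0e.
Qed.

Let density_nnsfun (h : {nnsfun T >-> R}) :
  (\int[nu]_x (h x)%:E = \int[mu]_x ((h x)%:E * (g x)%:E))%E.
Proof.
under [LHS]eq_integral do rewrite fimfunE -fsumEFin//.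
rewrite [LHS]ge0_integral_fsum//; last 2 first.
  - by move=> r; exact/measurable_EFinP/measurableT_comp.
  - by move=> n x _; rewrite EFinM nnfun_muleindic_ge0.
under [RHS]eq_integral.
  move=> x xD; rewrite fimfunE -fsumEFin// ge0_mule_fsuml; last first.
    by move=> r; rewrite EFinM nnfun_muleindic_ge0.
  over.
rewrite [RHS]ge0_integral_fsum//; last 2 first.
  - move=> r; apply: emeasurable_funM => //.
    exact/measurable_EFinP/measurableT_comp.
  - move=> n x _; rewrite EFinM mule_ge0//; first by rewrite nnfun_muleindic_ge0.
    by rewrite lee_fin.
apply: eq_fsbigr => r _; rewrite !integralZl_indic_nnsfun//= density_indic//.
have [r0|r0] := leP 0 r; last first.
  have -> : h @^-1` [set r] = set0 by exact: preimage_nnfun0.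
  rewrite !integral0_eq ?mule0// => x _.
    by rewrite indic0 mulr0 mul0e.
  by rewrite indic0 mul0e.
rewrite -ge0_integralZl//=.
- by apply: eq_integral => x _; rewrite muleA -EFinM.
- apply: emeasurable_funM => //.
  exact/measurable_EFinP/measurable_indic.
- by move=> x _; rewrite mule_ge0// lee_fin.
Qed.

(** The usual extension: [nuE] gives indicators, linearity gives simple functions, and monotone
    convergence along [nnsfun_approx] gives the rest. *)
Lemma ge0_integral_density (f : T -> \bar R) :
  measurable_fun setT f -> (forall x, 0 <= f x)%E ->
  (\int[nu]_x f x = \int[mu]_x (f x * (g x)%:E))%E.
Proof.
move=> mf f0.
pose f_ := nnsfun_approx measurableT mf.
transitivity (lim (\int[nu]_x (f_ n x)%:E @[n --> \oo])%E).
  rewrite -monotone_convergence//=.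
  - apply: eq_integral => ? /set_mem xD; apply/esym/cvg_lim => //=.
    exact: cvg_nnsfun_approx.
  - by move=> n; exact/measurable_EFinP/measurable_funTS.
  - by move=> n ? _; rewrite lee_fin.
  - by move=> ? _ ? ? mn; rewrite lee_fin; exact/lefP/nd_nnsfun_approx.
transitivity (lim (\int[mu]_x ((f_ n x)%:E * (g x)%:E) @[n --> \oo])%E).
  by apply: congr_lim; apply/funext => n /=; exact: density_nnsfun.
rewrite -monotone_convergence//=.
- apply: eq_integral => x _; apply/cvg_lim => //=.
  by apply: cvgeZr => //; exact: cvg_nnsfun_approx.
- move=> n; apply: emeasurable_funM => //.
  exact/measurable_EFinP/measurable_funTS.
- by move=> n x _; rewrite mule_ge0// lee_fin.
- move=> x _ n m nm; rewrite lee_wpmul2r ?lee_fin//.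
  exact/lefP/nd_nnsfun_approx.
Qed.

End density.

Lemma ge0_integral_normal_prob (R : realType) (s : R) (f : R -> \bar R) :
  measurable_fun setT f -> (forall x, 0 <= f x)%E ->
  (\int[normal_prob 0 s]_x f x
   = \int[lebesgue_measure]_x (f x * (normal_pdf 0 s x)%:E))%E.
Proof.
apply: (@ge0_integral_density _ _ _ lebesgue_measure (normal_prob 0 s)
  (normal_pdf 0 s)) => //.
- exact: measurable_normal_pdf.
- by move=> x; exact: normal_pdf_ge0.
Qed.

(** * Iterated integrals over tuples *)

Section tuple_integral_theory.
Context {R : realType}.

Lemma tuple_integral_ge0 n (F : n.-tuple R -> \bar R) :
  (forall s, 0 <= F s)%E -> (0 <= tuple_integral F)%E.
Proof.
elim: n F => [|n ih] F F0 /=; first exact: F0.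
by apply: integral_ge0 => x _; exact: ih.
Qed.

(** The parameter space is arbitrary so that the induction can move the coordinate just peeled off
    into it. *)
Lemma measurable_tuple_integral d (T : measurableType d) n
    (F : T -> n.-tuple R -> \bar R) :
  measurable_fun setT (fun p : T * n.-tuple R => F p.1 p.2) ->
  (forall t s, 0 <= F t s)%E ->
  measurable_fun setT (fun t => tuple_integral (F t)).
Proof.
elim: n d T F => [|n ih] d T F mF F0 /=.
  apply: (measurableT_comp mF (g := fun t => (t, [tuple]))).
  exact: measurable_fun_pair.
pose G (p : T * R) := tuple_integral (fun s => F p.1 [tuple of p.2 :: s]).
apply: (@measurable_fun_fubini_tonelli_F _ _ _ _ _ lebesgue_measure G).
- apply: (ih _ _ (fun (p : T * R) s => F p.1 [tuple of p.2 :: s])) => //.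
  apply: (measurableT_comp mF
    (g := fun p : (T * R) * n.-tuple R => (p.1.1, [tuple of p.1.2 :: p.2]))).
  apply: measurable_fun_pair.
    exact: (measurableT_comp measurable_fst).
  apply: measurable_cons => //.
  exact: (measurableT_comp measurable_snd).
- by move=> p; apply: tuple_integral_ge0.
Qed.

Lemma measurable_tuple_cons n (F : n.+1.-tuple R -> \bar R) :
  measurable_fun setT F ->
  measurable_fun setT (fun p : R * n.-tuple R => F [tuple of p.1 :: p.2]).
Proof.
move=> mF; apply: (measurableT_comp mF
  (g := fun p : R * n.-tuple R => [tuple of p.1 :: p.2])).
exact: measurable_cons.
Qed.

Lemma measurable_tuple_cons2 n (x : R) (F : n.+1.-tuple R -> \bar R) :
  measurable_fun setT F ->
  measurable_fun setT (fun s : n.-tuple R => F [tuple of x :: s]).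
Proof.
move=> mF; apply: (measurableT_comp mF
  (g := fun s : n.-tuple R => [tuple of x :: s])).
exact: measurable_cons.
Qed.

Lemma measurable_tuple_integral_cons n (F : n.+1.-tuple R -> \bar R) :
  measurable_fun setT F -> (forall s, 0 <= F s)%E ->
  measurable_fun setT
    (fun x : R => tuple_integral (fun s => F [tuple of x :: s])).
Proof.
move=> mF F0.
apply: (measurable_tuple_integral (F := fun x s => F [tuple of x :: s])) => //.
exact: measurable_tuple_cons.
Qed.

Lemma ge0_tuple_integralZl n (k : R) (F : n.-tuple R -> \bar R) :
  0 <= k -> measurable_fun setT F -> (forall s, 0 <= F s)%E ->
  (tuple_integral (fun s => k%:E * F s) = k%:E * tuple_integral F)%E.
Proof.
move=> k0; elim: n F => [//|n ih] F mF F0 /=.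
transitivity (\int[lebesgue_measure]_x
    (k%:E * tuple_integral (fun s => F [tuple of x :: s])))%E.
  apply: eq_integral => x _; apply: ih => //.
  exact: measurable_tuple_cons2.
apply: ge0_integralZl => //.
- exact: measurable_tuple_integral_cons.
- by move=> x _; exact: tuple_integral_ge0.
Qed.

(** Tonelli, one coordinate at a time. It later brings the total increment of a walk outside the
    integrals over the other increments. *)
Lemma ge0_tuple_integral_exchange n (F : R -> n.-tuple R -> \bar R) :
  measurable_fun setT (fun p : R * n.-tuple R => F p.1 p.2) ->
  (forall t s, 0 <= F t s)%E ->
  (tuple_integral (fun s => \int[lebesgue_measure]_t F t s)
   = \int[lebesgue_measure]_t tuple_integral (F t))%E.
Proof.
elim: n F => [//|n ih] F mF F0 /=.
have mF2 : measurable_fun setT (fun p : (R * R) * n.-tuple R =>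
    F p.1.1 [tuple of p.1.2 :: p.2]).
  apply: (measurableT_comp mF
    (g := fun p : (R * R) * n.-tuple R => (p.1.1, [tuple of p.1.2 :: p.2]))).
  apply: measurable_fun_pair.
    exact: (measurableT_comp measurable_fst).
  apply: measurable_cons => //.
  exact: (measurableT_comp measurable_snd).
transitivity (\int[lebesgue_measure]_x \int[lebesgue_measure]_t
    tuple_integral (fun s => F t [tuple of x :: s]))%E.
  apply: eq_integral => x _.
  apply: (ih (fun t s => F t [tuple of x :: s])) => //.
  apply: (measurableT_comp mF2
    (g := fun p : R * n.-tuple R => ((p.1, x), p.2))).
  by apply: measurable_fun_pair => //; exact: measurable_fun_pair.
pose G (p : R * R) := tuple_integral (fun s => F p.1 [tuple of p.2 :: s]).
apply/esym/(@fubini_tonelli _ _ _ _ _ lebesgue_measure lebesgue_measure G).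
- exact: (measurable_tuple_integral
    (F := fun (p : R * R) s => F p.1 [tuple of p.2 :: s])).
- by move=> p; exact: tuple_integral_ge0.
Qed.

(** The coordinates already read are kept in [h]; each new one is scaled by [sc] and translated by a
    function of its predecessors. The Jacobian matrix is triangular with constant diagonal [sc]. *)
Fixpoint triangular_map (sc : R) (a : seq R -> R) (h s : seq R) : seq R :=
  if s is x :: s' then (sc * x + a h) :: triangular_map sc a (rcons h x) s'
  else [::].

(** With the head fixed, the induction hypothesis treats the tail; the head then undergoes an affine
    substitution of factor [sc]. The offsets never enter the Jacobian. *)
Lemma tuple_integral_triangular n (sc : R) (a : seq R -> R) (h : seq R)
    (F : seq R -> \bar R) :
  0 < sc -> measurable_fun setT (fun s : n.-tuple R => F s) ->
  (forall s, 0 <= F s)%E ->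
  (tuple_integral (fun s : n.-tuple R => F (triangular_map sc a h s))
   = (sc ^- n)%:E * tuple_integral (fun s : n.-tuple R => F s))%E.
Proof.
move=> sc0; elim: n h F => [|n ih] h F mF F0 /=.
  by rewrite expr0 invr1 mul1e.
have mFc := measurable_tuple_cons2 _ mF.
transitivity (\int[lebesgue_measure]_x ((sc ^- n)%:E *
    tuple_integral (fun s : n.-tuple R => F ((sc * x + a h)%R :: s))))%E.
  apply: eq_integral => x _.
  apply: (ih (rcons h x) (fun s => F ((sc * x + a h)%R :: s))) => //.
  exact: mFc.
have mG : measurable_fun setT
    (fun x => tuple_integral (fun s : n.-tuple R => F (x :: s))).
  exact: (measurable_tuple_integral_cons (F := fun s : n.+1.-tuple R => F s)).
have G0 x : (0 <= tuple_integral (fun s : n.-tuple R => F (x :: s)))%E.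
  exact: tuple_integral_ge0.
rewrite ge0_integralZl//=; last 2 first.
- apply: (measurableT_comp mG (g := fun x => (sc * x + a h)%R)).
  exact: measurable_affine.
- by rewrite lee_fin invr_ge0 exprn_ge0// ltW.
rewrite (ge0_integralT_affine (a h) sc0 mG G0) muleA -EFinM.
by rewrite exprSr invfM.
Qed.

End tuple_integral_theory.

(** * Gaussian vectors and the discrete Brownian bridge *)

(** A pi-system argument: measurable rectangles are stable under intersection and generate the
    product sigma-algebra. *)
Lemma tuple_measure_unique (R : realType) n
    (m1 m2 : {measure set (n.-tuple R) -> \bar R}) :
  (m1 setT < +oo)%E ->
  (forall A : 'I_n -> set R, (forall i, measurable (A i)) ->
    m1 (\bigcap_i ((fun s : n.-tuple R => tnth s i) @^-1` A i))
    = m2 (\bigcap_i ((fun s : n.-tuple R => tnth s i) @^-1` A i))) ->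
  forall B, measurable B -> m1 B = m2 B.
Proof.
move=> m1oo m12.
pose rect (A : 'I_n -> set R) :=
  \bigcap_i ((fun s : n.-tuple R => tnth s i) @^-1` A i).
pose G := [set B | exists2 A, (forall i, measurable (A i)) & B = rect A].
have rectT : rect (fun=> setT) = setT by rewrite /rect; apply/seteqP; split.
apply: (measure_unique G (fun=> setT)) => //.
- apply/seteqP; split.
  + apply: smallest_sub; first exact: smallest_sigma_algebra.
    move=> B; rewrite -bigcup_seq/= => -[i _ [Y mY]]; rewrite setTI => <-.
    apply: sub_sigma_algebra.
    exists (fun j => if j == i then Y else setT).
      by move=> j; case: ifPn.
    apply/seteqP; split => s /=.
      by move=> Ys j _ /=; case: eqP => [->|].
    by move=> /(_ i Logic.I) /=; rewrite eqxx.
  + apply: smallest_sub; first exact: sigma_algebra_measurable.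
    move=> _ [A mA ->]; apply: fin_bigcap_measurable.
      exact: finite_finset.
    move=> i _; rewrite -[X in measurable X]setTI.
    exact: (measurable_tnth i).
- move=> _ _ [A mA ->] [B mB ->]; exists (fun i => A i `&` B i).
    by move=> i; exact: measurableI.
  by rewrite /rect -bigcapI.
- by move=> _; exists (fun=> setT).
- by rewrite bigcup_const//; exists 0%N.
- by move=> _ [A mA ->]; exact: m12.
Qed.

Lemma measurable_mktuple d (T : measurableType d) (R : realType) n
    (X : 'I_n -> T -> R) : (forall i, measurable_fun setT (X i)) ->
  measurable_fun setT (fun w => [tuple X i w | i < n]).
Proof.
move=> mX; apply/measurable_fun_tnthP => i.
apply: eq_measurable_fun (mX i) => w _ /=.
by rewrite tnth_mktuple.
Qed.

Section gaussian_vector.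
Context d (T : measurableType d) {R : realType} (P : probability T R).

Lemma mutually_independent_lift n (X : 'I_n.+1 -> T -> R) :
  mutually_independent P X ->
  mutually_independent P (fun i : 'I_n => X (lift ord0 i)).
Proof.
move=> iX A mA.
(* The missing coordinate 0 is given the sure event. *)
pose A' (i : 'I_n.+1) := if unlift ord0 i is Some j then A j else setT.
have mA' i : measurable (A' i) by rewrite /A'; case: unliftP.
have := iX A' mA'; rewrite big_ord_recl /A' unlift_none preimage_setT.
rewrite probability_setT mul1e.
under eq_bigr do rewrite liftK.
move=> <-; congr (P _); apply/seteqP; split => w /= Aw i _ /=.
  by case: unliftP => [j ->|//]; exact: (Aw j).
by have := Aw (lift ord0 i) Logic.I; rewrite /= liftK.
Qed.

(** For fixed [A] both sides are finite measures in [B]. On a rectangle they agree by the product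
    rule for the whole family, and rectangles determine a finite measure. *)
Lemma mutually_independent_head n (X : 'I_n.+1 -> T -> R) :
  (forall i, measurable_fun setT (X i)) -> mutually_independent P X ->
  forall (A : set R) (B : set (n.-tuple R)), measurable A -> measurable B ->
  (P (X ord0 @^-1` A
      `&` (fun w => [tuple X (lift ord0 i) w | i < n]) @^-1` B)
   = P (X ord0 @^-1` A) * P ((fun w => [tuple X (lift ord0 i) w | i < n]) @^-1` B))%E.
Proof.
move=> mX iX A B mA mB.
have mX' : measurable_fun setT (fun w => [tuple X (lift ord0 i) w | i < n]).
  by apply: measurable_mktuple.
have mXA : measurable (X ord0 @^-1` A) by rewrite -[X in measurable X]setTI; exact: mX.
pose p := fine (P (X ord0 @^-1` A)).
have pE : P (X ord0 @^-1` A) = p%:E by rewrite fineK// fin_num_measure.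
have p0 : 0 <= p by exact: fine_ge0.
rewrite setIC.
pose m1 : {measure set (n.-tuple R) -> \bar R} :=
  image_measure (mrestr P mXA) mX'.
pose m2 : {measure set (n.-tuple R) -> \bar R} :=
  mscale (NngNum p0) (image_measure P mX').
transitivity (m1 B) => //.
transitivity (m2 B); last by rewrite /m2 /mscale/= pE.
apply: tuple_measure_unique mB.
  rewrite /m1 /image_measure/= /pushforward preimage_setT /mrestr setTI.
  by rewrite ltey_eq fin_num_measure.
move=> C mC.
have -> : m2 (\bigcap_i ((fun z : n.-tuple R => tnth z i) @^-1` C i))
    = (p%:E * P ((fun w => [tuple X (lift ord0 i) w | i < n]) @^-1`
      (\bigcap_i ((fun z : n.-tuple R => tnth z i) @^-1` C i))))%E by [].
rewrite /m1 /image_measure/= /pushforward /mrestr/=.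
pose C' (i : 'I_n.+1) := if unlift ord0 i is Some j then C j else A.
have mC' i : measurable (C' i) by rewrite /C'; case: unliftP.
have := iX C' mC'; rewrite big_ord_recl /C' unlift_none pE.
under eq_bigr do rewrite liftK.
have := mutually_independent_lift iX mC => <-.
have -> : (fun w => [tuple X (lift ord0 i) w | i < n]) @^-1`
    (\bigcap_i ((fun z : n.-tuple R => tnth z i) @^-1` C i))
    = \bigcap_i (X (lift ord0 i) @^-1` C i).
  by apply/seteqP; split => w /= Cw i _ /=; have /= := Cw i Logic.I;
    rewrite tnth_mktuple.
move=> <-; congr (P _); apply/seteqP; split => w /=.
  move=> [Cw Aw] i _ /=; case: unliftP => [j ->|->]//.
  exact: (Cw j).
move=> Cw; split; last by have := Cw ord0 Logic.I; rewrite /= unlift_none.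
move=> i _ /=.
by have := Cw (lift ord0 i) Logic.I; rewrite /= liftK.
Qed.

Variable s : R.

Definition gaussian_density n (z : seq R) : R :=
  \prod_(j < n) normal_pdf 0 s z`_j.

Lemma gaussian_density_ge0 n z : 0 <= gaussian_density n z.
Proof. by apply: prodr_ge0 => i _; exact: normal_pdf_ge0. Qed.

Lemma gaussian_density_cons n x z :
  gaussian_density n.+1 (x :: z) = normal_pdf 0 s x * gaussian_density n z.
Proof. by rewrite /gaussian_density big_ord_recl. Qed.

Lemma measurable_nth n j : measurable_fun setT (fun z : n.-tuple R => z`_j).
Proof.
have [jn|nj] := ltnP j n; last first.
  rewrite (_ : (fun _ => _) = cst 0); first exact: measurable_cst.
  by apply/funext => z /=; rewrite nth_default// size_tuple.
rewrite (_ : (fun _ => _) = fun z : n.-tuple R => tnth z (Ordinal jn)).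
  exact: measurable_tnth.
by apply/funext => z; rewrite (tnth_nth 0).
Qed.

Lemma measurable_gaussian_density n :
  measurable_fun setT (fun z : n.-tuple R => gaussian_density n z).
Proof.
apply: measurable_prod => i _.
apply: (measurableT_comp (measurable_normal_pdf 0 s)).
exact: measurable_nth.
Qed.

(** Induction on the dimension: independence makes the joint law of the first coordinate and the
    remaining tuple a product measure, to which Tonelli applies. *)
Lemma ge0_integral_gaussian_vector n (X : 'I_n -> T -> R) :
  (forall i, measurable_fun setT (X i)) ->
  mutually_independent P X ->
  (forall i (A : set R), measurable A -> P (X i @^-1` A) = normal_prob 0 s A) ->
  forall F : n.-tuple R -> \bar R, measurable_fun setT F ->
  (forall z, 0 <= F z)%E ->
  (\int[P]_w F [tuple X i w | i < n]
   = tuple_integral (fun z => F z * (gaussian_density n z)%:E))%E.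
Proof.
elim: n X => [|n ih] X mX iX lX F mF F0 /=.
  rewrite /gaussian_density big_ord0 mule1.
  under eq_integral do rewrite tuple0.
  transitivity (F [tuple] * P setT)%E; first exact: integral_cst.
  by rewrite probability_setT mule1.
have mX' : measurable_fun setT (fun w => [tuple X (lift ord0 i) w | i < n]).
  exact: measurable_mktuple.
have tE w : [tuple X i w | i < n.+1]
    = [tuple of X ord0 w :: [tuple X (lift ord0 i) w | i < n]].
  apply: eq_from_tnth => i; rewrite tnth_mktuple.
  have [j ->|->] := unliftP ord0 i; last by rewrite tnth0.
  by rewrite tnthS tnth_mktuple.
under eq_integral do rewrite tE.
pose X' : {mfun T >-> n.-tuple R} :=
  HB.pack (fun w => [tuple X (lift ord0 i) w | i < n])
    (isMeasurableFun.Build _ _ _ _ _ mX').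
have mXX : measurable_fun setT
    (fun w => (X ord0 w : measurableTypeR R,
               [tuple X (lift ord0 i) w | i < n])).
  apply: measurable_fun_pair => //; exact: mX.
pose FF (p : measurableTypeR R * n.-tuple R) := F [tuple of p.1 :: p.2].
have mFF : measurable_fun setT FF by exact: measurable_tuple_cons.
have FF0 p : (0 <= FF p)%E by exact: F0.
transitivity (\int[image_measure P mXX]_p FF p)%E.
  by rewrite ge0_integral_image.
transitivity (\int[(normal_prob 0 s \x distribution P X')%E]_p FF p)%E.
  apply: eq_measure_integral => B mB _; apply/esym.
  apply: product_measure_unique mB => A B' mA mB'.
  rewrite [RHS](_ : _ = P (X ord0 @^-1` A)
    * P ((fun w => [tuple X (lift ord0 i) w | i < n]) @^-1` B'))%E.
    exact: (mutually_independent_head mX iX).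
  by rewrite lX.
rewrite fubini_tonelli1// /fubini_F ge0_integral_normal_prob//; first last.
- by move=> x; apply: integral_ge0.
- exact: (@measurable_fun_fubini_tonelli_F _ _ _ _ _ (distribution P X') FF mFF FF0).
apply: eq_integral => x _.
have mFx : measurable_fun setT (fun z : n.-tuple R => F [tuple of x :: z]).
  exact: measurable_tuple_cons2.
rewrite [X in (X * _)%E](_ : _
    = \int[P]_w F [tuple of x :: [tuple X (lift ord0 i) w | i < n]])%E; last first.
  exact: (ge0_integral_image P mX').
have /= -> := ih (fun i => X (lift ord0 i)) _ (mutually_independent_lift iX) _
  (fun z => F [tuple of x :: z]) mFx _ => //.
rewrite muleC -ge0_tuple_integralZl//.
- congr (tuple_integral _); apply/funext => z.
  by rewrite gaussian_density_cons EFinM muleCA.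
- exact: normal_pdf_ge0.
- apply: emeasurable_funM => //; apply/measurable_EFinP.
  exact: measurable_gaussian_density.
- by move=> z; rewrite mule_ge0// lee_fin gaussian_density_ge0.
- by move=> i A mA; exact: lX.
Qed.

End gaussian_vector.

(** * From the Trotter integrand to Gaussian increments *)

Section bridge_density.
Context {R : realType}.

(** With S_j the partial sums of the increments this is x0 + sg (S_j - (j / N) S_N), a walk tied
    down at time N. It is the Brownian loop at time j / N when the z_i are Brownian increments and
    [sg] is sqrt(beta / m). *)
Definition bridge_path (sg x0 : R) (N : nat) (z : nat -> R) (j : nat) : R :=
  x0 + sg * (\sum_(i < j) z i - j%:R / N%:R * \sum_(i < N) z i).

Lemma tuple_integral_rcons n (F : seq R -> \bar R) :
  tuple_integral (fun z : n.+1.-tuple R => F z)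
  = tuple_integral (fun s : n.-tuple R => \int[lebesgue_measure]_y F (rcons s y))%E.
Proof.
elim: n F => [//|n ih] F.
rewrite [LHS]/=; apply: eq_integral => x _.
exact: (ih (fun s => F (x :: s))).
Qed.

Lemma nth_triangular_map (x0 sc : R) (a : seq R -> R) (h s : seq R) (j : nat) :
  (j < size s)%N ->
  nth x0 (triangular_map sc a h s) j = sc * s`_j + a (h ++ take j s).
Proof.
elim: s h j => [//|x s ih] h [|j] /=; first by rewrite cats0.
by rewrite ltnS => js; rewrite ih// cat_rcons.
Qed.

Lemma size_triangular_map (sc : R) (a : seq R -> R) (h s : seq R) :
  size (triangular_map sc a h s) = size s.
Proof. by elim: s h => [//|x s ih] h /=; rewrite ih. Qed.

Lemma sum_take (s : seq R) (j : nat) : (j <= size s)%N ->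
  \sum_(y <- take j s) y = \sum_(i < j) s`_i.
Proof.
move=> js; rewrite (big_nth 0) size_takel// big_mkord.
by apply: eq_bigr => i _; rewrite nth_take.
Qed.

Lemma sum_nth (s : seq R) : \sum_(y <- s) y = \sum_(i < size s) s`_i.
Proof. by rewrite -sum_take// take_size. Qed.

(** Chosen so that [triangular_map sg] carries the first N - 1 increments to the nodes 1, ..., N - 1
    of the bridge with total increment [W]. After the history [h], the node being computed has index
    [(size h).+1]. *)
Definition bridge_offset (sg x0 W : R) (N : nat) (h : seq R) : R :=
  x0 + sg * (\sum_(y <- h) y - (size h).+1%:R / N%:R * W).

(** The last entry of [z] is forced by the total increment [W]. At j = N the two sides agree because
    [loop_node] falls back on its default [x0] and the bridge returns to [x0]. *)
Lemma loop_node_triangular (sg x0 W : R) (s : seq R) (N j : nat) :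
  N = (size s).+1 ->
  let z := rcons s (W - \sum_(y <- s) y) in
  (j <= N)%N ->
  loop_node x0 (triangular_map sg (bridge_offset sg x0 W N) [::] s) j
  = bridge_path sg x0 N (fun i => z`_i) j.
Proof.
move=> NE z jN; rewrite /loop_node /bridge_path.
have zN : \sum_(i < N) z`_i = W.
  by rewrite NE -(size_rcons s (W - \sum_(y <- s) y)) -sum_nth big_rcons/= addrC subrK.
rewrite zN NE; case: j jN => [|j] jN /=.
  by rewrite big_ord0 mul0r mul0r subrr mulr0 addr0.
move: jN; rewrite NE ltnS leq_eqVlt => /predU1P[->|js].
  rewrite nth_default ?size_triangular_map// -NE zN NE divff ?pnatr_eq0// mul1r.
  by rewrite subrr mulr0 addr0.
rewrite nth_triangular_map//= /bridge_offset size_takel 1?ltnW//.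
rewrite sum_take 1?ltnW// big_ord_recr/= /z nth_rcons js.
under [X in _ + sg * (X + _ - _)]eq_bigr => i _.
  rewrite nth_rcons (ltn_trans (ltn_ord i) js).
  over.
by ring.
Qed.

(** The steps of the bridge are sg (z_j - W / N) with W the total increment, and their squares add
    up to sg^2 (sum z_j^2 - W^2 / N). The factor sg^2 = beta / m turns the kinetic coefficient into
    N / 2. *)
Lemma loop_action_bridge (m beta x0 : R) (N : nat) (V : R -> R) (z : nat -> R) :
  0 < m -> 0 < beta -> (0 < N)%N ->
  let sg := Num.sqrt (beta / m) in
  loop_action m beta N V (bridge_path sg x0 N z)
  = beta / N%:R * \sum_(j < N) V (bridge_path sg x0 N z j)
    + (N%:R / 2 * \sum_(j < N) z j ^+ 2 - (\sum_(j < N) z j) ^+ 2 / 2).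
Proof.
move=> m0 b0 N0 sg; rewrite /loop_action; congr +%R.
have N0' : N%:R != 0 :> R by rewrite pnatr_eq0 -lt0n.
have sg2 : sg ^+ 2 = beta / m by rewrite sqr_sqrtr// divr_ge0// ltW.
set W := \sum_(j < N) z j.
under eq_bigr => j _.
  rewrite (_ : _ ^+ 2 = beta / m * (z j ^+ 2 - W / N%:R * z j *+ 2 + (W / N%:R) ^+ 2)); last first.
    rewrite -sg2 /bridge_path big_ord_recr/= -/W -natr1.
    by field.
  over.
rewrite -mulr_sumr big_split/= sumrB sumr_const card_ord.
rewrite (_ : \sum_(i < N) _ *+ 2 = W / N%:R * W *+ 2); last first.
  by rewrite sumrMnl -mulr_sumr.
rewrite -(mulr_natr (_ * W)) -(mulr_natr (_ ^+ 2)); field.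
by rewrite N0' (gt_eqF m0) (gt_eqF b0).
Qed.

Lemma gaussian_density_sqrtV (N : nat) (z : seq R) : (0 < N)%N ->
  gaussian_density (Num.sqrt N%:R^-1) N z
  = normal_peak (Num.sqrt N%:R^-1) ^+ N
    * expR (- (N%:R / 2 * \sum_(j < N) z`_j ^+ 2)).
Proof.
move=> N0; rewrite /gaussian_density normal_pdfE; last first.
  by rewrite gt_eqF// sqrtr_gt0 invr_gt0 ltr0n.
rewrite big_split/= prodr_const card_ord; congr *%R.
rewrite mulr_sumr -sumrN expR_sum; apply: eq_bigr => j _.
rewrite /normal_fun subr0 sqr_sqrtr ?invr_ge0//.
congr expR; rewrite -mulr_natr; field.
by rewrite pnatr_eq0 -lt0n.
Qed.

Lemma integral_expR_sqr :
  (\int[lebesgue_measure]_x (expR (- (x ^+ 2 / 2)))%:E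
   = ((@normal_peak R 1)^-1)%:E)%E.
Proof.
have pk0 : 0 < @normal_peak R 1 by rewrite normal_peak_gt0// oner_neq0.
rewrite -[RHS]mule1 -(@integral_normal_pdf R 0 1) -ge0_integralZl//=.
- apply: eq_integral => x _; rewrite normal_pdfE ?oner_neq0//.
  rewrite -EFinM mulrA mulVf ?gt_eqF// mul1r /normal_fun subr0 expr1n.
  by rewrite mulNr.
- by apply/measurable_EFinP; exact: measurable_normal_pdf.
- by move=> x _; rewrite lee_fin normal_pdf_ge0.
- by rewrite lee_fin invr_ge0 ltW.
Qed.

Lemma measurable_bridge_path d (T : measurableType d) (sg : R) N j
    (x : T -> R) (z : nat -> T -> R) :
  measurable_fun setT x -> (forall i, (i < maxn j N)%N -> measurable_fun setT (z i)) ->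
  measurable_fun setT (fun t => bridge_path sg (x t) N (z^~ t) j).
Proof.
move=> mx mz; apply: measurable_funD => //; apply: measurable_funM => //.
apply: measurable_funB => //.
  apply: measurable_sum => i; apply: mz.
  by rewrite (leq_trans (ltn_ord i))// leq_maxl.
apply: measurable_funM => //; apply: measurable_sum => i; apply: mz.
by rewrite (leq_trans (ltn_ord i))// leq_maxr.
Qed.

Lemma measurable_trotter_weight (m beta x0 : R) (n N : nat) (V : R -> R) :
  measurable_fun setT V -> measurable_fun setT (fun xs : n.-tuple R =>
    expR (- loop_action m beta N V (loop_node x0 xs))).
Proof.
move=> mV.
have mnode j : measurable_fun setT (fun xs : n.-tuple R => loop_node x0 xs j).
  case: j => [|j]; first exact: measurable_cst.
  have [jn|nj] := ltnP j n.
    apply: eq_measurable_fun (@measurable_nth R n j) => xs _.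
    by rewrite /loop_node/=; apply: set_nth_default; rewrite size_tuple.
  apply: eq_measurable_fun (@measurable_cst _ _ (n.-tuple R) R setT x0) => xs _.
  by rewrite /loop_node/= nth_default// size_tuple.
apply: measurableT_comp => //; apply: measurableT_comp => //.
apply: measurable_funD.
  apply: measurable_funM => //; apply: measurable_sum => j.
  exact: (measurableT_comp mV).
apply: measurable_funM => //; apply: measurable_sum => j.
by apply: measurable_funX; apply: measurable_funB.
Qed.

(** The left side has N - 1 integrations and the right side N. The additional variable is the total
    increment W, independent of the bridge; its weight exp(- W^2 / 2) factors out and integrates to
    sqrt(2 pi). *)
Lemma trotter_bridge (m beta x0 : R) (n : nat) (V : R -> R) :
  0 < m -> 0 < beta -> measurable_fun setT V ->
  let N := n.+1 in
  let sg := Num.sqrt (beta / m) in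
  (((m * N%:R / (2 * pi * beta)) `^ (N%:R / 2))%:E
     * tuple_integral (fun xs : n.-tuple R =>
         (expR (- loop_action m beta N V (loop_node x0 xs)))%:E)
   = (Num.sqrt (m / (2 * pi * beta)))%:E
     * tuple_integral (fun z : N.-tuple R =>
         (expR (- (beta / N%:R
                   * \sum_(j < N) V (bridge_path sg x0 N (fun i => z`_i) j))))%:E
         * (gaussian_density (Num.sqrt N%:R^-1) N z)%:E))%E.
Proof.
move=> m0 b0 mV N sg.
have sg0 : 0 < sg by rewrite sqrtr_gt0 divr_gt0.
set s := Num.sqrt N%:R^-1.
have s0 : s != 0 by rewrite gt_eqF// sqrtr_gt0 invr_gt0 ltr0n.
have pk0 : 0 < normal_peak s by exact: normal_peak_gt0.
pose act (xs : seq R) := expR (- loop_action m beta N V (loop_node x0 xs)).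
pose F (z : seq R) : \bar R := ((expR (- (beta / N%:R
    * \sum_(j < N) V (bridge_path sg x0 N (fun i => z`_i) j))))%:E
  * (gaussian_density s N z)%:E)%E.
(* In the coordinates formed by the first n increments and the total W, the term - W^2 / 2 of
   [loop_action_bridge] is what separates W from the loop weight. *)
have FE (W : R) (xs : n.-tuple R) : F (rcons xs (W - \sum_(y <- xs) y))
    = ((normal_peak s ^+ N * expR (- (W ^+ 2 / 2)))%:E
      * (act (triangular_map sg (bridge_offset sg x0 W N) [::] xs))%:E)%E.
  have szE : (size xs).+1 = N by rewrite size_tuple.
  rewrite /F gaussian_density_sqrtV// -!EFinM; congr EFin.
  rewrite mulrCA -[in RHS]mulrA; congr *%R; rewrite -!expRD; congr expR.
  rewrite /act (_ : loop_action _ _ _ _ _ = loop_action m beta N V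
    (bridge_path sg x0 N (fun i => (rcons xs (W - \sum_(y <- xs) y))`_i))); last first.
    rewrite /loop_action; congr (_ * _ + _ * _); apply: eq_bigr => j _.
      by rewrite (loop_node_triangular _ _ _ (esym szE))// ltnW.
    by rewrite !(loop_node_triangular _ _ _ (esym szE))// ltnW.
  rewrite loop_action_bridge//.
  rewrite [X in _ - X ^+ 2 / 2](_ : _ = W); first by ring.
  have := sum_nth (rcons xs (W - \sum_(y <- xs) y)).
  by rewrite size_rcons szE big_rcons/= addrC subrK => e; exact/esym.
have mact : measurable_fun setT (fun xs : n.-tuple R => (act xs)%:E).
  by apply/measurable_EFinP; exact: measurable_trotter_weight.
have mF : measurable_fun setT (fun z : N.-tuple R => F z).
  apply: emeasurable_funM; apply/measurable_EFinP; last first.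
    exact: measurable_gaussian_density.
  apply: measurableT_comp => //; apply: measurableT_comp => //.
  apply: measurable_funM => //; apply: measurable_sum => j.
  apply: (measurableT_comp mV).
  by apply: measurable_bridge_path => // i _; exact: measurable_nth.
have F0 z : (0 <= F z)%E.
  by rewrite mule_ge0 ?lee_fin ?expR_ge0 ?gaussian_density_ge0.
have mrc (g : R -> n.-tuple R -> R) :
    measurable_fun setT (fun p : R * n.-tuple R => g p.1 p.2) ->
    measurable_fun setT (fun p : R * n.-tuple R => F (rcons p.2 (g p.1 p.2))).
  move=> mg.
  apply: (measurableT_comp mF
    (g := fun p : R * n.-tuple R => [tuple of rcons p.2 (g p.1 p.2)])).
  apply/measurable_fun_tnthP => i.
  have [jn|nj] := ltnP i n.
    apply: eq_measurable_fun (measurableT_comp (@measurable_nth R n i)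
      (@measurable_snd _ _ R (n.-tuple R))) => p _ /=.
    by rewrite (tnth_nth 0) nth_rcons size_tuple jn.
  apply: eq_measurable_fun mg => p _ /=.
  rewrite (tnth_nth 0) nth_rcons size_tuple ltnNge nj/= ifT//.
  by rewrite eqn_leq nj andbT -ltnS.
have msum : measurable_fun setT (fun xs : n.-tuple R => \sum_(y <- xs) y).
  apply: eq_measurable_fun (@measurable_sum _ (n.-tuple R) R setT _
    (index_enum 'I_n) (fun i xs => xs`_i) (fun i => @measurable_nth R n i)) => xs _.
  by rewrite sum_nth size_tuple.
rewrite [X in _ = (_ * X)%E](_ : _
  = tuple_integral (fun z : n.+1.-tuple R => F z))//.
rewrite (tuple_integral_rcons n F).
(* For fixed first increments, the last increment y is replaced by the total W, a translation of the
   line. *)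
have -> : (fun xs : n.-tuple R => \int[lebesgue_measure]_y F (rcons xs y))%E
    = (fun xs : n.-tuple R => \int[lebesgue_measure]_W
        F (rcons xs (W - \sum_(y <- xs) y)%R))%E.
  apply/funext => xs; apply/esym.
  rewrite (ge0_integralT_shift _ (f := fun y => F (rcons xs y)))//.
  apply: (measurableT_comp (mrc (fun y _ => y) _) (g := fun y => (y, xs))) => //.
  exact: measurable_fst.
have mG : measurable_fun setT (fun p : R * n.-tuple R =>
    F (rcons p.2 (p.1 - \sum_(y <- p.2) y))).
  apply: (mrc (fun W xs => W - \sum_(y <- xs) y)).
  by apply: measurable_funB => //; exact: (measurableT_comp msum).
have /= -> := @ge0_tuple_integral_exchange R n
  (fun W xs => F (rcons xs (W - \sum_(y <- xs) y))) mG (fun _ _ => F0 _).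
set I := tuple_integral _.
have I0 : (0 <= I)%E by apply: tuple_integral_ge0 => xs; rewrite lee_fin expR_ge0.
transitivity ((Num.sqrt (m / (2 * pi * beta)))%:E
  * \int[lebesgue_measure]_W ((normal_peak s ^+ N * sg ^- n)%:E
     * I * (expR (- (W ^+ 2 / 2)))%:E))%E; last first.
  congr (_ * _)%E; apply: eq_integral => W _.
  under [in RHS]eq_fun do rewrite FE.
  have C0 : 0 <= normal_peak s ^+ N * expR (- (W ^+ 2 / 2)).
    by rewrite mulr_ge0// ?expR_ge0// exprn_ge0// ltW.
  (* The offsets depend on W but the Jacobian [sg ^- n] does not, so the inner integral is a
     multiple of [I] that sees W only through exp(- W^2 / 2). *)
  have := @tuple_integral_triangular R n sg (bridge_offset sg x0 W N) [::]
    (fun xs => (normal_peak s ^+ N * expR (- (W ^+ 2 / 2)))%:E * (act xs)%:E)%E sg0.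
  move=> /= ->; last 2 first.
  - by apply: emeasurable_funM.
  - by move=> xs; rewrite mule_ge0 ?lee_fin// expR_ge0.
  rewrite ge0_tuple_integralZl//; last by move=> xs; rewrite lee_fin expR_ge0.
  rewrite -/I !muleA -!EFinM [in LHS]muleAC -EFinM; congr (_%:E * _)%E.
  by ring.
rewrite ge0_integralZl//; last 2 first.
- apply/measurable_EFinP; apply: measurableT_comp => //.
  apply: measurableT_comp => //; apply: measurable_funM => //.
- by rewrite mule_ge0// lee_fin mulr_ge0// ?invr_ge0 exprn_ge0// ltW.
rewrite integral_expR_sqr muleAC -EFinM muleA -EFinM; congr (_%:E * _)%E.
have X0 : 0 <= m * N%:R / (2 * pi * beta).
  by rewrite divr_ge0 ?mulr_ge0 ?pi_ge0// ltW.
have -> : (m * N%:R / (2 * pi * beta)) `^ (N%:R / 2)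
    = Num.sqrt (m * N%:R / (2 * pi * beta)) ^+ N.
  by rewrite -powR12_sqrt// -powR_mulrn ?powR_ge0// -powRrM [N%:R / 2]mulrC.
(* Each of the N Gaussian densities brings one factor [sg]. The Jacobian cancels n of them and
   [pk1E] the last one. *)
have pkE : normal_peak s = sg * Num.sqrt (m * N%:R / (2 * pi * beta)).
  rewrite /normal_peak /s /sg; move: (@pi R) (pi_gt0 R) => p p0.
  rewrite -sqrtrM ?divr_ge0 ?ltW// sqr_sqrtr ?invr_ge0// -sqrtrV; last first.
    by rewrite mulrn_wge0// mulr_ge0 ?invr_ge0// ltW.
  congr Num.sqrt; rewrite -mulr_natr; field.
  by rewrite (gt_eqF m0) (gt_eqF b0) (gt_eqF p0) pnatr_eq0.
have pk1E : (@normal_peak R 1)^-1 = sg^-1 / Num.sqrt (m / (2 * pi * beta)).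
  rewrite /normal_peak /sg; move: (@pi R) (pi_gt0 R) => p p0.
  rewrite invrK expr1n mul1r -!sqrtrV ?divr_ge0 ?mulr_ge0 ?ltW//.
  rewrite -sqrtrM ?invr_ge0 ?divr_ge0 ?ltW//.
  congr Num.sqrt; rewrite -mulr_natr; field.
  by rewrite (gt_eqF m0) (gt_eqF b0) (gt_eqF p0).
rewrite pk1E pkE exprMn /N exprS.
have c0 : Num.sqrt (m / (2 * pi * beta)) != 0.
  by rewrite gt_eqF// sqrtr_gt0 divr_gt0// !mulr_gt0// pi_gt0.
rewrite [sg ^+ n.+1]exprS.
have sgn0 : sg ^+ n != 0 by rewrite expf_neq0// gt_eqF.
have sg0' : sg != 0 by rewrite gt_eqF.
move: c0 sgn0; move: (Num.sqrt (m / _)) (sg ^+ n) (Num.sqrt _ ^+ n).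
move: (Num.sqrt (m * _ / _)) => X c q Y c0 q0.
by field; rewrite c0 q0 sg0'.
Qed.

End bridge_density.

(** * Nodes of the Brownian loop *)

Lemma mutually_independent_perm (R : realType) d (T : measurableType d)
    (P : probability T R) n (X : 'I_n -> T -> R) (p : {perm 'I_n}) :
  mutually_independent P X -> mutually_independent P (fun i => X (p i)).
Proof.
move=> iX A mA.
have := iX (fun i => A ((p^-1)%g i)) (fun i => mA _).
rewrite (reindex_inj (@perm_inj _ p))/=.
under eq_bigr do rewrite permK.
move=> <-; congr (P _); apply/seteqP; split => w /= Aw i _ /=.
  by have := Aw ((p^-1)%g i) Logic.I; rewrite /= permKV.
by have := Aw (p i) Logic.I; rewrite /= permK.
Qed.

Lemma eq_bridge_path (R : realType) (sg x : R) N (z z' : nat -> R) j :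
  (forall i, (i < maxn j N)%N -> z i = z' i) ->
  bridge_path sg x N z j = bridge_path sg x N z' j.
Proof.
move=> zz; rewrite /bridge_path; congr (_ + _ * (_ - _ * _)).
  by apply: eq_bigr => i _; rewrite zz// (leq_trans (ltn_ord i))// leq_maxl.
by apply: eq_bigr => i _; rewrite zz// (leq_trans (ltn_ord i))// leq_maxr.
Qed.

Section brownian_nodes.
Context {R : realType} d (T : measurableType d) (P : probability T R).
Variables (m beta : R) (B : R -> T -> R).
Hypothesis hB : standard_brownian_motion P B.

Definition increment (M i : nat) (w : T) : R :=
  B (i.+1%:R / M%:R) w - B (i%:R / M%:R) w.

Definition increments (M : nat) (w : T) : M.-tuple R :=
  [tuple increment M i w | i < M].

Definition node (M : nat) (x : R) (w : T) (j : nat) : R :=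
  brownian_loop m beta B x w (j%:R / M%:R).

Let sg := Num.sqrt (beta / m).

Lemma nth_increments M w i : (i < M)%N -> (increments M w)`_i = increment M i w.
Proof. by move=> iM; rewrite -[i]/(nat_of_ord (Ordinal iM)) nth_mktuple. Qed.

Lemma sum_increment M w j : \sum_(i < j) increment M i w = B (j%:R / M%:R) w.
Proof.
elim: j => [|j ih]; first by rewrite big_ord0 mul0r (bm_start hB).
by rewrite big_ord_recr/= ih /increment addrC subrK.
Qed.

Lemma node_bridge M x w j : (0 < M)%N ->
  node M x w j = bridge_path sg x M (fun i => increment M i w) j.
Proof.
move=> M0; rewrite /node /brownian_loop /bridge_path !sum_increment.
by rewrite divff// pnatr_eq0 -lt0n.
Qed.

Lemma node_bridge_tuple M x w j : (0 < M)%N -> (j <= M)%N ->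
  node M x w j = bridge_path sg x M (fun i => (increments M w)`_i) j.
Proof.
move=> M0 jM; rewrite node_bridge//; apply: eq_bridge_path => i.
by rewrite (maxn_idPr jM) => iM; rewrite nth_increments.
Qed.

Lemma node0 M x w : node M x w 0 = x.
Proof.
by rewrite /node /brownian_loop mul0r (bm_start hB) mul0r subrr mulr0 addr0.
Qed.

Lemma node_last M x w : (0 < M)%N -> node M x w M = x.
Proof.
move=> M0; rewrite /node /brownian_loop divff ?pnatr_eq0 -?lt0n//.
by rewrite mul1r subrr mulr0 addr0.
Qed.

Lemma nodeD M x w j : node M x w j = x + node M 0 w j.
Proof. by rewrite /node /brownian_loop add0r. Qed.

Lemma measurable_increment M i : measurable_fun setT (increment M i).
Proof.
by apply: measurable_funB; apply: (bm_measurable hB); rewrite divr_ge0.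
Qed.

Lemma measurable_node M j :
  measurable_fun setT (fun p : R * T => node M p.1 p.2 j).
Proof.
have mB t : 0 <= t -> measurable_fun setT (fun p : R * T => B t p.2).
  by move=> t0; exact: (measurableT_comp (bm_measurable hB t0)).
apply: measurable_funD => //; apply: measurable_funM => //.
by apply: measurable_funB; [|apply: measurable_funM => //]; apply: mB;
  rewrite ?divr_ge0.
Qed.

Lemma increment_law M i (A : set R) : (0 < M)%N -> measurable A ->
  P (increment M i @^-1` A) = normal_prob 0 (Num.sqrt M%:R^-1) A.
Proof.
move=> M0 mA.
have e : i.+1%:R / M%:R - i%:R / M%:R = M%:R^-1 :> R.
  by rewrite -mulrBl -natr1 [_ + 1]addrC addrK mul1r.
rewrite -e; apply: (bm_increments_normal hB) mA.
  by rewrite divr_ge0.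
by rewrite ltr_pM2r ?invr_gt0 ?ltr0n// ltr_nat.
Qed.

Lemma increment_independent M :
  mutually_independent P (fun i : 'I_M => increment M i).
Proof.
apply: (bm_increments_independent hB (t := fun i => i%:R / M%:R)).
  by rewrite mul0r.
by move=> i; rewrite ler_wpM2r ?invr_ge0// ler_nat.
Qed.

Lemma integral_increments M (F : M.-tuple R -> \bar R) : (0 < M)%N ->
  measurable_fun setT F -> (forall z, 0 <= F z)%E ->
  (\int[P]_w F (increments M w) = tuple_integral (fun z =>
    F z * (gaussian_density (Num.sqrt M%:R^-1) M z)%:E))%E.
Proof.
move=> M0 mF F0.
apply: (@ge0_integral_gaussian_vector _ _ _ P (Num.sqrt M%:R^-1) M
  (fun i : 'I_M => increment M i)) => //.
- by move=> i; exact: measurable_increment.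
- exact: increment_independent.
- by move=> i A mA; exact: increment_law.
Qed.

(** The permuted increments are again independent with the same normal law, so both sides are one
    and the same Gaussian integral. *)
Lemma integral_increments_perm M (F : M.-tuple R -> \bar R) (p : {perm 'I_M}) :
  (0 < M)%N -> measurable_fun setT F -> (forall z, 0 <= F z)%E ->
  (\int[P]_w F [tuple increment M (p i) w | i < M]
   = \int[P]_w F (increments M w))%E.
Proof.
move=> M0 mF F0; rewrite integral_increments//.
apply: (@ge0_integral_gaussian_vector _ _ _ P (Num.sqrt M%:R^-1) M
  (fun i : 'I_M => increment M (p i))) => //.
- by move=> i; exact: measurable_increment.
- exact: (mutually_independent_perm p (@increment_independent M)).
- by move=> i A mA; exact: increment_law.
Qed.

Lemma trotter_inner (n : nat) (x : R) (V : R -> R) :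
  0 < m -> 0 < beta -> measurable_fun setT V ->
  let N := n.+1 in
  (((m * N%:R / (2 * pi * beta)) `^ (N%:R / 2))%:E
     * tuple_integral (fun xs : n.-tuple R =>
         (expR (- loop_action m beta N V (loop_node x xs)))%:E)
   = (Num.sqrt (m / (2 * pi * beta)))%:E
     * \int[P]_w (expR (- (beta / N%:R * \sum_(j < N) V (node N x w j))))%:E)%E.
Proof.
move=> m0 b0 mV N; rewrite trotter_bridge// -/N -/sg; congr (_ * _)%E.
pose F (z : N.-tuple R) : \bar R := (expR (- (beta / N%:R
  * \sum_(j < N) V (bridge_path sg x N (fun i => z`_i) j))))%:E.
rewrite -(@integral_increments N F)//.
- apply: eq_integral => w _; rewrite /F; congr (expR (- (_ * _)))%:E.
  by apply: eq_bigr => j _; rewrite node_bridge_tuple// ltnW.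
- apply/measurable_EFinP; apply: measurableT_comp => //.
  apply: measurableT_comp => //; apply: measurable_funM => //.
  apply: measurable_sum => j; apply: (measurableT_comp mV).
  by apply: measurable_bridge_path => // i _; exact: measurable_nth.
- by move=> z; rewrite lee_fin expR_ge0.
Qed.

(** Paths are sequences indexed by [nat], so that shifting or reflecting nodes needs no bounded
    indices. The second clause allows a passage to tuples, where measurability makes sense. *)
Definition node_functional (M : nat) (Phi : (nat -> R) -> \bar R) : Prop :=
  [/\ measurable_fun setT (fun y : M.-tuple R => Phi (fun j => y`_j)),
      forall y y', (forall j, (j < M)%N -> y j = y' j) -> Phi y = Phi y'
    & forall y, (0 <= Phi y)%E].

Lemma measurable_node_functional d' (S : measurableType d') M Phi
    (y : S -> nat -> R) :
  node_functional M Phi ->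
  (forall j, (j < M)%N -> measurable_fun setT (fun s => y s j)) ->
  measurable_fun setT (fun s => Phi (y s)).
Proof.
move=> [mPhi ePhi _] my.
apply: (eq_measurable_fun (fun s => Phi (fun j => [tuple y s i | i < M]`_j))).
  move=> s _; apply: ePhi => j jM.
  by rewrite -[j]/(nat_of_ord (Ordinal jM)) nth_mktuple.
apply: (measurableT_comp mPhi (g := fun s => [tuple y s i | i < M])).
by apply: measurable_mktuple => i; exact: my.
Qed.

(** Reflecting node k about the midpoint of its neighbours exchanges the increments k - 1 and k. The
    total increment, hence the drift, is unchanged, and the increments are exchangeable. *)
Lemma reflect_node M k (x : R) Phi : (0 < k < M)%N -> node_functional M.+1 Phi ->
  (\int[P]_w Phi (fun j => if j == k
      then (node M x w k.-1 + node M x w k.+1 - node M x w k)%R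
      else node M x w j)
   = \int[P]_w Phi (node M x w))%E.
Proof.
move=> /andP[k0 kM] nPhi; have [mPhi ePhi Phi0] := nPhi.
have M0 : (0 < M)%N by exact: leq_trans kM.
have k1M : (k.-1 < M)%N by rewrite (leq_ltn_trans _ kM)// leq_pred.
pose i1 : 'I_M := Ordinal k1M; pose i2 : 'I_M := Ordinal kM.
pose F (z : M.-tuple R) := Phi (bridge_path sg x M (fun i => z`_i)).
have mF : measurable_fun setT F.
  apply: (measurable_node_functional
    (y := fun z : M.-tuple R => bridge_path sg x M (fun i => z`_i)) nPhi).
  move=> j _; apply: measurable_bridge_path => // i _.
  exact: measurable_nth.
transitivity (\int[P]_w F (increments M w))%E; last first.
  apply: eq_integral => w _; apply: ePhi => j; rewrite ltnS => jM.
  by rewrite node_bridge_tuple.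
rewrite -(integral_increments_perm (tperm i1 i2))//.
apply: eq_integral => w _; apply: ePhi => j; rewrite ltnS => jM.
set z := fun i => increment M i w.
pose z' i := if i == k.-1 then z k else if i == k then z k.-1 else z i.
have kk : (k == k.-1) = false by rewrite -[X in X == _](prednK k0) gtn_eqF.
have -> : bridge_path sg x M
    (fun i => [tuple increment M (tperm i1 i2 i0) w | i0 < M]`_i) j
    = bridge_path sg x M z' j.
  apply: eq_bridge_path => i; rewrite (maxn_idPr jM) => iM.
  rewrite -[in LHS]/(nat_of_ord (Ordinal iM)) nth_mktuple /z' permE /=.
  rewrite -!(inj_eq val_inj)/=.
  by case: eqP => // _; case: eqP.
(* The partial sums before and after the exchange differ at the index k only. *)
have sumz' l : (l <= M)%N ->
    \sum_(i < l) z' i = \sum_(i < l) z i + (if l == k then z k - z k.-1 else 0).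
  elim: l => [_|l ih lM].
    by rewrite !big_ord0 add0r; case: eqP => // k0'; rewrite -k0' in k0.
  rewrite !big_ord_recr/= ih; last exact: ltnW.
  rewrite /z'; have [->|lk1] := eqVneq l k.-1.
    rewrite prednK// eqxx eq_sym kk addr0.
    by ring.
  have [->|lk] := eqVneq l k.
    by rewrite gtn_eqF//; ring.
  rewrite ifF ?addr0//; apply/eqP => lk2.
  by move: lk1; rewrite -lk2 eqxx.
rewrite !node_bridge// -/z /bridge_path !sumz'//.
rewrite (gtn_eqF kM) addr0.
case: (eqVneq j k) => [->|_]; last by rewrite addr0.
have -> : \sum_(i < k.+1) z i = \sum_(i < k.-1) z i + z k.-1 + z k.
  rewrite big_ord_recr/=; congr +%R.
  by rewrite -[in LHS](prednK k0) big_ord_recr.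
have -> : \sum_(i < k) z i = \sum_(i < k.-1) z i + z k.-1.
  by rewrite -[in LHS](prednK k0) big_ord_recr.
have -> : k.+1%:R = k.-1%:R + 2 :> R.
  by rewrite -[in LHS](prednK k0) -addn2 natrD -natr1; ring.
have -> : k%:R = k.-1%:R + 1 :> R by rewrite natr1 prednK.
by ring.
by move=> z; exact: Phi0.
Qed.

Lemma ge0_integral_exchange (D : set R) (F : R -> T -> \bar R) :
  measurable D -> measurable_fun setT (fun p : R * T => F p.1 p.2) ->
  (forall x w, 0 <= F x w)%E ->
  (\int[lebesgue_measure]_(x in D) \int[P]_w F x w
   = \int[P]_w \int[lebesgue_measure]_(x in D) F x w)%E.
Proof.
move=> mD mF F0.
pose G (p : R * T) := ((\1_D p.1)%:E * F p.1 p.2)%E.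
have mG : measurable_fun setT G.
  apply: emeasurable_funM => //; apply/measurable_EFinP.
  exact: (measurableT_comp (measurable_indic mD)).
have G0 p : (0 <= G p)%E by rewrite mule_ge0// lee_fin.
have /= := @fubini_tonelli _ _ _ _ _ lebesgue_measure P G mG G0.
rewrite /fubini_F /fubini_G /G/= => FG.
rewrite integral_mkcond.
transitivity (\int[lebesgue_measure]_x \int[P]_w ((\1_D x)%:E * F x w))%E.
  apply: eq_integral => x _; rewrite patchE indicE; case: ifPn => xD.
    by under [RHS]eq_integral do rewrite mul1e.
  by under [RHS]eq_integral do rewrite mul0e; rewrite integral0.
rewrite FG; apply: eq_integral => w _.
rewrite [RHS]integral_mkcond; apply: eq_integral => x _.
by rewrite patchE indicE; case: ifPn => xD; rewrite ?mul1e ?mul0e.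
Qed.

(** A loop read from its node 1 is the loop with cyclically rotated increments, started at that
    node. For a fixed path this start is [x] plus a constant, and [period_domain] removes the
    constant from the integral over D. The integrals are exchanged for this purpose. *)
Lemma shift_nodes (D : set R) (L : R) M Phi : (0 < M)%N ->
  period_domain D L -> node_functional M Phi ->
  (forall y, Phi (fun j => y j + L) = Phi y) ->
  (\int[lebesgue_measure]_(x in D) \int[P]_w Phi (fun j => node M x w j.+1)
   = \int[lebesgue_measure]_(x in D) \int[P]_w Phi (node M x w))%E.
Proof.
move=> M0 [mD pD]; rewrite -(prednK M0); move: (M.-1) => K nPhi LPhi.
have [mPhi ePhi Phi0] := nPhi.
pose rot : {perm 'I_K.+1} := perm (@ordS_inj K.+1).
pose rinc w := [tuple increment K.+1 (rot i) w | i < K.+1].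
pose F (x : R) (z : K.+1.-tuple R) := Phi (bridge_path sg x K.+1 (fun i => z`_i)).
have mF : measurable_fun setT (fun p : R * K.+1.-tuple R => F p.1 p.2).
  apply: (measurable_node_functional (y := fun p : R * K.+1.-tuple R =>
    bridge_path sg p.1 K.+1 (fun i => p.2`_i)) nPhi) => j _.
  apply: measurable_bridge_path => // i _.
  exact: (measurableT_comp (@measurable_nth R K.+1 i)).
have mrinc : measurable_fun setT rinc.
  by apply: measurable_mktuple => i; exact: measurable_increment.
transitivity (\int[lebesgue_measure]_(x in D) \int[P]_w F x (rinc w))%E; last first.
  apply: eq_integral => x _.
  rewrite (@integral_increments_perm K.+1 (F x))//.
    apply: eq_integral => w _; apply: ePhi => j jM.
    by rewrite node_bridge_tuple// ltnW.
    apply: (measurableT_comp mF (g := fun z => (x, z))).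
    exact: measurable_fun_pair.
  by move=> z; exact: Phi0.
have mPn : measurable_fun setT
    (fun p : R * T => Phi (fun j => node K.+1 p.1 p.2 j.+1)).
  apply: (measurable_node_functional (y := fun p : R * T =>
    fun j => node K.+1 p.1 p.2 j.+1) nPhi) => j _.
  exact: measurable_node.
have mFr : measurable_fun setT (fun p : R * T => F p.1 (rinc p.2)).
  apply: (measurableT_comp mF (g := fun p : R * T => (p.1, rinc p.2))).
  by apply: measurable_fun_pair => //; exact: (measurableT_comp mrinc).
rewrite [LHS](@ge0_integral_exchange D
  (fun x w => Phi (fun j => node K.+1 x w j.+1)) mD mPn (fun _ _ => Phi0 _)).
rewrite [RHS](@ge0_integral_exchange D
  (fun x w => F x (rinc w)) mD mFr (fun _ _ => Phi0 _)).
apply: eq_integral => w _ /=.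
rewrite -[RHS](pD (fun x => F x (rinc w)) _ _ _ (node K.+1 0 w 1))//; first last.
- move=> x; rewrite /F -[RHS]LPhi; apply: ePhi => j _.
  by rewrite /bridge_path addrAC.
- by move=> x; exact: Phi0.
- apply: (measurableT_comp mF (g := fun x => (x, rinc w))).
  by apply: measurable_fun_pair => //; exact: measurable_cst.
apply: eq_integral => x _; apply: ePhi => j jM.
set z := fun i => increment K.+1 i w.
pose z' i := if i == K then z 0%N else z i.+1.
have -> : bridge_path sg (x + node K.+1 0 w 1) K.+1 (fun i => (rinc w)`_i) j
    = bridge_path sg (x + node K.+1 0 w 1) K.+1 z' j.
  apply: eq_bridge_path => i; rewrite (maxn_idPr (ltnW jM)) => iM.
  rewrite -[in LHS]/(nat_of_ord (Ordinal iM)) nth_mktuple /z' permE /=.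
  have [->|iK'] := eqVneq i K; first by rewrite modnn.
  by rewrite modn_small// ltnS ltn_neqAle iK'.
have zj l : (l <= K)%N -> \sum_(i < l) z' i = \sum_(i < l.+1) z i - z 0%N.
  move=> lM; rewrite big_ord_recl/= addrC addrA addNr add0r.
  apply: eq_bigr => i _; rewrite /z' ifF//.
  by rewrite ltn_eqF// (leq_trans (ltn_ord i)).
have zM : \sum_(i < K.+1) z' i = \sum_(i < K.+1) z i.
  by rewrite big_ord_recr/= zj// /z' eqxx subrK.
rewrite !node_bridge// -/z /bridge_path zM zj// [\sum_(i < 1) _]big_ord1.
by rewrite -[j.+1%:R]natr1; ring.
Qed.

End brownian_nodes.

(** * Growth bounds and Gaussian inequalities *)

Section tame_functions.
Context {R : realType}.

(* What is used of a C^2 function with a linearly bounded first derivative and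
   a bounded second derivative. *)
Definition tame (K : R) (f : R -> R) : Prop :=
  [/\ continuous f,
      forall x y, `|f y - f x| <= K * (1 + `|x| + `|y|) * `|y - x|
    & forall c t, `|f (c + t) + f (c - t) - 2 * f c| <= 2 * K * t ^+ 2].

Lemma mean_value (f : R -> R) (x y : R) : (forall z, derivable f z 1) ->
  exists2 c, Num.min x y <= c <= Num.max x y & f y - f x = derive1 f c * (y - x).
Proof.
move=> df.
have isd z : is_derive z (1 : R) f (derive1 f z) by rewrite derive1E; exact/derivableP.
have cf a b : {within `[a, b], continuous f}.
  by apply: derivable_within_continuous => z _.
have [xy|yx|->] := ltgtP x y.
- have [c] := MVT xy (fun z _ => isd z) (cf x y).
  by rewrite in_itv/= => /andP[xc cy] e; exists c => //; rewrite !ltW.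
- have [c] := MVT yx (fun z _ => isd z) (cf y x).
  rewrite in_itv/= => /andP[xc cy] e; exists c; first by rewrite !ltW.
  by rewrite -opprB e -mulrN opprB.
- by exists y; rewrite ?lexx// !subrr mulr0.
Qed.

(** A point between x and y has absolute value at most |x| + |y|, whence the linear growth of the
    Lipschitz constant. For the second difference the mean value theorem is used on each
    half-interval and once more on the derivative, between points at most 2t apart. *)
Lemma tame_C2 (K : R) (f : R -> R) : 0 <= K -> C2 f ->
  (forall x, `|f^`() x| <= K * (1 + `|x|)) -> (forall x, `|f^`(2) x| <= K) ->
  tame K f.
Proof.
move=> K0 [df ddf _] f1 f2.
have cf : continuous f.
  by move=> x; apply/differentiable_continuous/derivable1_diffP.
have f2' x : `|(f^`())^`() x| <= K by have := f2 x; rewrite derive1nS derive1n1.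
split => // [x y|c t].
  have [c /andP[c1 c2] ->] := mean_value x y df.
  rewrite normrM ler_wpM2r// (le_trans (f1 c))// ler_wpM2l//.
  rewrite -addrA lerD2l.
  have [xy|/ltW yx] := leP x y.
    move: c1 c2; rewrite (min_idPl xy) (max_idPr xy) => c1 c2.
    rewrite ler_norml; apply/andP; split.
      by have := ler_norm (- x); rewrite normrN; have := normr_ge0 y; lra.
    by have := ler_norm y; have := normr_ge0 x; lra.
  move: c1 c2; rewrite (min_idPr yx) (max_idPl yx) => c1 c2.
  rewrite ler_norml; apply/andP; split.
    by have := ler_norm (- y); rewrite normrN; have := normr_ge0 x; lra.
  by have := ler_norm x; have := normr_ge0 y; lra.
(* The second difference is even in t. *)
wlog t0 : t / 0 <= t => [H|].
  have [t0|t0] := leP 0 t; first exact: H.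
  have := H (- t); rewrite opprK sqrrN [f (c - t) + _]addrC; apply.
  by rewrite oppr_ge0 ltW.
have [a /andP[a1 a2] ea] := mean_value c (c + t) df.
have [b /andP[b1 b2] eb] := mean_value (c - t) c df.
have [z _ ez] := mean_value b a ddf.
have ct : c <= c + t by rewrite lerDl.
have tc : c - t <= c by rewrite gerBl.
move: a1 a2 b1 b2.
rewrite (min_idPl ct) (max_idPr ct) (min_idPl tc) (max_idPr tc) => a1 a2 b1 b2.
have -> : f (c + t) + f (c - t) - 2 * f c
    = (f (c + t) - f c) - (f c - f (c - t)) by ring.
rewrite ea eb.
have -> : derive1 f a * (c + t - c) - derive1 f b * (c - (c - t))
    = (derive1 f a - derive1 f b) * t by ring.
rewrite ez !normrM (ger0_norm t0) expr2 mulrA ler_wpM2r//.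
rewrite [2 * K]mulrC -mulrA; apply: ler_pM => //.
rewrite ger0_norm; lra.
Qed.

Lemma tameD_cst (K k : R) (f : R -> R) : tame K f -> tame K (fun x => f x + k).
Proof.
move=> [cf f1 f2]; split => [x|x y|c t].
- by apply: cvgD; [exact: cf|exact: cvg_cst].
- by rewrite opprD addrACA subrr addr0.
- by have := f2 c t; congr (`|_| <= _); ring.
Qed.

Lemma tame_cst (K k : R) : 0 <= K -> tame K (fun=> k).
Proof.
move=> K0; split => [x|x y|c t]; first exact: cvg_cst.
- by rewrite subrr normr0 !mulr_ge0// addr_ge0// addr_ge0.
- rewrite (_ : _ - _ = 0); last by ring.
  by rewrite normr0 mulr_ge0 ?sqr_ge0// mulr_ge0.
Qed.

Lemma tame_measurable K (f : R -> R) : tame K f -> measurable_fun setT f.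
Proof. by move=> [cf _ _]; exact: continuous_measurable_fun. Qed.

(** Jensen's inequality from the tangent of the exponential at - v: the deviations v - u_i add up to
    zero, so the linear terms cancel. *)
Lemma expR_mean_le (n : nat) (u : 'I_n.+1 -> R) :
  expR (- (n.+1%:R^-1 * \sum_i u i)) <= n.+1%:R^-1 * \sum_i expR (- u i).
Proof.
set v := n.+1%:R^-1 * _.
have vE : \sum_i (v - u i) = 0.
  rewrite sumrB sumr_const card_ord -[v *+ _]mulr_natl /v mulrA divff.
    by rewrite mul1r subrr.
  by rewrite pnatr_eq0.
rewrite ler_pdivlMl ?ltr0n//.
have -> : n.+1%:R * expR (- v) = \sum_(i < n.+1) expR (- v) * (1 + (v - u i)).
  rewrite -mulr_sumr big_split/= vE addr0 sumr_const card_ord.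
  by rewrite mulrnAr mulr1 mulr_natl.
apply: ler_sum => i _.
rewrite [X in _ <= expR X](_ : _ = - v + (v - u i)); last by ring.
by rewrite expRD ler_wpM2l ?expR_ge0// expR_ge1Dx.
Qed.

(** One term of the exponential series is kept. The exponent x^2 / (4 v) is half that of the centred
    normal density of variance v, so the product of the two remains integrable. *)
Lemma expr_even_le_expR (v x : R) (p : nat) : 0 < v ->
  x ^+ (2 * p.+1) <= (4 * v) ^+ p.+1 * (p.+1)`!%:R * expR (x ^+ 2 / (4 * v)).
Proof.
move=> v0.
have v4 : 0 < 4 * v by rewrite mulr_gt0.
have y0 : 0 <= x ^+ 2 / (4 * v) by rewrite divr_ge0 ?sqr_ge0// ltW.
have := expR_ge1Dxn p y0.
set e := expR _ => he.
have he' : (x ^+ 2 / (4 * v)) ^+ p.+1 / (p.+1)`!%:R <= e.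
  by apply: le_trans he; rewrite lerDr.
move: he'; rewrite ler_pdivrMr ?ltr0n ?fact_gt0// exprMn exprVn.
rewrite ler_pdivrMr ?exprn_gt0// exprM => /le_trans; apply.
by rewrite mulrC [e * _]mulrC mulrA.
Qed.

(** The surviving exponent - x^2 / (4 v) belongs to variance 2 v; the ratio of the normalising
    factors is sqrt 2. *)
Lemma normal_pdf_expR (v x : R) : 0 < v ->
  expR (x ^+ 2 / (4 * v)) * normal_pdf 0 (Num.sqrt v) x
  = Num.sqrt 2 * normal_pdf 0 (Num.sqrt (2 * v)) x.
Proof.
move=> v0.
have v20 : 0 < 2 * v by rewrite mulr_gt0.
rewrite !normal_pdfE ?gt_eqF ?sqrtr_gt0// /normal_peak /normal_fun !subr0.
rewrite !sqr_sqrtr ?ltW// mulrCA -expRD [in RHS]mulrA; congr (_ * expR _).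
- have pv : 0 < v * pi *+ 2 by rewrite mulrn_wgt0// mulr_gt0// pi_gt0.
  by rewrite -[2 * v * pi]mulrA -[in RHS]mulrnAr [in RHS]sqrtrM// invfM mulrA divff ?mul1r//.
- rewrite -(mulr_natr v) -(mulr_natr (2 * v)); field.
  by rewrite gt_eqF.
Qed.

End tame_functions.

(** * Eighth moments of increments and nodes *)

Section moments.
Context {R : realType} d (T : measurableType d) (P : probability T R).
Variables (m beta : R) (B : R -> T -> R).
Hypothesis hB : standard_brownian_motion P B.
Hypotheses (m0 : 0 < m) (b0 : 0 < beta).

(** The monomial is dominated by an exponential whose normal integral is known, which avoids
    computing Gaussian moments. Later only the scaling (t - s)^(p+1) matters. *)
Lemma increment_moment (p : nat) (s t : R) : 0 <= s -> s < t ->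
  (\int[P]_w ((B t w - B s w) ^+ (2 * p.+1))%:E
   <= ((4 * (t - s)) ^+ p.+1 * (p.+1)`!%:R * Num.sqrt 2)%:E)%E.
Proof.
move=> s0 st; have v0 : 0 < t - s by rewrite subr_gt0.
set v := t - s; set c := (4 * v) ^+ p.+1 * (p.+1)`!%:R.
have c0 : 0 <= c by rewrite mulr_ge0// exprn_ge0// mulr_ge0// ltW.
have t0 : 0 <= t by rewrite (le_trans s0)// ltW.
have mX : measurable_fun setT (B t \- B s : T -> measurableTypeR R).
  by apply: measurable_funB; exact: (bm_measurable hB).
have mp : measurable_fun setT (fun x : R => (x ^+ (2 * p.+1))%:E).
  exact/measurable_EFinP.
have p0 (x : R) : (0 <= (x ^+ (2 * p.+1))%:E)%E.
  by rewrite lee_fin exprM exprn_ge0// sqr_ge0.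
have -> : (\int[P]_w ((B t w - B s w) ^+ (2 * p.+1))%:E
    = \int[normal_prob 0 (Num.sqrt v)]_x (x ^+ (2 * p.+1))%:E)%E.
  transitivity (\int[image_measure P mX]_x (x ^+ (2 * p.+1))%:E)%E.
    by rewrite ge0_integral_image.
  apply: eq_measure_integral => A mA _.
  exact: (bm_increments_normal hB).
rewrite ge0_integral_normal_prob//.
have m2 : measurable_fun setT
    (fun x => (c * Num.sqrt 2 * normal_pdf 0 (Num.sqrt (2 * v)) x)%:E).
  apply/measurable_EFinP; apply: measurable_funM => //.
  exact: measurable_normal_pdf.
apply: (@le_trans _ _ (\int[lebesgue_measure]_x
    (c * Num.sqrt 2 * normal_pdf 0 (Num.sqrt (2 * v)) x)%:E)%E).
  apply: ge0_le_integral => //.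
  - by move=> x _; rewrite mule_ge0// lee_fin normal_pdf_ge0.
  - apply: emeasurable_funM => //; apply/measurable_EFinP.
    exact: measurable_normal_pdf.
  - move=> x _; rewrite -EFinM lee_fin -mulrA -normal_pdf_expR// mulrA.
    by rewrite ler_wpM2r ?normal_pdf_ge0// expr_even_le_expR.
under eq_integral do rewrite EFinM.
rewrite ge0_integralZl//=.
- by rewrite integral_normal_pdf mule1.
- by apply/measurable_EFinP; exact: measurable_normal_pdf.
- by move=> x _; rewrite lee_fin normal_pdf_ge0.
- by rewrite lee_fin mulr_ge0// sqrtr_ge0.
Qed.

End moments.

Lemma ge0_integral_le2 (R : realType) d (T : measurableType d)
    (mu : {measure set T -> \bar R}) (f g h : T -> R) (a b x y : R) :
  0 <= a -> 0 <= b ->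
  measurable_fun setT f -> measurable_fun setT g -> measurable_fun setT h ->
  (forall t, 0 <= f t) -> (forall t, 0 <= g t) -> (forall t, 0 <= h t) ->
  (forall t, f t <= a * g t + b * h t) ->
  (\int[mu]_t (g t)%:E <= x%:E)%E -> (\int[mu]_t (h t)%:E <= y%:E)%E ->
  (\int[mu]_t (f t)%:E <= (a * x + b * y)%:E)%E.
Proof.
move=> a0 b0 mf mg mh f0 g0 h0 fgh gx hy.
apply: (@le_trans _ _ (\int[mu]_t (a%:E * (g t)%:E + b%:E * (h t)%:E))%E).
  apply: ge0_le_integral => //.
  - by move=> t _; rewrite lee_fin.
  - exact/measurable_EFinP.
  - by apply: emeasurable_funD; apply: measurable_funeM; exact/measurable_EFinP.
  - by move=> t _; rewrite -!EFinM -EFinD lee_fin.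
rewrite ge0_integralD//.
- rewrite !ge0_integralZl//; try exact/measurable_EFinP.
    by rewrite EFinD !EFinM leeD// lee_wpmul2l// lee_fin.
  by move=> t _; rewrite lee_fin.
  by move=> t _; rewrite lee_fin.
- by move=> t _; rewrite mule_ge0// lee_fin.
- by apply: measurable_funeM; exact/measurable_EFinP.
- by move=> t _; rewrite mule_ge0// lee_fin.
- by apply: measurable_funeM; exact/measurable_EFinP.
Qed.

Section power_inequalities.
Context {R : realType}.
Implicit Types x y : R.

Lemma sqrD_le x y : (x + y) ^+ 2 <= 2 * (x ^+ 2 + y ^+ 2).
Proof. by have := sqr_ge0 (x - y); nra. Qed.

Lemma pow4D_le x y : (x + y) ^+ 4 <= 8 * (x ^+ 4 + y ^+ 4).
Proof.
have -> : (x + y) ^+ 4 = ((x + y) ^+ 2) ^+ 2 by rewrite -exprM.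
have -> : x ^+ 4 = (x ^+ 2) ^+ 2 by rewrite -exprM.
have -> : y ^+ 4 = (y ^+ 2) ^+ 2 by rewrite -exprM.
apply: (@le_trans _ _ ((2 * (x ^+ 2 + y ^+ 2)) ^+ 2)).
  rewrite ler_sqr ?nnegrE ?sqr_ge0 ?sqrD_le//.
  by rewrite mulr_ge0// addr_ge0// sqr_ge0.
have := sqrD_le (x ^+ 2) (y ^+ 2).
by rewrite exprMn; lra.
Qed.

Lemma pow8_ge0 x : 0 <= x ^+ 8.
Proof. by rewrite -[8%N]/(2 * 4)%N exprM exprn_ge0// sqr_ge0. Qed.

Lemma pow8D_le x y : (x + y) ^+ 8 <= 128 * (x ^+ 8 + y ^+ 8).
Proof.
have -> : (x + y) ^+ 8 = ((x + y) ^+ 2) ^+ 4 by rewrite -exprM.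
have -> : x ^+ 8 = (x ^+ 2) ^+ 4 by rewrite -exprM.
have -> : y ^+ 8 = (y ^+ 2) ^+ 4 by rewrite -exprM.
apply: (@le_trans _ _ ((2 * (x ^+ 2 + y ^+ 2)) ^+ 4)).
  rewrite lerXn2r ?nnegrE ?sqr_ge0 ?sqrD_le//.
  by rewrite mulr_ge0// addr_ge0// sqr_ge0.
have := pow4D_le (x ^+ 2) (y ^+ 2).
by rewrite exprMn; lra.
Qed.

End power_inequalities.

Section node_moments.
Context {R : realType} d (T : measurableType d) (P : probability T R).
Variables (m beta : R) (B : R -> T -> R).
Hypothesis hB : standard_brownian_motion P B.

Let sg := Num.sqrt (beta / m).
Let c4 : R := 4 ^+ 4 * 4`!%:R * Num.sqrt 2.

(** The factor 256 is twice the 128 of [pow8D_le]; the rest is sg^8 times the constant of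
    [increment_moment] for p = 3. *)
Definition moment_bound : R :=
  256 * (Num.sqrt (beta / m) ^+ 8 * (4 ^+ 4 * 4`!%:R * Num.sqrt 2)).

Local Notation b M w j := (node m beta B M 0 w j).

Let c40 : 0 <= c4.
Proof. by rewrite mulr_ge0// ?sqrtr_ge0// mulr_ge0// exprn_ge0. Qed.

Let sg80 : 0 <= sg ^+ 8. Proof. exact: pow8_ge0. Qed.

Lemma moment_bound_ge0 : 0 <= moment_bound.
Proof. by rewrite mulr_ge0// mulr_ge0. Qed.

Let moment8 s t : 0 <= s -> s <= t ->
  (\int[P]_w ((B t w - B s w) ^+ 8)%:E <= ((t - s) ^+ 4 * c4)%:E)%E.
Proof.
move=> s0; rewrite le_eqVlt => /predU1P[<-|st].
  rewrite integral0_eq; first by rewrite subrr expr0n mul0r.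
  by move=> w _; rewrite subrr expr0n.
have := increment_moment hB 3 s0 st.
by rewrite exprMn /c4; congr (_ <= _%:E)%E; ring.
Qed.

Let moment8_0 t : 0 <= t -> (\int[P]_w ((B t w) ^+ 8)%:E <= (t ^+ 4 * c4)%:E)%E.
Proof.
move=> t0; have := moment8 (lexx 0) t0; rewrite subr0.
by under eq_integral do rewrite (bm_start hB) subr0.
Qed.

Let mB8 t : 0 <= t -> measurable_fun setT (fun w => (B t w) ^+ 8).
Proof. by move=> t0; apply: measurable_funX; exact: (bm_measurable hB). Qed.

Lemma measurable_node0 M x j : measurable_fun setT (fun w => node m beta B M x w j).
Proof.
apply: (measurableT_comp (measurable_node m beta hB M j) (g := fun w => (x, w))).
exact: measurable_fun_pair.
Qed.

Let mnode8 M j : measurable_fun setT (fun w => b M w j ^+ 8).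
Proof. by apply: measurable_funX; exact: measurable_node0. Qed.

Let minc8 M j : measurable_fun setT (fun w => increment B M j w ^+ 8).
Proof. by apply: measurable_funX; exact: (measurable_increment hB). Qed.

Let increment8 M j : (0 < M)%N ->
  (\int[P]_w (increment B M j w ^+ 8)%:E <= (M%:R^-1 ^+ 4 * c4)%:E)%E.
Proof.
move=> M0.
have e : j.+1%:R / M%:R - j%:R / M%:R = M%:R^-1 :> R.
  by rewrite -mulrBl -natr1 [_ + 1]addrC addrK mul1r.
rewrite -e; apply: moment8; first by rewrite divr_ge0.
by rewrite ler_wpM2r ?invr_ge0// ler_nat.
Qed.

Lemma node_moment M j : (0 < M)%N -> (j <= M)%N ->
  (\int[P]_w (b M w j ^+ 8)%:E <= moment_bound%:E)%E.
Proof.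
move=> M0 jM; set t : R := j%:R / M%:R.
have M0' : 0 < M%:R :> R by rewrite ltr0n.
have t0 : 0 <= t by rewrite divr_ge0.
have t1 : t <= 1 by rewrite ler_pdivrMr// mul1r ler_nat.
have t8 n : t ^+ n <= 1 by exact: exprn_ile1.
have E1 : (\int[P]_w (B t w ^+ 8)%:E <= c4%:E)%E.
  apply: le_trans (moment8_0 t0) _.
  by rewrite lee_fin ler_piMl.
have E2 : (\int[P]_w (B 1 w ^+ 8)%:E <= c4%:E)%E.
  by have := moment8_0 ler01; rewrite expr1n mul1r.
have -> : moment_bound = 128 * sg ^+ 8 * c4 + 128 * sg ^+ 8 * c4.
  by rewrite /moment_bound -/sg -/c4; ring.
have k0 : 0 <= 128 * sg ^+ 8 by rewrite mulr_ge0.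
apply: (ge0_integral_le2 k0 k0 _ _ _ _ _ _ _ E1 E2) => //.
- exact: mB8.
- exact: mB8.
- by move=> w; exact: pow8_ge0.
- by move=> w; exact: pow8_ge0.
- by move=> w; exact: pow8_ge0.
move=> w; rewrite /node /brownian_loop add0r exprMn -/t -/sg.
have := pow8D_le (B t w) (- (t * B 1 w)).
have -> : (- (t * B 1 w)) ^+ 8 = t ^+ 8 * B 1 w ^+ 8.
  by rewrite -[8%N]/(2 * 4)%N exprM sqrrN -exprM exprMn.
move=> /(ler_wpM2l sg80)/le_trans; apply.
have : t ^+ 8 * B 1 w ^+ 8 <= B 1 w ^+ 8 by rewrite ler_piMl// pow8_ge0.
by move=> /(ler_wpM2l sg80); lra.
Qed.

(** The signed distance of node k from the midpoint of its neighbours. The drift cancels in it,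
    leaving sg / 2 times the difference of two adjacent increments. *)
Definition mid_dev M w k : R :=
  (2 * b M w k - b M w k.-1 - b M w k.+1) / 2.

Definition half_step M w k : R := (b M w k.+1 - b M w k.-1) / 2.

Let node_step M w k : (0 < M)%N ->
  b M w k.+1 - b M w k = sg * (increment B M k w - B 1 w / M%:R).
Proof.
move=> M0; rewrite /node /brownian_loop /increment -/sg.
rewrite -[k.+1%:R]natr1; field.
by rewrite pnatr_eq0 -lt0n.
Qed.

Lemma measurable_mid_dev M k : measurable_fun setT (fun w => mid_dev M w k).
Proof.
apply: measurable_funM => //; apply: measurable_funB; last exact: measurable_node0.
apply: measurable_funB; last exact: measurable_node0.
by apply: measurable_funM => //; exact: measurable_node0.
Qed.

Lemma measurable_half_step M k : measurable_fun setT (fun w => half_step M w k).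
Proof.
apply: measurable_funM => //.
by apply: measurable_funB; exact: measurable_node0.
Qed.

(** The 128 of [pow8D_le] against 2^8 in the denominator leaves the factor sg^8 / 2 for each of the
    two adjacent increments. *)
Lemma mid_dev_moment M k : (0 < k)%N -> (0 < M)%N ->
  (\int[P]_w (mid_dev M w k ^+ 8)%:E <= (moment_bound / M%:R ^+ 4)%:E)%E.
Proof.
move=> k0 M0.
have c0 : 0 <= sg ^+ 8 / 2 by rewrite mulr_ge0.
set x := M%:R^-1 ^+ 4 * c4.
apply: (@le_trans _ _ (sg ^+ 8 / 2 * x + sg ^+ 8 / 2 * x)%:E); last first.
  rewrite lee_fin -exprVn /x /moment_bound -/sg -/c4.
  have := mulr_ge0 sg80 (mulr_ge0 (exprn_ge0 4 (_ : 0 <= M%:R^-1)) c40).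
  rewrite invr_ge0 => /(_ (ler0n _ _)).
  by set y := M%:R^-1 ^+ 4; nra.
apply: (ge0_integral_le2 c0 c0 _ _ _ _ _ _ _
  (increment8 k.-1 M0) (increment8 k M0)) => //.
- by apply: measurable_funX; exact: measurable_mid_dev.
- by move=> w; exact: pow8_ge0.
- by move=> w; exact: pow8_ge0.
- by move=> w; exact: pow8_ge0.
move=> w.
have -> : mid_dev M w k = sg * 2^-1 * (increment B M k.-1 w + - increment B M k w).
  rewrite /mid_dev (_ : 2 * _ - _ - _ = (b M w k - b M w k.-1)
    - (b M w k.+1 - b M w k)); last by ring.
  by rewrite node_step// -{1}(prednK k0) node_step//; ring.
have := pow8D_le (increment B M k.-1 w) (- increment B M k w).
have -> : (- increment B M k w) ^+ 8 = increment B M k w ^+ 8.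
  by rewrite -[8%N]/(2 * 4)%N exprM sqrrN -exprM.
rewrite [in X in _ -> X]exprMn exprMn => h.
have := ler_wpM2l (mulr_ge0 sg80 (exprn_ge0 8 (_ : 0 <= 2^-1 :> R))) h.
rewrite invr_ge0 => /(_ (ler0n _ _)) /le_trans; apply.
have -> : 2^-1 ^+ 8 = 256^-1 :> R by rewrite exprVn -natrX.
by rewrite le_eqVlt; apply/orP; left; apply/eqP; field.
Qed.

(** The Brownian increment over two steps has variance 2 / M. The drift enters the eighth power with
    M^-8 and is absorbed into M^-4. *)
Lemma half_step_moment M k : (0 < k < M)%N ->
  (\int[P]_w (half_step M w k ^+ 8)%:E <= (moment_bound / M%:R ^+ 4)%:E)%E.
Proof.
move=> /andP[k0 kM]; have M0 : (0 < M)%N by exact: leq_trans kM.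
have M0' : M%:R != 0 :> R by rewrite pnatr_eq0 -lt0n.
have M1 : M%:R^-1 <= 1 :> R by rewrite invf_le1 ?ltr0n// ler1n.
have MV0 : 0 <= M%:R^-1 :> R by rewrite invr_ge0.
have c0 : 0 <= sg ^+ 8 / 2 by rewrite mulr_ge0.
have c1 : 0 <= sg ^+ 8 / 2 * 256 * M%:R^-1 ^+ 8.
  by apply: mulr_ge0; [exact: mulr_ge0|exact: exprn_ge0].
have E1 : (\int[P]_w ((B (k.+1%:R / M%:R) w - B (k.-1%:R / M%:R) w) ^+ 8)%:E
    <= ((2 / M%:R) ^+ 4 * c4)%:E)%E.
  have e : k.+1%:R / M%:R - k.-1%:R / M%:R = 2 / M%:R :> R.
    rewrite -mulrBl; congr (_ / _).
    by rewrite -[in LHS](prednK k0) -addn2 natrD addrC addKr.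
  rewrite -e; apply: moment8; first by rewrite divr_ge0.
  by rewrite ler_wpM2r ?invr_ge0// ler_nat (leq_trans (leq_pred k)).
have E2 : (\int[P]_w (B 1 w ^+ 8)%:E <= c4%:E)%E.
  by have := moment8_0 ler01; rewrite expr1n mul1r.
apply: (@le_trans _ _ (sg ^+ 8 / 2 * ((2 / M%:R) ^+ 4 * c4)
    + sg ^+ 8 / 2 * 256 * M%:R^-1 ^+ 8 * c4)%:E); last first.
  rewrite lee_fin -exprVn /moment_bound -/sg -/c4 exprMn.
  have : M%:R^-1 ^+ 8 <= M%:R^-1 ^+ 4 :> R.
    rewrite -[8%N]/(4 + 4)%N exprD ler_piMr ?exprn_ge0//.
    exact: exprn_ile1.
  have := mulr_ge0 sg80 c40; have := exprn_ge0 4 MV0.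
  set y := _ ^+ 4; set z := _ ^+ 8; set u := sg ^+ 8.
  have -> : 2 ^+ 4 = 16 :> R by rewrite -natrX.
  by move=> y0 u0 zy; have := ler_wpM2l u0 zy; have := mulr_ge0 u0 y0; nra.
apply: (ge0_integral_le2 c0 c1 _ _ _ _ _ _ _ E1 E2) => //.
- by apply: measurable_funX; exact: measurable_half_step.
- by apply: measurable_funX; apply: measurable_funB;
    apply: (bm_measurable hB); rewrite divr_ge0.
- exact: mB8.
- by move=> w; exact: pow8_ge0.
- by move=> w; exact: pow8_ge0.
- by move=> w; exact: pow8_ge0.
move=> w; set z := B _ w - _.
have -> : half_step M w k = sg * 2^-1 * (z + - (2 * M%:R^-1 * B 1 w)).
  rewrite /half_step /node /brownian_loop /z -/sg.
  rewrite -[in k.+1%:R](prednK k0) -addn2 natrD.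
  by field.
have := pow8D_le z (- (2 * M%:R^-1 * B 1 w)).
have -> : (- (2 * M%:R^-1 * B 1 w)) ^+ 8 = 256 * (M%:R^-1 ^+ 8 * B 1 w ^+ 8).
  rewrite -[8%N]/(2 * 4)%N exprM sqrrN -exprM !exprMn -mulrA.
  by congr (_ * _); rewrite -natrX.
rewrite [in X in _ -> X]exprMn exprMn => h.
have := ler_wpM2l (mulr_ge0 sg80 (exprn_ge0 8 (_ : 0 <= 2^-1 :> R))) h.
rewrite invr_ge0 => /(_ (ler0n _ _)) /le_trans; apply.
have -> : 2^-1 ^+ 8 = 256^-1 :> R by rewrite exprVn -natrX.
by rewrite le_eqVlt; apply/orP; left; apply/eqP; field.
Qed.

End node_moments.

(** * Doubling the number of nodes *)

Section real_node_functional.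
Context {R : realType}.

(** A signed counterpart of [node_functional], closed under the algebraic operations below, so that
    measurability of an integrand follows from its form. *)
Definition real_node_functional (M : nat) (f : (nat -> R) -> R) : Prop :=
  measurable_fun setT (fun y : M.-tuple R => f (fun j => y`_j)) /\
  forall y y', (forall j, (j < M)%N -> y j = y' j) -> f y = f y'.

Lemma rnf_coord M j : (j < M)%N -> real_node_functional M (fun y => y j).
Proof. by move=> jM; split => [|y y' ->//]; exact: measurable_nth. Qed.

Lemma rnf_cst M k : real_node_functional M (fun=> k).
Proof. by split => //; exact: measurable_cst. Qed.

Lemma rnf_comp M (h : R -> R) f : measurable_fun setT h ->
  real_node_functional M f -> real_node_functional M (fun y => h (f y)).
Proof.
move=> mh [mf ef]; split => [|y y' yy]; first exact: (measurableT_comp mh mf).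
by rewrite (ef _ _ yy).
Qed.

Lemma rnfD M f g : real_node_functional M f -> real_node_functional M g ->
  real_node_functional M (fun y => f y + g y).
Proof.
move=> [mf ef] [mg eg]; split => [|y y' yy]; first exact: measurable_funD.
by rewrite (ef _ _ yy) (eg _ _ yy).
Qed.

Lemma rnfM M f g : real_node_functional M f -> real_node_functional M g ->
  real_node_functional M (fun y => f y * g y).
Proof.
move=> [mf ef] [mg eg]; split => [|y y' yy]; first exact: measurable_funM.
by rewrite (ef _ _ yy) (eg _ _ yy).
Qed.

Lemma rnfN M f : real_node_functional M f ->
  real_node_functional M (fun y => - f y).
Proof. by apply: rnf_comp; exact: oppr_measurable. Qed.

Lemma rnfX M f n : real_node_functional M f ->
  real_node_functional M (fun y => f y ^+ n).
Proof. by apply: (rnf_comp (h := fun x => x ^+ n)); exact: exprn_measurable. Qed.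

Lemma rnf_sum M n (F : 'I_n -> (nat -> R) -> R) :
  (forall i, real_node_functional M (F i)) ->
  real_node_functional M (fun y => \sum_(i < n) F i y).
Proof.
move=> hF; split => [|y y' yy].
  by apply: measurable_sum => i; have [] := hF i.
by apply: eq_bigr => i _; have [_ eF] := hF i; exact: eF.
Qed.

Lemma rnf_node_functional M f : real_node_functional M f ->
  (forall y, 0 <= f y) -> node_functional M (fun y => (f y)%:E).
Proof.
move=> [mf ef] f0; split => [|y y' yy|y]; first exact/measurable_EFinP.
  by rewrite (ef _ _ yy).
by rewrite lee_fin.
Qed.

Lemma measurable_rnf d' (S : measurableType d') M f (y : S -> nat -> R) :
  real_node_functional M f ->
  (forall j, (j < M)%N -> measurable_fun setT (fun s => y s j)) ->
  measurable_fun setT (fun s => f (y s)).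
Proof.
move=> [mf ef] my.
apply: (eq_measurable_fun (fun s => f (fun j => [tuple y s i | i < M]`_j))).
  move=> s _; apply: ef => j jM.
  by rewrite -[j]/(nat_of_ord (Ordinal jM)) nth_mktuple.
apply: (measurableT_comp mf (g := fun s => [tuple y s i | i < M])).
by apply: measurable_mktuple => i; exact: my.
Qed.

Definition mean (f : R -> R) (N : nat) (y : nat -> R) : R :=
  N%:R^-1 * \sum_(j < N) f (y j).

Lemma rnf_mean M (f : R -> R) N (k : nat -> nat) :
  measurable_fun setT f -> (forall j, (j < N)%N -> (k j < M)%N) ->
  real_node_functional M (fun y => mean f N (fun j => y (k j))).
Proof.
move=> mf kM; apply: rnfM; first exact: rnf_cst.
apply: rnf_sum => i; apply: (rnf_comp mf); apply: rnf_coord.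
exact: kM.
Qed.

Lemma mean_ge0 f N y : (forall x, 0 <= f x) -> 0 <= mean f N y.
Proof. by move=> f0; rewrite mulr_ge0 ?invr_ge0// sumr_ge0. Qed.

Lemma ler_mean f g N y : (forall x, f x <= g x) -> mean f N y <= mean g N y.
Proof. by move=> fg; rewrite ler_wpM2l ?invr_ge0// ler_sum. Qed.

Lemma mean_le_cst (f : R -> R) N y k : (0 < N)%N -> (forall x, f x <= k) ->
  mean f N y <= k.
Proof.
move=> N0 fk; rewrite /mean ler_pdivrMl ?ltr0n//.
apply: (@le_trans _ _ (\sum_(j < N) k)); first exact: ler_sum.
by rewrite sumr_const card_ord mulr_natl.
Qed.

Lemma meanD f g N y : mean (fun x => f x + g x) N y = mean f N y + mean g N y.
Proof. by rewrite /mean big_split/= mulrDr. Qed.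

Lemma meanZ k f N y : mean (fun x => k * f x) N y = k * mean f N y.
Proof. by rewrite /mean -mulr_sumr mulrCA. Qed.

Lemma mean_cst k N y : (0 < N)%N -> mean (fun=> k) N y = k.
Proof.
move=> N0; rewrite /mean sumr_const card_ord -[k *+ _]mulr_natl mulrA mulVf.
  by rewrite mul1r.
by rewrite pnatr_eq0 -lt0n.
Qed.

Lemma expR_mean (f : R -> R) N y : (0 < N)%N ->
  expR (- mean f N y) <= mean (fun x => expR (- f x)) N y.
Proof. by case: N => // n _; exact: (expR_mean_le (fun i : 'I_n.+1 => f (y i))). Qed.

End real_node_functional.

(** * Integration over starting points and paths *)

Section bracket.
Context {R : realType} d (T : measurableType d) (P : probability T R).
Variable D : set R.
Hypothesis mD : measurable D.

Definition bracket (F : R -> T -> R) : \bar R :=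
  (\int[lebesgue_measure]_(x in D) \int[P]_w (F x w)%:E)%E.

Definition jointly_measurable (F : R -> T -> R) : Prop :=
  measurable_fun setT (fun p : R * T => F p.1 p.2).

Implicit Types F X Y : R -> T -> R.

Lemma jointly_measurable_section F x :
  jointly_measurable F -> measurable_fun setT (F x).
Proof.
move=> mF; apply: (measurableT_comp mF (g := fun w => (x, w))).
exact: measurable_fun_pair.
Qed.

Lemma measurable_inner F : jointly_measurable F -> (forall x w, 0 <= F x w) ->
  measurable_fun D (fun x => \int[P]_w (F x w)%:E)%E.
Proof.
move=> mF F0; apply: measurable_funTS.
apply: (@measurable_fun_fubini_tonelli_F _ _ _ _ _ P
  (fun p : R * T => (F p.1 p.2)%:E)).
  exact/measurable_EFinP.
by move=> p; rewrite lee_fin.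
Qed.

Lemma inner_ge0 F x : (forall w, 0 <= F x w) -> (0 <= \int[P]_w (F x w)%:E)%E.
Proof. by move=> F0; apply: integral_ge0 => w _; rewrite lee_fin. Qed.

Lemma bracket_ge0 F : (forall x w, 0 <= F x w) -> (0 <= bracket F)%E.
Proof. by move=> F0; apply: integral_ge0 => x _; exact: inner_ge0. Qed.

Lemma bracketD X Y : jointly_measurable X -> jointly_measurable Y ->
  (forall x w, 0 <= X x w) -> (forall x w, 0 <= Y x w) ->
  bracket (fun x w => X x w + Y x w) = (bracket X + bracket Y)%E.
Proof.
move=> mX mY X0 Y0; rewrite /bracket -ge0_integralD//.
- apply: eq_integral => x _; rewrite -ge0_integralD//.
  + by move=> w _; rewrite lee_fin.
  + by apply/measurable_EFinP; exact: jointly_measurable_section.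
  + by move=> w _; rewrite lee_fin.
  + by apply/measurable_EFinP; exact: jointly_measurable_section.
- by move=> x _; exact: inner_ge0.
- exact: measurable_inner.
- by move=> x _; exact: inner_ge0.
- exact: measurable_inner.
Qed.

Lemma bracketZ k X : 0 <= k -> jointly_measurable X ->
  (forall x w, 0 <= X x w) ->
  bracket (fun x w => k * X x w) = (k%:E * bracket X)%E.
Proof.
move=> k0 mX X0; rewrite /bracket -ge0_integralZl//.
- apply: eq_integral => x _; rewrite -ge0_integralZl//.
  + by apply/measurable_EFinP; exact: jointly_measurable_section.
  + by move=> w _; rewrite lee_fin.
- exact: measurable_inner.
- by move=> x _; exact: inner_ge0.
Qed.

Lemma le_bracket X Y : jointly_measurable X -> jointly_measurable Y ->
  (forall x w, 0 <= X x w) -> (forall x w, 0 <= Y x w) ->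
  (forall x w, D x -> X x w <= Y x w) -> (bracket X <= bracket Y)%E.
Proof.
move=> mX mY X0 Y0 XY; apply: ge0_le_integral => //.
- by move=> x _; exact: inner_ge0.
- exact: measurable_inner.
- exact: measurable_inner.
- move=> x Dx; apply: ge0_le_integral => //.
  + by move=> w _; rewrite lee_fin.
  + by apply/measurable_EFinP; exact: jointly_measurable_section.
  + by apply/measurable_EFinP; exact: jointly_measurable_section.
  + by move=> w _; rewrite lee_fin XY.
Qed.

Lemma jointly_measurableD X Y : jointly_measurable X -> jointly_measurable Y ->
  jointly_measurable (fun x w => X x w + Y x w).
Proof. exact: measurable_funD. Qed.

Lemma jointly_measurableZ k X : jointly_measurable X ->
  jointly_measurable (fun x w => k * X x w).
Proof. by move=> mX; exact: measurable_funM. Qed.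

Lemma bracket_le2 F X Y (a b x0 y0 : R) : 0 <= a -> 0 <= b ->
  jointly_measurable F -> jointly_measurable X -> jointly_measurable Y ->
  (forall x w, 0 <= F x w) -> (forall x w, 0 <= X x w) ->
  (forall x w, 0 <= Y x w) ->
  (forall x w, D x -> F x w <= a * X x w + b * Y x w) ->
  (bracket X <= x0%:E)%E -> (bracket Y <= y0%:E)%E ->
  (bracket F <= (a * x0 + b * y0)%:E)%E.
Proof.
move=> a0 b0 mF mX mY F0 X0 Y0 FXY Xx Yy.
apply: (@le_trans _ _ (bracket (fun x w => a * X x w + b * Y x w))).
  apply: le_bracket => //.
    by apply: jointly_measurableD; exact: jointly_measurableZ.
  by move=> x w; rewrite addr_ge0// mulr_ge0.
rewrite bracketD; [|exact: jointly_measurableZ|exact: jointly_measurableZ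
  |by move=> x w; rewrite mulr_ge0|by move=> x w; rewrite mulr_ge0].
by rewrite !bracketZ// EFinD !EFinM leeD// lee_wpmul2l// lee_fin.
Qed.

Lemma bracket_leZ F X (a x0 : R) : 0 <= a ->
  jointly_measurable F -> jointly_measurable X ->
  (forall x w, 0 <= F x w) -> (forall x w, 0 <= X x w) ->
  (forall x w, D x -> F x w <= a * X x w) ->
  (bracket X <= x0%:E)%E -> (bracket F <= (a * x0)%:E)%E.
Proof.
move=> a0 mF mX F0 X0 FX Xx; rewrite -[a * x0]addr0 -[X in _ + X](mul0r x0).
apply: (bracket_le2 a0 (lexx 0) mF mX mX) => // x w Dx.
by rewrite mul0r addr0 FX.
Qed.

Lemma bracket_sum_le n (F : 'I_n -> R -> T -> R) (c : R) :
  (forall i, jointly_measurable (F i)) -> (forall i x w, 0 <= F i x w) ->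
  (forall i, (bracket (F i) <= c%:E)%E) ->
  (bracket (fun x w => (\sum_(i < n) F i x w)%R) <= (n%:R * c)%:E)%E.
Proof.
elim: n F => [|n ih] F mF F0 Fc.
  rewrite mul0r /bracket integral0_eq// => x _.
  by rewrite integral0_eq// => w _; rewrite big_ord0.
have -> : n.+1%:R * c = 1 * (n%:R * c) + 1 * c by rewrite -natr1; ring.
apply: (bracket_le2 ler01 ler01 _ _ _ _ _ _ _
  (ih (fun i => F (widen_ord (leqnSn n) i)) _ _ _) (Fc ord_max)) => //.
- by apply: measurable_sum => i; exact: mF.
- by apply: measurable_sum => i; exact: mF.
- by move=> x w; exact: sumr_ge0.
- by move=> x w; exact: sumr_ge0.
- by move=> x w _; rewrite big_ord_recr/= !mul1r.
Qed.

Lemma bracket_prod (h : R -> R) (g : T -> R) (a b : R) :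
  measurable_fun setT h -> measurable_fun setT g ->
  (forall x, 0 <= h x) -> (forall w, 0 <= g w) -> 0 <= b ->
  (\int[lebesgue_measure]_(x in D) (h x)%:E <= a%:E)%E ->
  (\int[P]_w (g w)%:E <= b%:E)%E ->
  (bracket (fun x w => (h x * g w)%R) <= (a * b)%:E)%E.
Proof.
move=> mh mg h0 g0 b0 ha gb.
apply: (@le_trans _ _ (\int[lebesgue_measure]_(x in D) ((h x)%:E * b%:E))%E).
  apply: ge0_le_integral => //.
  - by move=> x _; apply: integral_ge0 => w _; rewrite lee_fin mulr_ge0.
  - apply: (measurable_inner (F := fun x w => h x * g w)).
      by apply: measurable_funM; exact: measurableT_comp.
    by move=> x w; rewrite mulr_ge0.
  - apply: emeasurable_funM => //; apply/measurable_EFinP.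
    exact: measurable_funTS.
  - move=> x _; under eq_integral do rewrite EFinM.
    rewrite ge0_integralZl//.
    + by rewrite lee_wpmul2l// lee_fin.
    + exact/measurable_EFinP.
    + by move=> w _; rewrite lee_fin.
    + by rewrite lee_fin.
rewrite ge0_integralZr//.
- by rewrite EFinM lee_wpmul2r// lee_fin.
- by apply/measurable_EFinP; exact: measurable_funTS.
- by move=> x _; rewrite lee_fin.
Qed.

End bracket.

Lemma ge0_integral_sum_le (R : realType) d (T : measurableType d)
    (mu : {measure set T -> \bar R}) n (f : 'I_n -> T -> R) (c : R) :
  (forall i, measurable_fun setT (f i)) -> (forall i t, 0 <= f i t) ->
  (forall i, (\int[mu]_t (f i t)%:E <= c%:E)%E) ->
  (\int[mu]_t (\sum_(i < n) f i t)%R%:E <= (n%:R * c)%:E)%E.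
Proof.
elim: n f => [|n ih] f mf f0 fc.
  by rewrite mul0r integral0_eq// => t _; rewrite big_ord0.
have -> : n.+1%:R * c = 1 * (n%:R * c) + 1 * c by rewrite -natr1; ring.
apply: (ge0_integral_le2 ler01 ler01 _ _ _ _ _ _ _
  (ih (fun i => f (widen_ord (leqnSn n) i)) _ _ _) (fc ord_max)) => //.
- exact: measurable_sum.
- exact: measurable_sum.
- by move=> t; exact: sumr_ge0.
- by move=> t; exact: sumr_ge0.
- by move=> t; rewrite big_ord_recr/= !mul1r.
Qed.

(** * Even and odd nodes of a doubled loop *)

Section half_sums.
Context {R : realType}.
Implicit Types (f : R -> R) (y : nat -> R).

Lemma mean_double f N y :
  mean f N.*2 y = (mean f N (fun j => y j.*2) + mean f N (fun j => y j.*2.+1)) / 2.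
Proof.
have -> : mean f N.*2 y = N.*2%:R^-1 * (\sum_(j < N) f (y j.*2) + \sum_(j < N) f (y j.*2.+1)).
  congr (_ * _); elim: N => [|N ih]; first by rewrite !big_ord0 addr0.
  by rewrite doubleS !big_ord_recr/= ih; ring.
rewrite /mean -muln2 natrM invfM; ring.
Qed.

Lemma mean_rot f N y : y N.*2 = y 0%N ->
  mean f N (fun j => y j.*2.+2) = mean f N (fun j => y j.*2).
Proof.
case: N => [|N] yN; first by rewrite /mean !big_ord0.
rewrite /mean; congr (_ * _).
rewrite big_ord_recr [RHS]big_ord_recl/= addrC -doubleS yN; congr (_ + _).
Qed.

(* Reflecting the odd node about the midpoint of its two neighbours changes the
   sign of [odd_part] and fixes [even_part]. *)
Definition odd_part f y j : R :=
  (f (y j.*2.+1) - f (y j.*2 + y j.*2.+2 - y j.*2.+1)) / 2.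

Definition even_part f y j : R :=
  (f (y j.*2.+1) + f (y j.*2 + y j.*2.+2 - y j.*2.+1)
   - f (y j.*2) - f (y j.*2.+2)) / 2.

(** The two parts add up to f at the odd node minus the average of f at its two neighbours. On a
    closed loop the left and the right neighbours have the same mean. *)
Lemma mean_odd_sub_even f N y : y N.*2 = y 0%N ->
  mean f N (fun j => y j.*2.+1) - mean f N (fun j => y j.*2)
  = N%:R^-1 * (\sum_(j < N) odd_part f y j + \sum_(j < N) even_part f y j).
Proof.
move=> yN; have := mean_rot f yN.
rewrite /mean -big_split/= => e.
have -> : N%:R^-1 * (\sum_(i < N) (odd_part f y i + even_part f y i))
  = N%:R^-1 * \sum_(j < N) f (y j.*2.+1)
    - (N%:R^-1 * \sum_(j < N) f (y j.*2) + N%:R^-1 * \sum_(j < N) f (y j.*2.+2)) / 2.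
  rewrite -mulrDr -big_split/= -mulrA -mulrBr mulr_suml -sumrB.
  by congr (_ * _); apply: eq_bigr => i _; rewrite /odd_part /even_part; field.
by rewrite e; move: (N%:R^-1 * _) => u; move: (N%:R^-1 * _) => v; field.
Qed.

(** Factoring out exp(- u), with e = exp(- (v - u) / 2), leaves half of (a + a') / 2 (1 - e)^2 + (a
    - a') / 2 (1 - e^2). Both terms are of second order in v - u and a - a', since 1 - e <= (v - u)
    / 2. *)
Lemma exp_mean_gap (a a' u v k : R) : 0 <= a <= k -> 0 <= a' <= k ->
  `|(a * expR (- u) + a' * expR (- v)) / 2
    - (a + a') / 2 * expR (- ((u + v) / 2))|
  <= (k + 1) / 8 * (((u - v) ^+ 2 + (a - a') ^+ 2) * (expR (- u) + expR (- v))).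
Proof.
move=> ha ha'.
wlog uv : a a' u v ha ha' / u <= v.
  move=> hw; have [uv|/ltW vu] := leP u v; first exact: hw.
  have := hw a' a v u ha' ha vu; congr (_ <= _).
    by congr `|_|; rewrite [v + u]addrC; ring.
  by ring.
move: ha ha' => /andP[a0 ak] /andP[a'0 a'k].
set s := expR (- (u / 2)); set z := (v - u) / 2.
have z0 : 0 <= z by rewrite divr_ge0// subr_ge0.
set e := expR (- z).
have e0 : 0 < e by exact: expR_gt0.
have e1 : 1 - z <= e by have := expR_ge1Dx (- z).
have e2 : e <= 1 by rewrite -expR0 ler_expR oppr_le0.
have s0 : 0 < s by exact: expR_gt0.
have uE : expR (- u) = s ^+ 2.
  by rewrite /s -expRM_natl; congr expR; field.
have vE : expR (- v) = s ^+ 2 * e ^+ 2.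
  by rewrite /s /e -!expRM_natl -expRD /z; congr expR; field.
have mE : expR (- ((u + v) / 2)) = s ^+ 2 * e.
  by rewrite /s /e -expRM_natl -expRD /z; congr expR; field.
have uvE : u - v = - (2 * z) by rewrite /z; field.
rewrite uE vE mE uvE.
have -> : (a * s ^+ 2 + a' * (s ^+ 2 * e ^+ 2)) / 2 - (a + a') / 2 * (s ^+ 2 * e)
  = s ^+ 2 * (((a + a') / 2 * (1 - e) ^+ 2 + (a - a') / 2 * (1 - e ^+ 2)) / 2).
  by field.
have -> : (k + 1) / 8 * (((- (2 * z)) ^+ 2 + (a - a') ^+ 2) * (s ^+ 2 + s ^+ 2 * e ^+ 2))
  = s ^+ 2 * ((k + 1) / 8 * ((4 * z ^+ 2 + (a - a') ^+ 2) * (1 + e ^+ 2))).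
  by ring.
rewrite normrM ger0_norm ?sqr_ge0// ler_wpM2l ?sqr_ge0//.
set D := a - a'.
have f0 : 0 <= 1 - e by rewrite subr_ge0.
have fz : 1 - e <= z by rewrite lerBlDr addrC -lerBlDr.
have fz2 : (1 - e) ^+ 2 <= z ^+ 2 by rewrite ler_sqr ?nnegrE.
have gz : 1 - e ^+ 2 <= 2 * z by nra.
have g0 : 0 <= 1 - e ^+ 2 by nra.
have k0 : 0 <= k by exact: le_trans ak.
have D2 : 0 <= D ^+ 2 by exact: sqr_ge0.
have z2 : 0 <= z ^+ 2 by exact: sqr_ge0.
have kk : 0 <= k * D ^+ 2 by exact: mulr_ge0.
have kz : 0 <= k * z ^+ 2 by exact: mulr_ge0.
have h1 : (a + a') / 2 * (1 - e) ^+ 2 <= k * z ^+ 2.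
  by apply: ler_pM => //; [rewrite divr_ge0// addr_ge0|exact: sqr_ge0|lra].
have h10 : 0 <= (a + a') / 2 * (1 - e) ^+ 2.
  by rewrite mulr_ge0 ?sqr_ge0// divr_ge0// addr_ge0.
(* The mixed product of |a - a'| and z is split into squares. *)
have h2 : `|D / 2 * (1 - e ^+ 2)| <= (D ^+ 2 + 4 * z ^+ 2) / 4.
  rewrite normrM (ger0_norm g0) normrM [`|2^-1|]ger0_norm ?invr_ge0//.
  apply: (@le_trans _ _ (`|D| / 2 * (2 * z))).
    by rewrite ler_wpM2l// divr_ge0.
  have -> : D ^+ 2 = `|D| ^+ 2 by rewrite real_normK// num_real.
  by have := sqr_ge0 (`|D| - 2 * z); nra.
have e20 : 0 <= e ^+ 2 by exact: sqr_ge0.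
have : (k + 1) / 8 * (4 * z ^+ 2 + D ^+ 2)
    <= (k + 1) / 8 * ((4 * z ^+ 2 + D ^+ 2) * (1 + e ^+ 2)).
  rewrite ler_wpM2l ?divr_ge0 ?addr_ge0// ler_peMr ?lerDl//.
  by rewrite addr_ge0// mulr_ge0.
apply: le_trans.
rewrite normrM [`|2^-1|]ger0_norm ?invr_ge0//.
have := ler_normD ((a + a') / 2 * (1 - e) ^+ 2) (D / 2 * (1 - e ^+ 2)).
rewrite (ger0_norm h10).
by nra.
Qed.

End half_sums.

(** * Pointwise bounds for squared odd and even parts *)

Section square_bounds.
Context {R : realType}.

(** With p = (1 + c^2)^2 each term satisfies p Y <= p^2 / 2 + Y^2 / 2, and p^2 <= 8 (1 + c^8). This
    decouples the growth of the Boltzmann weight from the small increments contained in Y. *)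
Lemma quartic_weight_le (N : nat) (y : nat -> R) (Y : R) : (0 < N)%N ->
  mean (fun c => (1 + c ^+ 2) ^+ 2) N y * Y
  <= 4 * (1 + mean (fun c => c ^+ 8) N y) + Y ^+ 2 / 2.
Proof.
move=> N0.
have -> : 4 * (1 + mean (fun c => c ^+ 8) N y) + Y ^+ 2 / 2
    = mean (fun c => (4 + Y ^+ 2 / 2) + 4 * c ^+ 8) N y.
  by rewrite meanD mean_cst// meanZ; ring.
rewrite mulrC -meanZ; apply: ler_mean => c.
have := pow4D_le 1 (c ^+ 2); rewrite expr1n -exprM.
have -> : (1 + c ^+ 2) ^+ 4 = ((1 + c ^+ 2) ^+ 2) ^+ 2 by rewrite -exprM.
have -> : (c ^+ (2 * 4)) = c ^+ 8 by [].
have := sqr_ge0 (Y - (1 + c ^+ 2) ^+ 2).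
move: ((1 + c ^+ 2) ^+ 2) (c ^+ 8) => p q; rewrite sqrrB -[_ *+ 2]mulr_natl.
move: (Y ^+ 2) (p ^+ 2) (Y * p) => a b e; lra.
Qed.

(** The odd node and its reflection are 2w apart, w being the deviation from the midpoint, and the
    Lipschitz constant grows linearly in both. The square of this growth is at most 10 (1 + x^2) +
    12 (b0^2 + b1^2 + b2^2), which the product form with factor 12 dominates. *)
Lemma tame_odd_le (K x b0 b1 b2 : R) (f : R -> R) : 0 <= K -> tame K f ->
  ((f (x + b1) - f (x + b0 + (x + b2) - (x + b1))) / 2) ^+ 2
  <= 12 * K ^+ 2 * (1 + x ^+ 2)
     * ((1 + b0 ^+ 2 + b1 ^+ 2 + b2 ^+ 2) * ((2 * b1 - b0 - b2) / 2) ^+ 2).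
Proof.
move=> K0 [_ tf _]; set r := (x + b0 + _ - _).
have h := tf r (x + b1).
set s := 1 + `|r| + `|x + b1| in h.
have s0 : 0 <= s by rewrite !addr_ge0.
have X2 : `|x| ^+ 2 = x ^+ 2 by rewrite real_normK// num_real.
have B0 : `|b0| ^+ 2 = b0 ^+ 2 by rewrite real_normK// num_real.
have B1 : `|b1| ^+ 2 = b1 ^+ 2 by rewrite real_normK// num_real.
have B2 : `|b2| ^+ 2 = b2 ^+ 2 by rewrite real_normK// num_real.
have sle : s <= (1 + 2 * `|x|) + (`|b0| + 2 * `|b1| + `|b2|).
  have h1 : `|x + b1| <= `|x| + `|b1| by exact: ler_normD.
  have h2 : `|r| <= `|x| + `|b0| + `|b1| + `|b2|.
    have -> : r = x + b0 + b2 - b1 by rewrite /r; ring.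
    rewrite (le_trans (ler_normB _ _))//.
    have := ler_normD (x + b0) b2; have := ler_normD x b0; lra.
  rewrite /s; lra.
have s2 : s ^+ 2 <= 12 * (1 + x ^+ 2) * (1 + b0 ^+ 2 + b1 ^+ 2 + b2 ^+ 2).
  apply: (@le_trans _ _ (((1 + 2 * `|x|) + (`|b0| + 2 * `|b1| + `|b2|)) ^+ 2)).
    by rewrite ler_sqr ?nnegrE// (le_trans s0).
  rewrite (le_trans (sqrD_le _ _))// -X2 -B0 -B1 -B2.
  have p1 : (1 + 2 * `|x|) ^+ 2 <= 5 * (1 + `|x| ^+ 2).
    by have := sqr_ge0 (2 - `|x|); nra.
  have p2 : (`|b0| + 2 * `|b1| + `|b2|) ^+ 2
      <= 6 * (`|b0| ^+ 2 + `|b1| ^+ 2 + `|b2| ^+ 2).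
    have := sqr_ge0 (2 * `|b0| - `|b1|); have := sqr_ge0 (`|b0| - `|b2|).
    by have := sqr_ge0 (`|b1| - 2 * `|b2|); nra.
  have q0 : 0 <= `|b0| ^+ 2 + `|b1| ^+ 2 + `|b2| ^+ 2.
    by rewrite !addr_ge0// sqr_ge0.
  have x0 : 0 <= `|x| ^+ 2 by exact: sqr_ge0.
  have := mulr_ge0 x0 q0.
  by nra.
set w := (2 * b1 - b0 - b2) / 2.
have eh : x + b1 - r = 2 * w by rewrite /r /w; field.
rewrite eh in h.
have h2 : ((f (x + b1) - f r) / 2) ^+ 2 <= (K * s * w) ^+ 2.
  rewrite -[X in X <= _]real_normK ?num_real// -[X in _ <= X]real_normK ?num_real//.
  rewrite ler_sqr ?nnegrE// normrM [`|2^-1|]ger0_norm ?invr_ge0//.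
  rewrite ler_pdivrMr// (le_trans h)//.
  rewrite !normrM [`|2|]ger0_norm// (ger0_norm K0) (ger0_norm s0).
  by rewrite le_eqVlt; apply/orP; left; apply/eqP; ring.
apply: (le_trans h2).
rewrite [(K * s * w) ^+ 2]exprMn [(K * s) ^+ 2]exprMn.
have -> : 12 * K ^+ 2 * (1 + x ^+ 2) * ((1 + b0 ^+ 2 + b1 ^+ 2 + b2 ^+ 2) * w ^+ 2)
  = K ^+ 2 * (12 * (1 + x ^+ 2) * (1 + b0 ^+ 2 + b1 ^+ 2 + b2 ^+ 2)) * w ^+ 2.
  by ring.
by rewrite ler_wpM2r ?sqr_ge0// ler_wpM2l ?sqr_ge0.
Qed.

(** The node with its reflection, and the two neighbours, are pairs with a common midpoint. The
    expression is half the difference of two second differences there; the value at the midpoint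
    drops out. *)
Lemma tame_even_le (K y0 y1 y2 : R) (f : R -> R) : 0 <= K -> tame K f ->
  ((f y1 + f (y0 + y2 - y1) - f y0 - f y2) / 2) ^+ 2
  <= 2 * K ^+ 2 * (((2 * y1 - y0 - y2) / 2) ^+ 4 + ((y2 - y0) / 2) ^+ 4).
Proof.
move=> K0 [_ _ tf].
set w := (2 * y1 - y0 - y2) / 2; set u := (y2 - y0) / 2.
have h1 := tf ((y0 + y2) / 2) w; have h2 := tf ((y0 + y2) / 2) u.
have e1 : (y0 + y2) / 2 + w = y1 by rewrite /w; field.
have e2 : (y0 + y2) / 2 - w = y0 + y2 - y1 by rewrite /w; field.
have e3 : (y0 + y2) / 2 + u = y2 by rewrite /u; field.
have e4 : (y0 + y2) / 2 - u = y0 by rewrite /u; field.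
rewrite e1 e2 in h1; rewrite e3 e4 in h2.
set F := f y1 + f _ - _ - _.
have hF : `|F / 2| <= K * (w ^+ 2 + u ^+ 2).
  rewrite normrM [`|2^-1|]ger0_norm ?invr_ge0// ler_pdivrMr//.
  set c := f ((y0 + y2) / 2) in h1 h2.
  have -> : F = (f y1 + f (y0 + y2 - y1) - 2 * c) - (f y2 + f y0 - 2 * c).
    by rewrite /F; ring.
  by rewrite (le_trans (ler_normB _ _))//; lra.
apply: (@le_trans _ _ ((K * (w ^+ 2 + u ^+ 2)) ^+ 2)).
  rewrite -[X in X <= _]real_normK ?num_real// ler_sqr ?nnegrE//.
  by rewrite mulr_ge0// addr_ge0// sqr_ge0.
have -> : 2 * K ^+ 2 * (w ^+ 4 + u ^+ 4) = K ^+ 2 * (2 * (w ^+ 4 + u ^+ 4)) by ring.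
rewrite exprMn ler_wpM2l ?sqr_ge0//.
by rewrite (le_trans (sqrD_le _ _))// -!exprM.
Qed.

End square_bounds.

Section integral_bound.
Context {R : realType} d (T : measurableType d) (mu : {measure set T -> \bar R}).

Definition integral_bound (f : T -> R) (x : R) : Prop :=
  [/\ measurable_fun setT f, forall t, 0 <= f t & (\int[mu]_t (f t)%:E <= x%:E)%E].

Lemma integral_boundD f g x y : integral_bound f x -> integral_bound g y ->
  integral_bound (fun t => f t + g t) (x + y).
Proof.
move=> [mf f0 fx] [mg g0 gy]; split; first exact: measurable_funD.
  by move=> t; exact: addr_ge0.
rewrite -[x]mul1r -[y]mul1r.
apply: (ge0_integral_le2 ler01 ler01 _ mf mg _ f0 g0 _ fx gy).
- exact: measurable_funD.
- by move=> t; exact: addr_ge0.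
- by move=> t; rewrite !mul1r.
Qed.

Lemma integral_boundZ k f x : 0 <= k -> integral_bound f x ->
  integral_bound (fun t => k * f t) (k * x).
Proof.
move=> k0 [mf f0 fx]; split; first exact: measurable_funM.
  by move=> t; exact: mulr_ge0.
rewrite -[k * x]addr0 -[X in _ + X](mul0r x).
apply: (ge0_integral_le2 k0 (lexx 0) _ mf mf _ f0 f0 _ fx fx).
- exact: measurable_funM.
- by move=> t; exact: mulr_ge0.
- by move=> t; rewrite mul0r addr0.
Qed.

Lemma integral_bound_sum n (f : 'I_n -> T -> R) x :
  (forall i, integral_bound (f i) x) ->
  integral_bound (fun t => \sum_(i < n) f i t) (n%:R * x).
Proof.
move=> fx; split.
- by apply: measurable_sum => i; have [] := fx i.
- by move=> t; apply: sumr_ge0 => i _; have [_ ->] := fx i.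
- by apply: ge0_integral_sum_le => i; have [] := fx i.
Qed.

Lemma integral_bound_le f x y : x <= y -> integral_bound f x -> integral_bound f y.
Proof. by move=> xy [mf f0 fx]; split=> //; apply: le_trans fx _. Qed.

End integral_bound.

Lemma integral_bound_cst (R : realType) d (T : measurableType d)
  (P : probability T R) (k : R) : 0 <= k -> integral_bound P (fun=> k) k.
Proof.
move=> k0; split => //.
by rewrite integral_cst//= probability_setT mule1.
Qed.

Lemma sum_sqr_le (R : realType) n (a : 'I_n -> R) :
  (\sum_(i < n) a i) ^+ 2 <= n%:R * \sum_(i < n) a i ^+ 2.
Proof.
elim: n a => [|n ih] a; first by rewrite !big_ord0 expr0n/= mul0r.
rewrite !big_ord_recr/=; have := ih (fun i => a (widen_ord (leqnSn n) i)).
set S := \sum_(i < n) a _; set Q := \sum_(i < n) _ ^+ 2; set x := a ord_max.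
case: (posnP n) => [n0|n0] h.
  have -> : S = 0 by rewrite /S; move: a @S @Q @x h; rewrite n0 => *; rewrite big_ord0.
  have -> : Q = 0 by rewrite /Q; move: a @S @Q @x h; rewrite n0 => *; rewrite big_ord0.
  by rewrite n0 !add0r mul1r.
have n0' : 0 < n%:R :> R by rewrite ltr0n.
have h2 : 2 * (S * x) <= Q + n%:R * x ^+ 2.
  rewrite -(ler_pM2l n0'); have := sqr_ge0 (S - n%:R * x); nra.
rewrite -natr1; nra.
Qed.

Lemma lee_double (R : realType) (e : \bar R) (t : R) :
  (e + e <= (2 * t)%:E)%E -> (e <= t%:E)%E.
Proof.
case: e => [r| |]; [|by []|by move=> _; exact: leNye].
by rewrite -EFinD !lee_fin; lra.
Qed.

(* [D] is a period of [V], or the whole line with [L = 0]. The profile [H] bounds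
   the Boltzmann weight of a point at distance [b] from [x] up to a power of [b]. *)
Record confinement (R : realType) (beta : R) (D : set R) (L G K : R)
    (H V : R -> R) : Prop := Confinement {
  confinement_domain : period_domain D L;
  measurable_profile : measurable_fun setT H;
  profile_ge0 : forall x, 0 <= H x;
  profile_integral :
    (\int[lebesgue_measure]_(x in D) (H x * (1 + x ^+ 2))%:E <= G%:E)%E;
  confinement_cst_ge0 : 0 <= K;
  potential_tame : tame K V;
  potential_periodic : forall x, V (x + L) = V x;
  boltzmann_le_profile : forall x b, D x ->
    expR (- (beta * V (x + b))) <= H x * (1 + b ^+ 2) ^+ 2
}.

Section doubling.
Context {R : realType} d (T : measurableType d) (P : probability T R).
Variables (m beta : R) (B : R -> T -> R).
Hypothesis hB : standard_brownian_motion P B.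
Variables (D : set R) (L G K : R) (H V : R -> R).
Hypothesis hC : confinement beta D L G K H V.

Let pD : period_domain D L. Proof. by case: hC. Qed.
Let mH : measurable_fun setT H. Proof. by case: hC. Qed.
Let H0 x : 0 <= H x. Proof. by case: hC. Qed.
Let HG : (\int[lebesgue_measure]_(x in D) (H x * (1 + x ^+ 2))%:E <= G%:E)%E.
Proof. by case: hC. Qed.
Let K0 : 0 <= K. Proof. by case: hC. Qed.
Let tV : tame K V. Proof. by case: hC. Qed.
Let pV x : V (x + L) = V x. Proof. by case: hC. Qed.
Let hV x b : D x ->
  expR (- (beta * V (x + b))) <= H x * (1 + b ^+ 2) ^+ 2.
Proof. by case: hC => *; auto. Qed.

Local Notation b M w j := (node m beta B M 0 w j).
Local Notation nd M x w := (node m beta B M x w).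
Local Notation br := (bracket P D).
Local Notation mb := (moment_bound m beta).

Let mD : measurable D. Proof. by have [] := pD. Qed.

Let G0 : 0 <= G.
Proof.
rewrite -lee_fin (le_trans _ HG)//; apply: integral_ge0 => x _.
by rewrite lee_fin mulr_ge0// addr_ge0// sqr_ge0.
Qed.

Definition boltzmann (N : nat) (y : nat -> R) : R :=
  expR (- (beta * mean V N y)).

Lemma boltzmann_ge0 N y : 0 <= boltzmann N y. Proof. exact: expR_ge0. Qed.

Lemma rnf_boltzmann M N (k : nat -> nat) : (forall j, (j < N)%N -> (k j < M)%N) ->
  real_node_functional M (fun y => boltzmann N (fun j => y (k j))).
Proof.
move=> kM; apply: (rnf_comp (h := fun t => expR (- (beta * t)))).
  by apply: measurableT_comp => //; apply: measurableT_comp.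
by apply: rnf_mean => //; exact: (tame_measurable tV).
Qed.

Lemma rnf_gap M N (rho : nat -> nat) h : measurable_fun setT h ->
  (N.*2 <= M)%N -> (forall j, (j < N)%N -> (rho j < M)%N) ->
  real_node_functional M (fun y => boltzmann N (fun j => y (rho j))
    * (mean h N (fun j => y j.*2.+1) - mean h N (fun j => y j.*2)) ^+ 2).
Proof.
move=> mh NM hrho; apply: rnfM; first exact: rnf_boltzmann.
apply: rnfX; apply: rnfD; last apply: rnfN; apply: rnf_mean => // j jN;
  apply: leq_trans NM; by rewrite ?ltn_Sdouble ?ltn_double.
Qed.

Lemma jointly_measurable_nodes M' M f : real_node_functional M f ->
  jointly_measurable (fun x (w : T) => f (nd M' x w)).
Proof.
move=> rf; apply: (measurable_rnf (y := fun p : R * T => nd M' p.1 p.2) rf).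
by move=> j _; exact: (measurable_node m beta hB).
Qed.

Lemma bracket_shift M f : (0 < M)%N -> real_node_functional M f ->
  (forall y, 0 <= f y) -> (forall y, f (fun j => y j + L) = f y) ->
  br (fun x w => f (fun j => nd M x w j.+1)) = br (fun x w => f (nd M x w)).
Proof.
move=> M0 rf f0 fL.
rewrite /bracket (shift_nodes (Phi := fun y => (f y)%:E) m beta hB M0 pD)//.
  exact: rnf_node_functional.
by move=> y; rewrite fL.
Qed.

Lemma mean_period f N (k : nat -> nat) y : (forall x, f (x + L) = f x) ->
  mean f N (fun j => y (k j) + L) = mean f N (fun j => y (k j)).
Proof. by move=> pf; rewrite /mean; congr (_ * _); apply: eq_bigr => i _. Qed.

(** Jensen's inequality moves the average over the nodes outside the exponential; each node is then
    bounded by the profile at the starting point. *)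
Lemma boltzmann_le M N x w (k : nat -> nat) : (0 < N)%N -> D x ->
  boltzmann N (fun j => nd M x w (k j))
  <= H x * mean (fun c => (1 + c ^+ 2) ^+ 2) N (fun j => b M w (k j)).
Proof.
move=> N0 Dx; rewrite /boltzmann -meanZ -[leRHS]meanZ.
rewrite (le_trans (expR_mean _ _ N0))//.
rewrite [leLHS](_ : _ = mean (fun c => expR (- (beta * V (x + c)))) N
    (fun j => b M w (k j))).
  by apply: ler_mean => c; exact: hV.
by rewrite /mean; congr (_ * _); apply: eq_bigr => i _; rewrite nodeD.
Qed.

(* Integrates to O(1), the increments in the last term having eighth moments of order N^-4. *)
Definition remainder N j w : R :=
  (1 + mean (fun c => c ^+ 8) N (fun i => b N.*2 w i.*2))
  + (b N.*2 w j.*2 ^+ 8 + b N.*2 w j.*2.+1 ^+ 8 + b N.*2 w j.*2.+2 ^+ 8)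
  + N%:R ^+ 4 * (mid_dev m beta B N.*2 w j.*2.+1 ^+ 8
                 + half_step m beta B N.*2 w j.*2.+1 ^+ 8).

Let bound_pow8 (f : T -> R) x : measurable_fun setT f ->
  (\int[P]_w (f w ^+ 8)%:E <= x%:E)%E -> integral_bound P (fun w => f w ^+ 8) x.
Proof.
by move=> mf fx; split=> //; [exact: measurable_funX|move=> w; exact: pow8_ge0].
Qed.

Let bound_node M j : (0 < M)%N -> (j <= M)%N ->
  integral_bound P (fun w => b M w j ^+ 8) mb.
Proof.
by move=> *; apply: bound_pow8; [exact: (measurable_node0 m beta hB)|exact: node_moment].
Qed.

Lemma mean_pow8_bound M N (k : nat -> nat) : (0 < N)%N -> (0 < M)%N ->
  (forall j, (j < N)%N -> (k j <= M)%N) ->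
  integral_bound P
    (fun w => 1 + mean (fun c => c ^+ 8) N (fun i => b M w (k i))) (1 + mb).
Proof.
move=> N0 M0 kM; apply: integral_boundD; first exact: integral_bound_cst.
rewrite [X in integral_bound _ _ X](_ : mb = N%:R^-1 * (N%:R * mb)); last first.
  by rewrite mulrA mulVf ?mul1r// pnatr_eq0 -lt0n.
apply: integral_boundZ; first by rewrite invr_ge0.
by apply: integral_bound_sum => i; apply: bound_node => //; exact: kM.
Qed.

Lemma remainder_bound N j : (j < N)%N ->
  integral_bound P (remainder N j) (1 + 5 * mb).
Proof.
move=> jN; have N0 : (0 < N)%N by exact: leq_ltn_trans jN.
have M0 : (0 < N.*2)%N by rewrite double_gt0.
have mb0 := moment_bound_ge0 m beta.
pose c := mb / N.*2%:R ^+ 4.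
apply: (@integral_bound_le _ _ _ _ _
  ((1 + mb) + (mb + mb + mb) + N%:R ^+ 4 * (c + c))).
  (* The doubled loop has 2N nodes, so N^4 (c + c) is only mb / 8, and 4 + 1/8 <= 5. *)
  have -> : c = mb / (16 * N%:R ^+ 4).
    by rewrite /c -muln2 natrM exprMn [_ * 2 ^+ 4]mulrC -natrX.
  have : N%:R != 0 :> R by rewrite pnatr_eq0 -lt0n.
  move: N%:R mb mb0 => n u u0 n0.
  have -> : n ^+ 4 * (u / (16 * n ^+ 4) + u / (16 * n ^+ 4)) = u / 8 by field.
  by lra.
apply: integral_boundD; first apply: integral_boundD.
- apply: mean_pow8_bound => // i iN.
  by rewrite leq_double ltnW.
- apply: integral_boundD; first apply: integral_boundD; apply: bound_node => //.
  + by rewrite leq_double ltnW.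
  + by rewrite ltn_double.
  + by rewrite -doubleS leq_double.
- apply: integral_boundZ; first exact: exprn_ge0.
  apply: integral_boundD; apply: bound_pow8.
  + exact: (measurable_mid_dev m beta hB).
  + exact: mid_dev_moment.
  + exact: (measurable_half_step m beta hB).
  + by apply: half_step_moment => //=; rewrite -doubleS ltn_Sdouble.
Qed.

Let wt N x w := boltzmann N (fun j => nd N.*2 x w j.*2).

(** The quantity N A om^2 is of order one, and forming it extracts the factor 1 / N. The constant is
    12 times 20: 12 from [tame_odd_le], and 20 = 4 + 16 from bounding the polynomial weight times
    this quantity by the remainder. *)
Lemma odd_part_le f N x w j : (0 < N)%N -> tame K f -> D x ->
  wt N x w * odd_part f (nd N.*2 x w) j ^+ 2
  <= 240 * K ^+ 2 / N%:R * (H x * (1 + x ^+ 2) * remainder N j w).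
Proof.
move=> N0 tf Dx.
have := boltzmann_le N.*2 w (fun j => j.*2) N0 Dx; rewrite -/(wt N x w) => hw.
have w0 : 0 <= wt N x w by exact: boltzmann_ge0.
have := @quartic_weight_le R N (fun i => b N.*2 w i.*2).
rewrite /odd_part !(nodeD m beta B N.*2 x w).
set b0 := b _ w j.*2; set b1 := b _ w j.*2.+1; set b2 := b _ w j.*2.+2.
have := tame_odd_le x b0 b1 b2 K0 tf.
rewrite /remainder -/b0 -/b1 -/b2.
have -> : (2 * b1 - b0 - b2) / 2 = mid_dev m beta B N.*2 w j.*2.+1 by [].
move: ((f _ - f _) / 2) => o.
set om := mid_dev _ _ _ _ _ _; set hs := half_step _ _ _ _ _ _.
set A := 1 + b0 ^+ 2 + _ + _; set M8 := mean (fun c => c ^+ 8) _ _.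
set M4 := mean _ _ _ in hw *.
move=> ho /(_ (N%:R * (A * om ^+ 2)) N0) hq.
have n0 : 0 < N%:R :> R by rewrite ltr0n.
have A4 : A ^+ 4 <= 64 * (1 + b0 ^+ 8 + b1 ^+ 8 + b2 ^+ 8).
  have := pow4D_le (1 + b0 ^+ 2) (b1 ^+ 2 + b2 ^+ 2).
  have := pow4D_le 1 (b0 ^+ 2); have := pow4D_le (b1 ^+ 2) (b2 ^+ 2).
  rewrite -!exprM -[(2 * 4)%N]/8%N expr1n [(1 + b0 ^+ 2) + (_ + _)]addrA -/A.
  by lra.
have M80 : 0 <= M8 by apply: mean_ge0 => c; exact: pow8_ge0.
have hs0 := pow8_ge0 hs; have om0 := pow8_ge0 om.
have := pow8_ge0 b0; have := pow8_ge0 b1; have := pow8_ge0 b2 => p2 p1 p0.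
have N40 : 0 <= N%:R ^+ 4 :> R by exact: exprn_ge0.
have hY : (N%:R * (A * om ^+ 2)) ^+ 2 / 2 <= (A ^+ 4 + N%:R ^+ 4 * om ^+ 8) / 4.
  have -> : A ^+ 4 = (A ^+ 2) ^+ 2 by rewrite -exprM.
  have -> : N%:R ^+ 4 * om ^+ 8 = ((N%:R * om ^+ 2) ^+ 2) ^+ 2.
    by ring.
  have -> : (N%:R * (A * om ^+ 2)) ^+ 2 = A ^+ 2 * (N%:R * om ^+ 2) ^+ 2.
    by rewrite !exprMn; ring.
  have := sqr_ge0 (A ^+ 2 - (N%:R * om ^+ 2) ^+ 2).
  by move: (A ^+ 2) ((N%:R * om ^+ 2) ^+ 2) => u v; nra.
set rem := 1 + M8 + _ + _.
have hrem : M4 * (N%:R * (A * om ^+ 2)) <= 20 * rem.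
  have h1 : 0 <= N%:R ^+ 4 * hs ^+ 8 by exact: mulr_ge0.
  have h2 : 0 <= N%:R ^+ 4 * om ^+ 8 by exact: mulr_ge0.
  by rewrite /rem mulrDr; lra.
have x1 : 0 <= 1 + x ^+ 2 by rewrite addr_ge0// sqr_ge0.
have q0 : 0 <= 12 * K ^+ 2 * (1 + x ^+ 2) * (A * om ^+ 2).
  by rewrite (le_trans _ ho)// sqr_ge0.
apply: (le_trans (ler_pM w0 (sqr_ge0 _) hw ho)).
have -> : H x * M4 * (12 * K ^+ 2 * (1 + x ^+ 2) * (A * om ^+ 2))
  = 12 * K ^+ 2 / N%:R * (H x * (1 + x ^+ 2)) * (M4 * (N%:R * (A * om ^+ 2))).
  by move: n0 => /lt0r_neq0 n0; field.
have -> : 240 * K ^+ 2 / N%:R * (H x * (1 + x ^+ 2) * rem)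
  = 12 * K ^+ 2 / N%:R * (H x * (1 + x ^+ 2)) * (20 * rem) by ring.
apply: ler_wpM2l => //; apply: mulr_ge0; last exact: mulr_ge0.
by rewrite mulr_ge0 ?invr_ge0// mulr_ge0// sqr_ge0.
Qed.

(** As for the odd parts, with N^2 (om^4 + hs^4) as the quantity of order one: second differences
    gain another factor 1 / N. The constant is 2 times 4. *)
Lemma even_part_le f N x w j : (0 < N)%N -> tame K f -> D x ->
  wt N x w * even_part f (nd N.*2 x w) j ^+ 2
  <= 8 * K ^+ 2 / N%:R ^+ 2 * (H x * (1 + x ^+ 2) * remainder N j w).
Proof.
move=> N0 tf Dx.
have := boltzmann_le N.*2 w (fun j => j.*2) N0 Dx; rewrite -/(wt N x w) => hw.
have w0 : 0 <= wt N x w by exact: boltzmann_ge0.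
have := @quartic_weight_le R N (fun i => b N.*2 w i.*2).
rewrite /even_part.
have := tame_even_le (nd N.*2 x w j.*2) (nd N.*2 x w j.*2.+1)
  (nd N.*2 x w j.*2.+2) K0 tf.
rewrite /remainder.
have -> : (2 * nd N.*2 x w j.*2.+1 - nd N.*2 x w j.*2 - nd N.*2 x w j.*2.+2) / 2
    = mid_dev m beta B N.*2 w j.*2.+1.
  by rewrite /mid_dev/= !(nodeD m beta B N.*2 x w); ring.
have -> : (nd N.*2 x w j.*2.+2 - nd N.*2 x w j.*2) / 2
    = half_step m beta B N.*2 w j.*2.+1.
  by rewrite /half_step/= !(nodeD m beta B N.*2 x w); ring.
move: ((_ + _ - _ - _) / 2) => o.
set om := mid_dev _ _ _ _ _ _; set hs := half_step _ _ _ _ _ _.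
set M8 := mean (fun c => c ^+ 8) _ _.
set M4 := mean _ _ _ in hw *.
move=> ho /(_ (N%:R ^+ 2 * (om ^+ 4 + hs ^+ 4)) N0) hq.
have n0 : 0 < N%:R :> R by rewrite ltr0n.
have M80 : 0 <= M8 by apply: mean_ge0 => c; exact: pow8_ge0.
have := pow8_ge0 (b N.*2 w j.*2); have := pow8_ge0 (b N.*2 w j.*2.+1).
have := pow8_ge0 (b N.*2 w j.*2.+2) => p2 p1 p0.
have hY : (N%:R ^+ 2 * (om ^+ 4 + hs ^+ 4)) ^+ 2 / 2
    <= N%:R ^+ 4 * (om ^+ 8 + hs ^+ 8).
  rewrite exprMn -exprM -[X in X <= _]mulrA ler_wpM2l ?exprn_ge0//.
  have := sqrD_le (om ^+ 4) (hs ^+ 4); rewrite -!exprM.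
  by rewrite -[(4 * 2)%N]/8%N; lra.
set rem := 1 + M8 + _ + _.
have hrem : M4 * (N%:R ^+ 2 * (om ^+ 4 + hs ^+ 4)) <= 4 * rem.
  have : 0 <= N%:R ^+ 4 * (om ^+ 8 + hs ^+ 8).
    by rewrite mulr_ge0 ?exprn_ge0// addr_ge0// pow8_ge0.
  by rewrite /rem; lra.
have x1 : 1 <= 1 + x ^+ 2 by rewrite lerDl sqr_ge0.
apply: (le_trans (ler_pM w0 (sqr_ge0 _) hw ho)).
have -> : H x * M4 * (2 * K ^+ 2 * (om ^+ 4 + hs ^+ 4))
  = 2 * K ^+ 2 / N%:R ^+ 2 * H x * (M4 * (N%:R ^+ 2 * (om ^+ 4 + hs ^+ 4))).
  by move: n0 => /lt0r_neq0 n0; field.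
have k0 : 0 <= 2 * K ^+ 2 / N%:R ^+ 2 * H x.
  by rewrite mulr_ge0// divr_ge0 ?sqr_ge0// mulr_ge0// sqr_ge0.
apply: (le_trans (ler_wpM2l k0 hrem)).
have rem0 : 0 <= rem.
  rewrite !addr_ge0// mulr_ge0 ?exprn_ge0// addr_ge0// pow8_ge0//.
have -> : 8 * K ^+ 2 / N%:R ^+ 2 * (H x * (1 + x ^+ 2) * rem)
  = 2 * K ^+ 2 / N%:R ^+ 2 * H x * (4 * rem) * (1 + x ^+ 2) by ring.
by rewrite ler_peMr// mulr_ge0// mulr_ge0.
Qed.

Let rbnd := G * (1 + 5 * mb).

Let rem_bracket N j : (j < N)%N ->
  (br (fun x w => (H x * (1 + x ^+ 2) * remainder N j w)%R) <= rbnd%:E)%E.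
Proof.
move=> jN; have [mr r0 hr] := remainder_bound jN.
apply: bracket_prod => //.
- apply: measurable_funM => //; apply: measurable_funD => //.
- by move=> x; rewrite mulr_ge0// addr_ge0// sqr_ge0.
- by rewrite addr_ge0// mulr_ge0// moment_bound_ge0.
Qed.

Let jm_rem N j : (j < N)%N ->
  jointly_measurable (fun x w => H x * (1 + x ^+ 2) * remainder N j w).
Proof.
move=> jN; have [mr r0 hr] := remainder_bound jN.
apply: measurable_funM; last exact: (measurableT_comp mr).
apply: measurable_funM; first exact: (measurableT_comp mH).
by apply: measurable_funD => //; apply: measurable_funX.
Qed.

Let rem0 N j x w : (j < N)%N -> 0 <= H x * (1 + x ^+ 2) * remainder N j w.
Proof.
move=> jN; have [mr r0 hr] := remainder_bound jN.
by rewrite mulr_ge0// mulr_ge0// addr_ge0// sqr_ge0.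
Qed.

Section differences.
Variable f : R -> R.
Hypothesis tf : tame K f.
Hypothesis pf : forall x, f (x + L) = f x.
Variable N : nat.
Hypothesis N0 : (0 < N)%N.

Let mf : measurable_fun setT f := tame_measurable tf.

Let W (y : nat -> R) := boltzmann N (fun j => y j.*2).

Let rW M : (N.*2 <= M)%N -> real_node_functional M W.
Proof.
move=> NM; apply: rnf_boltzmann => j jN; apply: leq_trans NM.
by rewrite ltn_double.
Qed.

Let W0 y : 0 <= W y. Proof. exact: boltzmann_ge0. Qed.

Let r_coord (k : nat) : (k <= N.*2)%N ->
  real_node_functional N.*2.+1 (fun y => f (y k)).
Proof. by move=> kN; apply: rnf_comp => //; apply: rnf_coord; rewrite ltnS. Qed.

Let r_odd j : (j < N)%N -> real_node_functional N.*2.+1 (fun y => odd_part f y j).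
Proof.
move=> jN; apply: (rnfM (g := fun=> 2^-1)); last exact: rnf_cst.
apply: rnfD; first by apply: r_coord; rewrite ltn_double.
apply: rnfN; apply: rnf_comp => //.
apply: rnfD; last by apply: rnfN; apply: rnf_coord; rewrite ltnS ltn_double.
apply: rnfD; apply: rnf_coord; rewrite ltnS.
  by rewrite leq_double ltnW.
by rewrite -doubleS leq_double.
Qed.

Let r_even j : (j < N)%N -> real_node_functional N.*2.+1 (fun y => even_part f y j).
Proof.
move=> jN; apply: (rnfM (g := fun=> 2^-1)); last exact: rnf_cst.
apply: rnfD; last by apply: rnfN; apply: r_coord; rewrite -doubleS leq_double.
apply: rnfD; last by apply: rnfN; apply: r_coord; rewrite leq_double ltnW.
apply: rnfD; first by apply: r_coord; rewrite ltn_double.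
apply: rnf_comp => //.
apply: rnfD; last by apply: rnfN; apply: rnf_coord; rewrite ltnS ltn_double.
apply: rnfD; apply: rnf_coord; rewrite ltnS.
  by rewrite leq_double ltnW.
by rewrite -doubleS leq_double.
Qed.

Let r_odds k : (k <= N)%N ->
  real_node_functional N.*2.+1 (fun y => \sum_(j < k) odd_part f y j).
Proof.
by move=> kN; apply: rnf_sum => i; apply: r_odd; exact: leq_trans kN.
Qed.

Let c_odd := 240 * K ^+ 2 / N%:R * rbnd.

Let odd_bracket j : (j < N)%N ->
  (br (fun x w => (W (nd N.*2 x w) * odd_part f (nd N.*2 x w) j ^+ 2)%R) <= c_odd%:E)%E.
Proof.
move=> jN.
apply: (@bracket_leZ _ _ _ _ _ mD _
  (fun x w => H x * (1 + x ^+ 2) * remainder N j w)).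
- apply: divr_ge0; last exact: ler0n.
  by apply: mulr_ge0; [exact: ler0n|exact: sqr_ge0].
- apply: (jointly_measurable_nodes N.*2 (M := N.*2.+1)
    (f := fun y => W y * odd_part f y j ^+ 2)).
  by apply: rnfM; [exact: rW|apply: rnfX; exact: r_odd].
- exact: jm_rem.
- by move=> x w; rewrite mulr_ge0// sqr_ge0.
- by move=> x w; exact: rem0.
- by move=> x w Dx; exact: odd_part_le.
- exact: rem_bracket.
Qed.

Let reflection k (y : nat -> R) j :=
  if j == k then y k.-1 + y k.+1 - y k else y j.

Let bracket_reflect k g : (0 < k < N.*2)%N -> real_node_functional N.*2.+1 g ->
  (forall y, 0 <= g y) ->
  br (fun x w => g (reflection k (nd N.*2 x w))) = br (fun x w => g (nd N.*2 x w)).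
Proof.
move=> hk rg g0; apply: eq_integral => x _.
exact: (reflect_node m beta hB x hk (rnf_node_functional rg g0)).
Qed.

(* The weight depends on the even nodes only, so reflecting the last odd node changes
   nothing but the sign of the last summand, and the cross terms cancel. *)
Lemma odd_parts_orthogonal k : (k <= N)%N ->
  (br (fun x w => (W (nd N.*2 x w) * (\sum_(j < k) odd_part f (nd N.*2 x w) j) ^+ 2)%R)
   <= (k%:R * c_odd)%:E)%E.
Proof.
elim: k => [_|k ih kN].
  rewrite mul0r /bracket integral0_eq// => x _; rewrite integral0_eq// => w _.
  by rewrite big_ord0 expr0n/= mulr0.
pose S (y : nat -> R) := \sum_(j < k) odd_part f y j.
pose o (y : nat -> R) := odd_part f y k.
pose F y := W y * (S y + o y) ^+ 2.
pose F' y := W y * (S y - o y) ^+ 2.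
have rS : real_node_functional N.*2.+1 S by apply: r_odds; exact: ltnW.
have ro : real_node_functional N.*2.+1 o by exact: r_odd.
have rW' : real_node_functional N.*2.+1 W by exact: rW.
have rF : real_node_functional N.*2.+1 F by apply: rnfM => //; apply: rnfX; exact: rnfD.
have rF' : real_node_functional N.*2.+1 F'.
  by apply: rnfM => //; apply: rnfX; apply: rnfD => //; exact: rnfN.
have F0 y : 0 <= F y by rewrite mulr_ge0// sqr_ge0.
have F'0 y : 0 <= F' y by rewrite mulr_ge0// sqr_ge0.
have FE y : F (reflection k.*2.+1 y) = F' y.
  rewrite /F /F'; congr (_ * (_ + _) ^+ 2).
  - rewrite /W /boltzmann /mean; congr expR; congr (- (_ * (_ * _))).
    apply: eq_bigr => i _; rewrite /reflection ifN//.
    by apply/eqP => /(congr1 odd); rewrite oddS !odd_double.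
  - apply: eq_bigr => i _; rewrite /odd_part /reflection.
    have := ltn_ord i => ik.
    rewrite !ifN//; first by rewrite neq_ltn -doubleS ltnS leq_double ik.
    + by rewrite neq_ltn ltnS leq_double ltnW.
    + by rewrite eqSS -!muln2 eqn_pmul2r// neq_ltn ik.
  - rewrite /o /odd_part /reflection eqxx !ifN /=.
    + rewrite (_ : y k.*2 + _ - (_ + _ - _) = y k.*2.+1); last by ring.
      by rewrite -mulNr opprB.
    + by rewrite neq_ltn ltnSn orbT.
    + by rewrite neq_ltn ltnSn.
have brF : br (fun x w => F' (nd N.*2 x w)) = br (fun x w => F (nd N.*2 x w)).
  rewrite -(bracket_reflect (k := k.*2.+1) _ rF F0)/=; last by rewrite ltn_Sdouble.
  by congr bracket; apply/funext => x; apply/funext => w; rewrite FE.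
(* The parallelogram identity F + F' = 2 W S^2 + 2 W o^2 removes the cross term without integrating
   a signed function, and [brF] makes the two brackets on the left equal. *)
have : (br (fun x w => (F (nd N.*2 x w) + F' (nd N.*2 x w))%R)
    <= (2 * (k%:R * c_odd) + 2 * c_odd)%:E)%E.
  apply: (bracket_le2 mD (ler0n R 2) (ler0n R 2) _ _ _ _ _ _ _ (ih (ltnW kN)) (odd_bracket kN)).
  - exact: (jointly_measurable_nodes (f := fun y => F y + F' y) N.*2 (rnfD rF rF')).
  - apply: (jointly_measurable_nodes (f := fun y => W y * S y ^+ 2) N.*2 (M := N.*2.+1)).
    by apply: rnfM; [exact: rW'|exact: rnfX].
  - apply: (jointly_measurable_nodes (f := fun y => W y * o y ^+ 2) N.*2 (M := N.*2.+1)).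
    by apply: rnfM; [exact: rW'|exact: rnfX].
  - by move=> x w; exact: addr_ge0.
  - by move=> x w; rewrite mulr_ge0// sqr_ge0.
  - by move=> x w; rewrite mulr_ge0// sqr_ge0.
  - by move=> x w _; rewrite /F /F' /S /o le_eqVlt; apply/orP; left; apply/eqP; ring.
rewrite bracketD//; last 2 first.
- exact: (jointly_measurable_nodes N.*2 rF).
- exact: (jointly_measurable_nodes N.*2 rF').
rewrite brF; have -> : br (fun x w => F (nd N.*2 x w)) = br (fun x w =>
    (W (nd N.*2 x w) * (\sum_(j < k.+1) odd_part f (nd N.*2 x w) j) ^+ 2)%R).
  by congr bracket; apply/funext => x; apply/funext => w; rewrite /F big_ord_recr.
move=> h; apply: lee_double; have -> // : 2 * (k.+1%:R * c_odd) = 2 * (k%:R * c_odd) + 2 * c_odd.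
by rewrite -(natr1 k) -mulrDr; congr (_ * _); rewrite mulrDl mul1r.
Qed.

(** The number 496 is 2 * 240 + 2 * 8, from the odd and the even parts. *)
Definition gap_const : R := 496 * K ^+ 2 * (G * (1 + 5 * mb)).

(** The odd parts are added by orthogonality: N terms, each of order 1 / N in weighted mean square.
    The even parts are of order 1 / N^2 there, and Cauchy-Schwarz is enough for them. *)
Lemma mean_gap_even :
  (br (fun x w => (boltzmann N (fun j => nd N.*2 x w j.*2)
     * (mean f N (fun j => nd N.*2 x w j.*2.+1)
        - mean f N (fun j => nd N.*2 x w j.*2)) ^+ 2)%R)
   <= (gap_const / N%:R ^+ 2)%:E)%E.
Proof.
have n0 : N%:R != 0 :> R by rewrite pnatr_eq0 -lt0n.
pose c_even := 8 * K ^+ 2 / N%:R ^+ 2 * rbnd.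
have jE (i : 'I_N) : jointly_measurable
    (fun x w => W (nd N.*2 x w) * even_part f (nd N.*2 x w) i ^+ 2).
  apply: (jointly_measurable_nodes N.*2 (M := N.*2.+1)
    (f := fun y => W y * even_part f y i ^+ 2)).
  by apply: rnfM; [exact: rW|apply: rnfX; exact: r_even].
have hE : (br (fun x w => (\sum_(j < N) (W (nd N.*2 x w)
    * even_part f (nd N.*2 x w) j ^+ 2))%R) <= (N%:R * c_even)%:E)%E.
  apply: bracket_sum_le => //.
  - by move=> i x w; rewrite mulr_ge0// sqr_ge0.
  - move=> i; apply: (@bracket_leZ _ _ _ _ _ mD _
      (fun x w => H x * (1 + x ^+ 2) * remainder N i w)).
    + by rewrite mulr_ge0 ?invr_ge0 ?sqr_ge0// mulr_ge0// sqr_ge0.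
    + exact: jE.
    + exact: jm_rem.
    + by move=> x w; rewrite mulr_ge0// sqr_ge0.
    + by move=> x w; exact: rem0.
    + by move=> x w Dx; exact: even_part_le.
    + exact: rem_bracket.
have hO := odd_parts_orthogonal (leqnn N).
have -> : gap_const / N%:R ^+ 2 = 2 / N%:R ^+ 2 * (N%:R * c_odd)
    + 2 / N%:R * (N%:R * c_even).
  by rewrite /gap_const /c_odd /c_even -/rbnd; field.
have k1 : 0 <= 2 / N%:R ^+ 2 :> R by rewrite divr_ge0// sqr_ge0.
have k2 : 0 <= 2 / N%:R :> R by rewrite divr_ge0.
apply: (bracket_le2 mD k1 k2 _ _ _ _ _ _ _ hO hE).
- apply: (jointly_measurable_nodes N.*2 (M := N.*2.+1) (f := fun y => W y
    * (mean f N (fun j => y j.*2.+1) - mean f N (fun j => y j.*2)) ^+ 2)).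
  by apply: rnf_gap => // j jN; rewrite ltnS leq_double ltnW.
- apply: (jointly_measurable_nodes N.*2 (M := N.*2.+1)
    (f := fun y => W y * (\sum_(j < N) odd_part f y j) ^+ 2)).
  by apply: rnfM; [exact: rW|apply: rnfX; exact: r_odds].
- apply: (jointly_measurable_nodes N.*2 (M := N.*2.+1)
    (f := fun y => \sum_(j < N) W y * even_part f y j ^+ 2)).
  by apply: rnf_sum => i; apply: rnfM; [exact: rW|apply: rnfX; exact: r_even].
- by move=> x w; rewrite mulr_ge0 ?sqr_ge0 ?boltzmann_ge0.
- by move=> x w; rewrite mulr_ge0// sqr_ge0.
- by move=> x w; apply: sumr_ge0 => i _; rewrite mulr_ge0// sqr_ge0.
move=> x w _; rewrite mean_odd_sub_even; last first.
  by rewrite node_last ?double_gt0// (node0 _ _ hB).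
rewrite -/(W _); move: (W _) (W0 (nd N.*2 x w)) => u u0.
set O := \sum_(j < N) odd_part _ _ _; set E := \sum_(j < N) even_part _ _ _.
rewrite -mulr_sumr; set Q := \sum_(j < N) _.
have hQ : E ^+ 2 <= N%:R * Q by exact: sum_sqr_le.
have := sqrD_le O E => hOE.
have -> : u * (N%:R^-1 * (O + E)) ^+ 2 = u / N%:R ^+ 2 * (O + E) ^+ 2.
  by field.
have -> : 2 / N%:R ^+ 2 * (u * O ^+ 2) + 2 / N%:R * (u * Q)
    = u / N%:R ^+ 2 * (2 * (O ^+ 2 + N%:R * Q)).
  by field.
by rewrite ler_wpM2l ?divr_ge0 ?sqr_ge0// (le_trans hOE)//; lra.
Qed.

(** A shift by one node exchanges the even and the odd nodes, the closed loop supplying the last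
    one, and the squared difference is insensitive to the exchange. *)
Lemma mean_gap_odd :
  (br (fun x w => (boltzmann N (fun j => nd N.*2 x w j.*2.+1)
     * (mean f N (fun j => nd N.*2 x w j.*2.+1)
        - mean f N (fun j => nd N.*2 x w j.*2)) ^+ 2)%R)
   <= (gap_const / N%:R ^+ 2)%:E)%E.
Proof.
apply: le_trans mean_gap_even.
pose F (y : nat -> R) := boltzmann N (fun j => y j.*2)
  * (mean f N (fun j => y j.*2.+1) - mean f N (fun j => y j.*2)) ^+ 2.
rewrite -(bracket_shift (f := F) (M := N.*2)).
- rewrite le_eqVlt; apply/orP; left; apply/eqP.
  congr bracket; apply/funext => x; apply/funext => w.
  rewrite /F (mean_rot f (y := nd N.*2 x w)).
    by rewrite -[(_ - _) ^+ 2]sqrrN opprB.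
  by rewrite node_last ?double_gt0// (node0 _ _ hB).
- by rewrite double_gt0.
- by apply: rnf_gap => // j jN; rewrite ltn_double.
- by move=> y; rewrite mulr_ge0 ?sqr_ge0 ?boltzmann_ge0.
- move=> y; rewrite /F /boltzmann (mean_period N double y pV).
  by rewrite (mean_period N double y pf) (mean_period N (fun j => j.*2.+1) y pf).
Qed.

End differences.

End doubling.

Lemma fine_dist_le (R : realType) (x y : \bar R) (c : R) :
  x \is a fin_num -> y \is a fin_num ->
  (x <= y + c%:E)%E -> (y <= x + c%:E)%E -> `|fine x - fine y| <= c.
Proof.
move=> fx fy; rewrite -(fineK fx) -(fineK fy) -!EFinD !lee_fin => h1 h2.
by rewrite ler_distl lerBlDr h1 h2.
Qed.

(** * The trace and its change under doubling *)

Section loop_trace.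
Context {R : realType} d (T : measurableType d) (P : probability T R).
Variables (m beta : R) (B : R -> T -> R).
Hypothesis hB : standard_brownian_motion P B.
Variables (D : set R) (L G K : R) (H V : R -> R).
Hypothesis hC : confinement beta D L G K H V.

Local Notation nd M x w := (node m beta B M x w).
Local Notation br := (bracket P D).
Local Notation mb := (moment_bound m beta).
Local Notation boltz := (boltzmann beta V).

Let pD : period_domain D L. Proof. by case: hC. Qed.
Let mD : measurable D. Proof. by have [] := pD. Qed.
Let mV : measurable_fun setT V.
Proof. by apply: tame_measurable (potential_tame hC). Qed.

Definition loop_trace N (f : R -> R) : \bar R :=
  br (fun x w => (mean f N (nd N x w) * boltz N (nd N x w))%R).

Lemma node_double N x w j : nd N.*2 x w j.*2 = nd N x w j.
Proof.
rewrite /node; congr brownian_loop.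
rewrite -!muln2 !natrM invfM mulrACA divff ?mulr1//.
Qed.

Lemma boltzmann_period N (k : nat -> nat) y :
  boltz N (fun j => y (k j) + L) = boltz N (fun j => y (k j)).
Proof. by rewrite /boltzmann (mean_period N k y (potential_periodic hC)). Qed.

Lemma jointly_measurable_boltzmann N :
  jointly_measurable (fun x w => boltz N (nd N x w)).
Proof.
apply: (jointly_measurable_nodes m beta hB N (M := N) (f := boltz N)).
exact: (rnf_boltzmann hC (k := id)).
Qed.

(** The case Y = 1 of [quartic_weight_le], with the constant 4 + 1/2 rounded up to 5. *)
Lemma boltzmann_le_pow8 N x w : (0 < N)%N -> D x ->
  boltz N (nd N x w)
  <= H x * (5 * (1 + mean (fun c => c ^+ 8) N (node m beta B N 0 w))).
Proof.
move=> N0 Dx; apply: (le_trans (boltzmann_le m B hC N w id N0 Dx)).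
apply: ler_wpM2l; first exact: (profile_ge0 hC).
have := quartic_weight_le (node m beta B N 0 w) 1 N0.
rewrite mulr1 expr1n => /le_trans; apply.
have : 0 <= mean (fun c => c ^+ 8) N (node m beta B N 0 w).
  by apply: mean_ge0 => c; exact: pow8_ge0.
by move: (mean _ _ _) => u; lra.
Qed.

Lemma mean_succ N (f : R -> R) (y : nat -> R) : y N = y 0%N ->
  mean f N (fun j => y j.+1) = mean f N y.
Proof.
case: N => [|N] yN; first by rewrite /mean !big_ord0.
rewrite /mean; congr (_ * _).
by rewrite big_ord_recr [RHS]big_ord_recl/= addrC yN.
Qed.

Section observable.
Variables (f : R -> R) (kf : R).
Hypothesis mf : measurable_fun setT f.
Hypothesis f0 : forall x, 0 <= f x.
Hypothesis fk : forall x, f x <= kf.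
Hypothesis pf : forall x, f (x + L) = f x.

Let kf0 : 0 <= kf. Proof. exact: le_trans (f0 0) (fk 0). Qed.

Let r_integrand M N (k : nat -> nat) : (forall j, (j < N)%N -> (k j < M)%N) ->
  real_node_functional M
    (fun y => mean f N (fun j => y (k j)) * boltz N (fun j => y (k j))).
Proof.
move=> kM; apply: rnfM; first exact: rnf_mean.
exact: (rnf_boltzmann hC).
Qed.

Lemma loop_trace_le N : (0 < N)%N ->
  (loop_trace N f <= (kf * (5 * (G * (1 + mb))))%:E)%E.
Proof.
move=> N0.
have [mM M80 hM] := mean_pow8_bound m beta hB (k := id) N0 N0 (fun j => @ltnW _ _).
set M8 := (fun w => 1 + _) in mM M80 hM.
have HX x : 0 <= H x * (1 + x ^+ 2).
  exact: mulr_ge0 (profile_ge0 hC x) (addr_ge0 ler01 (sqr_ge0 x)).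
rewrite [kf * _]mulrA.
apply: (@bracket_leZ _ _ _ _ _ mD _ (fun x w => H x * (1 + x ^+ 2) * M8 w)).
- exact: mulr_ge0.
- apply: (jointly_measurable_nodes m beta hB N (M := N)
    (f := fun y => mean f N y * boltz N y)).
  exact: (r_integrand (k := id)).
- apply: measurable_funM; last exact: (measurableT_comp mM).
  apply: measurable_funM; first exact: (measurableT_comp (measurable_profile hC)).
  by apply: measurable_funD => //; apply: measurable_funX.
- by move=> x w; rewrite mulr_ge0 ?boltzmann_ge0// mean_ge0.
- by move=> x w; exact: mulr_ge0 (HX x) (M80 w).
- move=> x w Dx.
  have h1 : mean f N (nd N x w) <= kf by exact: mean_le_cst.
  have H0 := profile_ge0 hC x.
  have x1 : 1 <= 1 + x ^+ 2 by rewrite lerDl sqr_ge0.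
  have h4 : boltz N (nd N x w) <= H x * (5 * M8 w) by exact: boltzmann_le_pow8.
  apply: (le_trans (ler_pM _ _ h1 h4)) => //.
  + exact: mean_ge0.
  + exact: boltzmann_ge0.
  have -> : kf * (H x * (5 * M8 w)) = kf * 5 * (H x * M8 w) by ring.
  apply: ler_wpM2l; first exact: mulr_ge0.
  by apply: (ler_wpM2r (M80 w)); rewrite ler_peMr.
- apply: (bracket_prod mD) => //.
  + apply: measurable_funM; first exact: (measurable_profile hC).
    by apply: measurable_funD => //; apply: measurable_funX.
  + by rewrite addr_ge0// moment_bound_ge0.
  + exact: (profile_integral hC).
Qed.

Lemma loop_trace_ge0 N : (0 <= loop_trace N f)%E.
Proof.
by apply: bracket_ge0 => x w; rewrite mulr_ge0 ?boltzmann_ge0// mean_ge0.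
Qed.

Lemma loop_trace_fin N : (0 < N)%N -> loop_trace N f \is a fin_num.
Proof.
move=> N0; rewrite ge0_fin_numE ?loop_trace_ge0//.
exact: le_lt_trans (loop_trace_le N0) (ltry _).
Qed.

(* Every node of the loop has the same weighted law, so the average over the nodes
   may be replaced by the value at the starting point. *)
Lemma loop_trace_start N : (0 < N)%N ->
  br (fun x w => (f x * boltz N (nd N x w))%R) = loop_trace N f.
Proof.
move=> N0.
pose F j (y : nat -> R) := f (y j) * boltz N y.
have F0 j y : 0 <= F j y by rewrite mulr_ge0 ?boltzmann_ge0.
have rF j : (j < N)%N -> real_node_functional N (F j).
  move=> jN; apply: rnfM; first by apply: rnf_comp => //; exact: rnf_coord.
  exact: (rnf_boltzmann hC (k := id)).
have eF j : (j < N)%N -> br (fun x w => F j (nd N x w)) = br (fun x w => F 0%N (nd N x w)).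
  elim: j => [//|j ih jN]; rewrite -(ih (ltnW jN)).
  have FL y : F j (fun i => y i + L) = F j y.
    by rewrite /F pf; congr (_ * _); exact: (boltzmann_period N id).
  rewrite -(bracket_shift m hB hC N0 (rF j (ltnW jN)) (F0 j) FL).
  congr bracket; apply/funext => x; apply/funext => w; rewrite /F; congr (_ * _).
  rewrite /boltzmann mean_succ; first by [].
  by rewrite node_last ?(node0 m beta hB).
have -> : br (fun x w => (f x * boltz N (nd N x w))%R) = br (fun x w => F 0%N (nd N x w)).
  congr bracket; apply/funext => x; apply/funext => w.
  by rewrite /F (node0 m beta hB).
rewrite /loop_trace.
have -> : br (fun x w => (mean f N (nd N x w) * boltz N (nd N x w))%R)
    = br (fun x w => (N%:R^-1 * \sum_(j < N) F j (nd N x w))%R).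
  congr bracket; apply/funext => x; apply/funext => w.
  by rewrite /mean -mulrA mulr_suml.
have sumE k : (k <= N)%N -> br (fun x w => (\sum_(j < k) F j (nd N x w))%R)
    = (k%:R%:E * br (fun x w => F 0%N (nd N x w)))%E.
  elim: k => [_|k ih kN].
    rewrite mul0e /bracket integral0_eq// => x _; rewrite integral0_eq// => w _.
    by rewrite big_ord0.
  rewrite [X in bracket _ _ X](_ : _ = fun x w =>
      \sum_(j < k) F j (nd N x w) + F k (nd N x w)); last first.
    by apply/funext => x; apply/funext => w; rewrite big_ord_recr.
  rewrite bracketD//.
  - rewrite (ih (ltnW kN)) eF// -(natr1 k) EFinD ge0_muleDl ?mul1e// ?lee_fin//.
  - apply: (jointly_measurable_nodes m beta hB N (M := N)
      (f := fun y => \sum_(j < k) F j y)).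
    by apply: rnf_sum => i; apply: rF; exact: ltn_trans kN.
  - exact: (jointly_measurable_nodes m beta hB N (rF k kN)).
  - by move=> x w; exact: sumr_ge0.
rewrite bracketZ//.
- rewrite (sumE N)// muleA -EFinM mulVf ?mul1e//.
  by rewrite pnatr_eq0 -lt0n.
- apply: (jointly_measurable_nodes m beta hB N (M := N)
    (f := fun y => \sum_(j < N) F j y)).
  by apply: rnf_sum => i; exact: rF.
- by move=> x w; exact: sumr_ge0.
Qed.

Let evens N x w := mean f N (fun j => nd N.*2 x w j.*2)
  * boltz N (fun j => nd N.*2 x w j.*2).
Let odds N x w := mean f N (fun j => nd N.*2 x w j.*2.+1)
  * boltz N (fun j => nd N.*2 x w j.*2.+1).

Let evens_trace N : br (evens N) = loop_trace N f.
Proof.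
congr bracket; apply/funext => x; apply/funext => w; rewrite /evens.
by under [fun j => nd _ _ _ _]eq_fun do rewrite node_double.
Qed.

(** One rotation step of the doubled loop carries its even nodes to the odd ones. *)
Let odds_trace N : (0 < N)%N -> br (odds N) = loop_trace N f.
Proof.
move=> N0; rewrite -evens_trace.
pose F (y : nat -> R) := mean f N (fun j => y j.*2) * boltz N (fun j => y j.*2).
rewrite /evens -(bracket_shift m hB hC (M := N.*2) (f := F))//.
- by rewrite double_gt0.
- by apply: r_integrand => j jN; rewrite ltn_double.
- by move=> y; rewrite mulr_ge0 ?boltzmann_ge0// mean_ge0.
- move=> y; rewrite /F (boltzmann_period N double) (mean_period N double y pf)//.
Qed.

Let evens_jm N : jointly_measurable (evens N).
Proof.
apply: (jointly_measurable_nodes m beta hB N.*2 (M := N.*2)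
  (f := fun y => mean f N (fun j => y j.*2) * boltz N (fun j => y j.*2))).
by apply: r_integrand => j jN; rewrite ltn_double.
Qed.

Let odds_jm N : jointly_measurable (odds N).
Proof.
apply: (jointly_measurable_nodes m beta hB N.*2 (M := N.*2)
  (f := fun y => mean f N (fun j => y j.*2.+1) * boltz N (fun j => y j.*2.+1))).
by apply: r_integrand => j jN; rewrite ltn_Sdouble.
Qed.

Hypothesis tf : tame K f.

(** One half of the right side of [exp_mean_gap], with u and v equal to beta times the two means of
    [V]; [rho] selects the even or the odd nodes for the exponential weight. *)
Let weighted_gap N (rho : nat -> nat) x w :=
  boltz N (fun j => nd N.*2 x w (rho j))
  * (beta ^+ 2 * (mean V N (fun j => nd N.*2 x w j.*2.+1)
                  - mean V N (fun j => nd N.*2 x w j.*2)) ^+ 2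
     + (mean f N (fun j => nd N.*2 x w j.*2.+1)
        - mean f N (fun j => nd N.*2 x w j.*2)) ^+ 2).

Let weighted_gap_ge0 N rho x w : 0 <= weighted_gap N rho x w.
Proof.
by rewrite mulr_ge0 ?boltzmann_ge0// addr_ge0 ?sqr_ge0// mulr_ge0 ?sqr_ge0.
Qed.

Let weighted_gap_le N rho q : (forall j, (j < N)%N -> (rho j < N.*2)%N) ->
  (br (fun x w => (boltz N (fun j => nd N.*2 x w (rho j))
      * (mean V N (fun j => nd N.*2 x w j.*2.+1)
         - mean V N (fun j => nd N.*2 x w j.*2)) ^+ 2)%R) <= q%:E)%E ->
  (br (fun x w => (boltz N (fun j => nd N.*2 x w (rho j))
      * (mean f N (fun j => nd N.*2 x w j.*2.+1)
         - mean f N (fun j => nd N.*2 x w j.*2)) ^+ 2)%R) <= q%:E)%E ->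
  jointly_measurable (weighted_gap N rho) /\
  (br (weighted_gap N rho) <= (beta ^+ 2 * q + 1 * q)%:E)%E.
Proof.
move=> rN hV hf.
have jm_gap h : measurable_fun setT h ->
    jointly_measurable (fun x w => boltz N (fun j => nd N.*2 x w (rho j))
      * (mean h N (fun j => nd N.*2 x w j.*2.+1)
         - mean h N (fun j => nd N.*2 x w j.*2)) ^+ 2).
  move=> mh; apply: (jointly_measurable_nodes m beta hB N.*2 (M := N.*2)
    (f := fun y => boltz N (fun j => y (rho j))
      * (mean h N (fun j => y j.*2.+1) - mean h N (fun j => y j.*2)) ^+ 2)).
  exact: (rnf_gap hC).
have jY : jointly_measurable (weighted_gap N rho).
  have := jointly_measurableD
    (jointly_measurableZ (beta ^+ 2) (jm_gap V mV)) (jm_gap f mf).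
  apply: eq_measurable_fun => p _ /=; rewrite /weighted_gap.
  by rewrite mulrDr mulrCA.
split=> //; apply: (bracket_le2 mD (sqr_ge0 beta) ler01 jY (jm_gap V mV)
  (jm_gap f mf) _ _ _ _ hV hf).
- exact: weighted_gap_ge0.
- by move=> x w; rewrite mulr_ge0 ?boltzmann_ge0 ?sqr_ge0.
- by move=> x w; rewrite mulr_ge0 ?boltzmann_ge0 ?sqr_ge0.
- by move=> x w _; rewrite /weighted_gap mul1r mulrDr mulrCA.
Qed.

(** Two weights, each with the factor (kf + 1) / 8 of [exp_mean_gap], give (kf + 1) / 4; the terms
    beta^2 and 1 come from the gaps of [V] and of [f]. *)
Definition doubling_const : R :=
  (kf + 1) / 4 * ((beta ^+ 2 + 1) * gap_const m beta G K).

(** Half the sum of the even and the odd integrands integrates to the trace for N, so its pointwise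
    distance to the integrand for 2N, controlled by [exp_mean_gap], bounds the difference of the
    traces. *)
Lemma loop_trace_double N : (0 < N)%N ->
  `|fine (loop_trace N f) - fine (loop_trace N.*2 f)| <= doubling_const / N%:R ^+ 2.
Proof.
move=> N0; have N20 : (0 < N.*2)%N by rewrite double_gt0.
have V0 := potential_tame hC; have pV := potential_periodic hC.
pose q := gap_const m beta G K / N%:R ^+ 2.
pose ev (h : R -> R) x w := mean h N (fun j => nd N.*2 x w j.*2).
pose od (h : R -> R) x w := mean h N (fun j => nd N.*2 x w j.*2.+1).
pose Y1 x w := weighted_gap N double x w.
pose Y2 x w := weighted_gap N (fun j => j.*2.+1) x w.
pose k := (kf + 1) / 8.
have k0 : 0 <= k by rewrite divr_ge0// addr_ge0.
pose g x w := k * Y1 x w + k * Y2 x w.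
have [jY1 bY1] : jointly_measurable Y1 /\ (br Y1 <= (beta ^+ 2 * q + 1 * q)%:E)%E.
  apply: weighted_gap_le; first by move=> j jN; rewrite ltn_double.
    exact: (mean_gap_even m hB hC V0 N0).
  exact: (mean_gap_even m hB hC tf N0).
have [jY2 bY2] : jointly_measurable Y2 /\ (br Y2 <= (beta ^+ 2 * q + 1 * q)%:E)%E.
  apply: weighted_gap_le; first by move=> j jN; rewrite ltn_Sdouble.
    exact: (mean_gap_odd m hB hC V0 pV N0).
  exact: (mean_gap_odd m hB hC tf pf N0).
have Y10 x w : 0 <= Y1 x w by exact: weighted_gap_ge0.
have Y20 x w : 0 <= Y2 x w by exact: weighted_gap_ge0.
have jg : jointly_measurable g by apply: jointly_measurableD; exact: jointly_measurableZ.
have g0 x w : 0 <= g x w by rewrite addr_ge0// mulr_ge0.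
have bg : (br g <= (doubling_const / N%:R ^+ 2)%:E)%E.
  have -> : doubling_const / N%:R ^+ 2 = k * (beta ^+ 2 * q + 1 * q) + k * (beta ^+ 2 * q + 1 * q).
    rewrite /doubling_const /k /q; move: (gap_const _ _ _ _) (N%:R ^+ 2)^-1 => a c.
    by field.
  by apply: (bracket_le2 mD k0 k0 jg jY1 jY2 g0 Y10 Y20 _ bY1 bY2) => x w _; exact: lexx.
pose M x w := mean f N.*2 (nd N.*2 x w) * boltz N.*2 (nd N.*2 x w).
have jM : jointly_measurable M.
  apply: (jointly_measurable_nodes m beta hB N.*2 (M := N.*2)
    (f := fun y => mean f N.*2 y * boltz N.*2 y)).
  exact: (r_integrand (k := id)).
have M0 x w : 0 <= M x w by rewrite mulr_ge0 ?boltzmann_ge0// mean_ge0.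
pose A x w := 2^-1 * evens N x w + 2^-1 * odds N x w.
have h20 : 0 <= 2^-1 :> R by rewrite invr_ge0.
have e0 x w : 0 <= evens N x w by rewrite mulr_ge0 ?boltzmann_ge0// mean_ge0.
have o0 x w : 0 <= odds N x w by rewrite mulr_ge0 ?boltzmann_ge0// mean_ge0.
have jA : jointly_measurable A.
  by apply: jointly_measurableD; apply: jointly_measurableZ; [exact: evens_jm|exact: odds_jm].
have A0 x w : 0 <= A x w by rewrite addr_ge0// mulr_ge0.
have fN := loop_trace_fin N0; have f2N := loop_trace_fin N20.
have bA : br A = loop_trace N f.
  rewrite bracketD//.
  - rewrite !bracketZ// ?evens_trace ?odds_trace//.
    by rewrite -(fineK fN) -!EFinM -EFinD; congr _%:E; field.
  - by apply: jointly_measurableZ; exact: evens_jm.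
  - by apply: jointly_measurableZ; exact: odds_jm.
  - by move=> x w; rewrite mulr_ge0.
  - by move=> x w; rewrite mulr_ge0.
have AMg x w : `|A x w - M x w| <= g x w.
  have hev : 0 <= ev f x w <= kf by rewrite mean_ge0//= mean_le_cst.
  have hod : 0 <= od f x w <= kf by rewrite mean_ge0//= mean_le_cst.
  have := exp_mean_gap (beta * ev V x w) (beta * od V x w) hev hod.
  have -> : A x w = (ev f x w * expR (- (beta * ev V x w))
      + od f x w * expR (- (beta * od V x w))) / 2.
    by rewrite /A /evens /odds /boltzmann /ev /od; field.
  have -> : M x w = (ev f x w + od f x w) / 2
      * expR (- ((beta * ev V x w + beta * od V x w) / 2)).
    rewrite /M /boltzmann !mean_double -/(ev f x w) -/(od f x w).
    by rewrite -/(ev V x w) -/(od V x w); congr (_ * expR (- _)); field.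
  move=> /le_trans; apply.
  rewrite /g /Y1 /Y2 /weighted_gap /boltzmann -/k -/(ev V x w) -/(od V x w).
  rewrite -/(ev f x w) -/(od f x w).
  rewrite le_eqVlt; apply/orP; left; apply/eqP; ring.
(* Adding [g] on one side avoids subtracting extended-real integrals; the comparison is used in both
   directions. *)
have br_le (X Y : R -> T -> R) : jointly_measurable X -> jointly_measurable Y ->
    (forall x w, 0 <= X x w) -> (forall x w, 0 <= Y x w) ->
    (forall x w, `|X x w - Y x w| <= g x w) ->
    (br X <= br Y + (doubling_const / N%:R ^+ 2)%:E)%E.
  move=> jX jY X0 Y0 XYg.
  apply: (@le_trans _ _ (br (fun x w => Y x w + g x w)%R)).
    refine (@le_bracket _ _ _ P _ mD _ (fun x w => Y x w + g x w) jX
      (jointly_measurableD jY jg) X0 _ _).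
    - by move=> x w; rewrite addr_ge0.
    - by move=> x w _; rewrite -lerBlDl (le_trans (ler_norm _)).
  rewrite (bracketD P mD jY jg Y0 g0); exact: leeD2l bg.
have h1 := br_le A M jA jM A0 M0 AMg.
have h2 : (br M <= br A + (doubling_const / N%:R ^+ 2)%:E)%E.
  by apply: br_le => // x w; rewrite distrC.
rewrite bA in h1 h2.
exact: fine_dist_le fN f2N h1 h2.
Qed.

End observable.

End loop_trace.

(** * The limit of infinitely many nodes *)

Section riemann_sums.
Context {R : realType}.
Implicit Type g : R -> R.

(** Heine's theorem from the covering form of compactness: each point has a neighbourhood on which
    the bound holds for all large n, and finitely many of these suffice. *)
Lemma uniformly_continuous_unit g : {within `[0, 1], continuous g} ->
  forall e, 0 < e -> \forall n \near \oo, forall s t, 0 <= s <= 1 -> 0 <= t <= 1 ->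
    `|t - s| <= n.+1%:R^-1 -> `|g t - g s| <= e.
Proof.
move=> /subspace_continuousP cg e e0.
have e20 : 0 < e / 2 by exact: divr_gt0.
have /compact_near_coveringP/near_covering_withinP hK := @segment_compact R 0 1.
have hP : \forall n \near \oo, `[0, 1] `<=` (fun s => forall t, 0 <= t <= 1 ->
    `|t - s| <= n.+1%:R^-1 -> `|g t - g s| <= e).
  apply: (hK nat \oo (fun n s => forall t, 0 <= t <= 1 ->
    `|t - s| <= n.+1%:R^-1 -> `|g t - g s| <= e)).
  move=> x Kx; have := cg x Kx => /cvgrPdist_lt /(_ _ e20).
  rewrite near_withinE => /nbhs_ballP[del /= del0 hdel].
  have d20 : 0 < del / 2 by exact: divr_gt0.
  exists (ball x (del / 2), [set n | n.+1%:R^-1 < del / 2]).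
    split; first exact: nbhsx_ballx.
    exact: near_infty_natSinv_lt (PosNum d20).
  move=> [x' n] /= [xx' nd] Kx' t Kt tx'.
  have h1 : `|g x - g x'| < e / 2.
    by apply: hdel => //; apply: le_ball xx'; lra.
  have h2 : `|g x - g t| < e / 2.
    apply: hdel; last by rewrite /= in_itv.
    rewrite /ball/= (_ : x - t = (x - x') - (t - x')); last by ring.
    rewrite (le_lt_trans (ler_normB _ _))// [del](_ : _ = del / 2 + del / 2); last by field.
    by rewrite ltr_leD// (le_trans tx')// ltW.
  rewrite (_ : g t - g x' = (g x - g x') - (g x - g t)); last by ring.
  rewrite (le_trans (ler_normB _ _))// [e](_ : _ = e / 2 + e / 2); last by field.
  by rewrite lerD// ltW.
apply: filterS hP => n hn s t hs; apply: hn.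
by rewrite /= in_itv.
Qed.

Lemma Rintegral_unit_piece g (a b e : R) : 0 <= a -> a <= b -> b <= 1 ->
  {within `[0, 1], continuous g} ->
  (forall t, a <= t <= b -> `|g t - g a| <= e) ->
  `|\int[lebesgue_measure]_(t in `[a, b]) g t - (b - a) * g a| <= (b - a) * e.
Proof.
move=> a0 ab b1 cg ge.
have sub : `[a, b] `<=` `[0, 1].
  by move=> t /=; rewrite !in_itv/= => /andP[? ?]; apply/andP; split;
    [exact: le_trans a0 _|exact: le_trans b1].
have cab : {within `[a, b], continuous g} by apply: continuous_subspaceW cg.
have cpt : compact `[a, b] by exact: segment_compact.
have icst k : lebesgue_measure.-integrable `[a, b] (EFin \o (fun=> k : R)).
  apply: continuous_compact_integrable => //.
  by apply: continuous_subspaceT => ?; exact: cst_continuous.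
have ig : lebesgue_measure.-integrable `[a, b] (EFin \o g).
  exact: continuous_compact_integrable.
have ecst k : \int[lebesgue_measure]_(t in `[a, b]) k = (b - a) * k.
  rewrite Rintegral_cst//= lebesgue_measure_itv/= lte_fin.
  case: ltP => [_|ba]; first by rewrite mulrC.
  by rewrite (_ : b = a) ?subrr ?mul0r ?mulr0//; apply/le_anti/andP.
rewrite -(ecst (g a)) -RintegralB//.
have igB : lebesgue_measure.-integrable `[a, b] (EFin \o (fun t => g t - g a)).
  have := integrableB _ ig (icst (g a)).
  move=> /(_ (measurable_itv _)); apply: eq_integrable => //.
rewrite (le_trans (le_normr_Rintegral _ igB))// -(ecst e).
apply: le_Rintegral => //.
- by have := integrable_abse igB; apply: eq_integrable.
Qed.

Lemma riemann_sum_le g e n : 0 < e -> {within `[0, 1], continuous g} ->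
  (forall s t, 0 <= s <= 1 -> 0 <= t <= 1 -> `|t - s| <= n.+1%:R^-1 ->
     `|g t - g s| <= e) ->
  `|\int[lebesgue_measure]_(t in `[0, 1]) g t
    - n.+1%:R^-1 * \sum_(j < n.+1) g (j%:R / n.+1%:R)| <= e.
Proof.
move=> e0 cg ge; set N := n.+1; have N0 : 0 < N%:R :> R by rewrite ltr0n.
have Nn0 : N%:R != 0 :> R by exact: lt0r_neq0.
pose I k := \int[lebesgue_measure]_(t in `[0, (k%:R / N%:R : R)]) g t.
(* Induction on the right endpoint k / N, adding one piece of length 1 / N at a time. *)
have hI k : (k <= N)%N ->
    `|I k - \sum_(j < k) N%:R^-1 * g (j%:R / N%:R)| <= k%:R * (N%:R^-1 * e).
  elim: k => [_|k ih kN].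
    rewrite /I mul0r set_itv1 Rintegral_set1 big_ord0 subr0 normr0 mul0r//.
  set a := k%:R / N%:R : R; set b := k.+1%:R / N%:R : R.
  have a0 : 0 <= a by rewrite divr_ge0.
  have ba : b - a = N%:R^-1.
    by rewrite /b /a -natr1 mulrDl mul1r addrAC subrr add0r.
  have ab : a <= b by rewrite -subr_ge0 ba invr_ge0.
  have b1 : b <= 1 by rewrite ler_pdivrMr// mul1r ler_nat.
  have ib : lebesgue_measure.-integrable `[0, b] (EFin \o g).
    apply: continuous_compact_integrable; first exact: segment_compact.
    apply: continuous_subspaceW cg => t /=; rewrite !in_itv/= => /andP[-> tb].
    exact: le_trans tb b1.
  have iab : lebesgue_measure.-integrable `]a, b] (EFin \o g).
    apply: integrableS ib => // t /=; rewrite !in_itv/= => /andP[at_ ->].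
    by rewrite (le_trans a0)// ltW.
  have -> : I k.+1 = I k + \int[lebesgue_measure]_(t in `[a, b]) g t.
    rewrite -Rintegral_itv_obnd_cbnd// /I -/a -/b.
    by rewrite -(Rintegral_itvB (x := a) ib) ?bnd_simp//; ring.
  rewrite big_ord_recr/= -/a.
  have hp : `|\int[lebesgue_measure]_(t in `[a, b]) g t - (b - a) * g a| <= (b - a) * e.
    apply: Rintegral_unit_piece => // t /andP[at_ tb].
    apply: ge.
    - by rewrite a0 (le_trans ab).
    - by rewrite (le_trans a0)//= (le_trans tb).
    - by rewrite ger0_norm ?subr_ge0// -ba lerB.
  rewrite ba in hp; set S := \sum_(j < k) _; set Q := \int[_]_(_ in _) _ in hp *.
  have -> : I k + Q - (S + N%:R^-1 * g a) = (I k - S) + (Q - N%:R^-1 * g a) by ring.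
  have -> : k.+1%:R * (N%:R^-1 * e) = k%:R * (N%:R^-1 * e) + N%:R^-1 * e.
    by rewrite -(natr1 k); ring.
  rewrite (le_trans (ler_normD _ _))// lerD//.
  exact: ih (ltnW kN).
have := hI N (leqnn _); rewrite /I divff// mulr_sumr.
by rewrite mulrA divff// mul1r.
Qed.

Lemma riemann_sum_cvg g : {within `[0, 1], continuous g} ->
  n.+1%:R^-1 * \sum_(j < n.+1) g (j%:R / n.+1%:R) @[n --> \oo]
  --> \int[lebesgue_measure]_(t in `[0, 1]) g t.
Proof.
move=> cg; apply/cvgrPdist_le => e e0.
have := uniformly_continuous_unit cg e0; apply: filterS => n.
exact: riemann_sum_le.
Qed.

End riemann_sums.

Section loop_averages.
Context {R : realType} d (T : measurableType d) (P : probability T R).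
Variables (m beta : R) (B : R -> T -> R).
Hypothesis hB : standard_brownian_motion P B.

Lemma brownian_loop_continuous x w :
  {within `[0, 1], continuous (brownian_loop m beta B x w)}.
Proof.
have cB : {within `[0, 1], continuous (fun t => B t w)}.
  apply: (continuous_subspaceW _ (@bm_continuous _ _ _ _ _ hB w)) => t /=.
  by rewrite !in_itv/= => /andP[->].
move=> t; apply: cvgD; first exact: cvg_cst.
apply: cvgM; first exact: cvg_cst.
apply: cvgB; first exact: cB.
apply: cvgM; last exact: cvg_cst.
by apply: (@continuous_subspaceT _ _ _ id) => ?; exact: cvg_id.
Qed.

Lemma mean_node_cvg f x w : continuous f ->
  mean f n.+1 (node m beta B n.+1 x w) @[n --> \oo]
  --> loop_time_average m beta B f x w.
Proof.
move=> cf; apply: (riemann_sum_cvg (g := fun t => f (brownian_loop m beta B x w t))).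
move=> t; apply: continuous_comp; first exact: brownian_loop_continuous.
exact: cf.
Qed.

(** The loop average is the pointwise limit of means over nodes, each of which is measurable in the
    pair (x, w). *)
Lemma jointly_measurable_loop_average f : continuous f ->
  jointly_measurable (fun x w => loop_time_average m beta B f x w).
Proof.
move=> cf; apply: (measurable_fun_cvg
  (h := fun n (p : R * T) => mean f n.+1 (node m beta B n.+1 p.1 p.2))).
  move=> n; apply: (jointly_measurable_nodes m beta hB n.+1 (M := n.+1) (f := mean f n.+1)).
  by apply: (rnf_mean (k := id)) => //; exact: continuous_measurable_fun.
by move=> p _; exact: mean_node_cvg.
Qed.

End loop_averages.

Lemma cvg_le_cst (R : realType) (u : R^nat) (l k : R) :
  u n @[n --> \oo] --> l -> (forall n, u n <= k) -> l <= k.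
Proof.
move=> ul uk; rewrite -(cvg_lim (@Rhausdorff R) ul); apply: limr_le.
  by apply/cvg_ex; exists l.
exact: nearW.
Qed.

Lemma cvg_ge_cst (R : realType) (u : R^nat) (l k : R) :
  u n @[n --> \oo] --> l -> (forall n, k <= u n) -> k <= l.
Proof.
move=> ul uk; rewrite -(cvg_lim (@Rhausdorff R) ul); apply: limr_ge.
  by apply/cvg_ex; exists l.
exact: nearW.
Qed.

(** * Signed integrands *)

Section dominated_bracket.
Context {R : realType} d (T : measurableType d) (P : probability T R).
Variables (D : set R) (mD : measurable D).
Variables (F W : R -> T -> R) (k : R).
Hypotheses (mF : jointly_measurable F) (mW : jointly_measurable W).
Hypotheses (W0 : forall x w, 0 <= W x w) (W1 : forall x w, W x w <= 1).
Hypotheses (k0 : 0 <= k) (FW : forall x w, `|F x w| <= k * W x w).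
Hypothesis Wfin : (bracket P D W < +oo)%E.

(** Adding the dominating term makes the integrand nonnegative, so that its inner integral is
    measurable by Tonelli; [F] is recovered by subtraction. *)
Let S x w := F x w + k * W x w.

Let mS : jointly_measurable S.
Proof. by apply: jointly_measurableD => //; exact: jointly_measurableZ. Qed.

Let S0 x w : 0 <= S x w.
Proof. by have := FW x w; rewrite ler_norml => /andP[+ _]; rewrite -subr_ge0 opprK. Qed.

Let bounded_integrable (G : R -> T -> R) l x : jointly_measurable G ->
  (forall x w, `|G x w| <= l) -> P.-integrable setT (EFin \o G x).
Proof.
move=> mG Gl; have mGx : measurable_fun setT (G x) by exact: jointly_measurable_section.
apply: (@le_integrable _ _ _ P setT measurableT _ (EFin \o (fun=> l))).
- exact/measurable_EFinP.
- by move=> w _; rewrite /= lee_fin (le_trans (Gl x w))// ler_norm.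
- exact: finite_measure_integrable_cst.
Qed.

Let Wk l x w : `|l * W x w| <= `|l|.
Proof. by rewrite normrM ler_piMr// ger0_norm. Qed.

Let Sk x w : `|S x w| <= 2 * k.
Proof.
rewrite ger0_norm// /S (_ : 2 * k = k + k); last by ring.
have kW : k * W x w <= k by rewrite ler_piMr.
by rewrite lerD// (le_trans (ler_norm _))// (le_trans (FW x w)).
Qed.

Let inner_sub x : (\int[P]_w (F x w)%:E
  = \int[P]_w (S x w)%:E - k%:E * \int[P]_w (W x w)%:E)%E.
Proof.
have iS : P.-integrable setT (EFin \o S x) by exact: (bounded_integrable x mS Sk).
have ikW : P.-integrable setT (EFin \o (fun w => k * W x w)).
  exact: (bounded_integrable (G := fun x w => k * W x w) x
    (jointly_measurableZ k mW) (Wk k)).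
rewrite -ge0_integralZl//.
- rewrite -(integralB measurableT iS ikW).
  apply: eq_integral => w _; rewrite /= -EFinB /S; congr _%:E; ring.
- by apply/measurable_EFinP; exact: jointly_measurable_section.
- by move=> w _; rewrite lee_fin.
Qed.

Let W_integrable : lebesgue_measure.-integrable D (fun x => \int[P]_w (W x w)%:E)%E.
Proof.
apply/integrableP; split; first exact: measurable_inner.
under eq_integral do rewrite gee0_abs ?inner_ge0//.
exact: Wfin.
Qed.

Let kW_integrable :
  lebesgue_measure.-integrable D (fun x => k%:E * \int[P]_w (W x w)%:E)%E.
Proof. exact: integrableZl. Qed.

Let S_integrable : lebesgue_measure.-integrable D (fun x => \int[P]_w (S x w)%:E)%E.
Proof.
have i2 : lebesgue_measure.-integrable D
  (fun x => (2 * k)%:E * \int[P]_w (W x w)%:E)%E by exact: integrableZl.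
apply: le_integrable i2 => //; first exact: measurable_inner.
move=> x Dx; rewrite !gee0_abs ?inner_ge0//; last first.
  by rewrite mule_ge0 ?inner_ge0// lee_fin mulr_ge0.
rewrite -ge0_integralZl//.
- apply: ge0_le_integral => //.
  + by move=> w _; rewrite lee_fin.
  + by apply/measurable_EFinP; exact: jointly_measurable_section.
  + apply: measurable_funeM; apply/measurable_EFinP.
    exact: jointly_measurable_section.
  + move=> w _; rewrite -EFinM lee_fin /S (_ : 2 * k * _ = k * W x w + k * W x w).
      by rewrite lerD2r (le_trans (ler_norm _)).
    by ring.
- by apply/measurable_EFinP; exact: jointly_measurable_section.
- by move=> w _; rewrite lee_fin.
- by rewrite lee_fin mulr_ge0.
Qed.

Lemma inner_integrable :
  lebesgue_measure.-integrable D (fun x => \int[P]_w (F x w)%:E)%E.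
Proof.
have : lebesgue_measure.-integrable D (fun x =>
    \int[P]_w (S x w)%:E - k%:E * \int[P]_w (W x w)%:E)%E by exact: integrableB.
by apply: eq_integrable => // x _; rewrite inner_sub.
Qed.

Lemma fine_bracketD : fine (bracket P D (fun x w => F x w + k * W x w))
  = fine (bracket P D F) + k * fine (bracket P D W).
Proof.
have -> : bracket P D F = (bracket P D S - k%:E * bracket P D W)%E.
  rewrite /bracket -ge0_integralZl//; last 2 first.
  - exact: measurable_inner.
  - by move=> x _; exact: inner_ge0.
  transitivity (\int[lebesgue_measure]_(x in D)
      (\int[P]_w (S x w)%:E - k%:E * \int[P]_w (W x w)%:E))%E.
    by apply: eq_integral => x _; exact: inner_sub.
  by rewrite integralB.
have fS : bracket P D S \is a fin_num by exact: integrable_fin_num.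
have fW : bracket P D W \is a fin_num by exact: integrable_fin_num.
rewrite -(fineK fW) -/S -(fineK fS) /= subrK//.
Qed.

End dominated_bracket.

Section signed_tuple_integral.
Context {R : realType}.

Lemma tuple_integralN n (F : n.-tuple R -> \bar R) : (forall s, 0 <= F s)%E ->
  (tuple_integral (fun s => - F s) = - tuple_integral F)%E.
Proof.
elim: n F => [//|n ih] F F0 /=.
rewrite -integral_ge0N; last by move=> x _; exact: tuple_integral_ge0.
by apply: eq_integral => x _; rewrite ih.
Qed.

(** Inside the inner integral the observable at the starting point is a constant of either sign; a
    negative one is handled through the opposite of the integral. *)
Lemma tuple_integralZl n (k : R) (F : n.-tuple R -> R) :
  measurable_fun setT F -> (forall s, 0 <= F s) ->
  (tuple_integral (fun s => (k * F s)%:E)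
   = k%:E * tuple_integral (fun s => (F s)%:E))%E.
Proof.
move=> mF F0; have mF' : measurable_fun setT (EFin \o F) by exact/measurable_EFinP.
have [k0|k0] := leP 0 k.
  exact: (ge0_tuple_integralZl (F := EFin \o F) k0).
rewrite (_ : (fun s => (k * F s)%:E) = (fun s => - ((- k)%:E * (F s)%:E))%E); last first.
  by apply/funext => s; rewrite -EFinM -EFinN mulNr opprK.
have Nk : 0 <= - k by rewrite oppr_ge0 ltW.
rewrite tuple_integralN; last by move=> s; rewrite -EFinM lee_fin mulr_ge0.
rewrite (ge0_tuple_integralZl (F := EFin \o F) Nk)//.
by rewrite EFinN mulNe oppeK.
Qed.

End signed_tuple_integral.

Section trace_limit.
Context {R : realType} d (T : measurableType d) (P : probability T R).
Variables (m beta : R) (B : R -> T -> R).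
Hypothesis hB : standard_brownian_motion P B.
Variables (D : set R) (L G K : R) (H V : R -> R).
Hypothesis hC : confinement beta D L G K H V.
Hypothesis beta0 : 0 <= beta.
Hypothesis V0 : forall x, 0 <= V x.

Local Notation nd M x w := (node m beta B M x w).
Local Notation br := (bracket P D).
Local Notation mb := (moment_bound m beta).
Local Notation boltz := (boltzmann beta V).
Local Notation lta := (loop_time_average m beta B).

Let pD : period_domain D L. Proof. by case: hC. Qed.
Let mD : measurable D. Proof. by have [] := pD. Qed.
Let cV : continuous V. Proof. by have [] := potential_tame hC. Qed.

Let node_cvg (f : R -> R) x w : continuous f ->
  mean f n.+1 (nd n.+1 x w) @[n --> \oo] --> lta f x w.
Proof. exact: (@mean_node_cvg _ _ _ P m beta B hB f x w). Qed.

Definition gibbs x w : R := expR (- (beta * lta V x w)).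

Lemma boltzmann_le1 N y : boltz N y <= 1.
Proof. by rewrite /boltzmann -expR0 ler_expR oppr_le0 mulr_ge0// mean_ge0. Qed.

(** The bounds hold for the means over nodes and survive the limit, so integrability along the path
    need not be discussed. *)
Lemma loop_average_bounds (f : R -> R) (a b : R) x w : continuous f ->
  (forall x, a <= f x) -> (forall x, f x <= b) -> a <= lta f x w <= b.
Proof.
move=> cf af fb; have h := @node_cvg _ x w cf.
apply/andP; split.
  apply: (cvg_ge_cst h) => n.
  by rewrite -(mean_cst a (nd n.+1 x w) (ltn0Sn n)); exact: ler_mean.
by apply: (cvg_le_cst h) => n; exact: mean_le_cst.
Qed.

Lemma loop_average_addr (f : R -> R) (k : R) x w : continuous f ->
  lta (fun x => f x + k) x w = lta f x w + k.
Proof.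
move=> cf; have h := @node_cvg _ x w cf.
have cfk : continuous (fun x => f x + k).
  by move=> y; apply: cvgD; [exact: cf|exact: cvg_cst].
have h1 : mean (fun x => f x + k) n.+1 (nd n.+1 x w) @[n --> \oo] --> lta f x w + k.
  under eq_fun do rewrite meanD mean_cst//.
  by apply: cvgD => //; exact: cvg_cst.
exact: (cvg_unique (@Rhausdorff R) (@node_cvg _ x w cfk) h1).
Qed.

Lemma gibbs_ge0 x w : 0 <= gibbs x w. Proof. exact: expR_ge0. Qed.

Lemma gibbs_le1 x w : gibbs x w <= 1.
Proof.
rewrite /gibbs -expR0 ler_expR oppr_le0 mulr_ge0//.
apply: (cvg_ge_cst (@node_cvg _ x w cV)) => n.
exact: mean_ge0.
Qed.

Lemma jointly_measurable_gibbs : jointly_measurable gibbs.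
Proof.
apply: (measurableT_comp (f := fun t => expR (- (beta * t)))).
  by apply: measurableT_comp => //; apply: measurableT_comp.
exact: (jointly_measurable_loop_average m beta hB cV).
Qed.

Lemma boltzmann_cvg x w :
  boltz n.+1 (nd n.+1 x w) @[n --> \oo] --> gibbs x w.
Proof.
have h := @node_cvg _ x w cV.
apply: continuous_cvg; first exact: continuous_expR.
by apply: cvgN; apply: cvgM => //; exact: cvg_cst.
Qed.

(** The domination in x for the limit of the traces: it is uniform in N, and integrable over D
    through the profile. *)
Lemma inner_boltzmann_le N x : (0 < N)%N -> D x ->
  (\int[P]_w (boltz N (nd N x w))%:E <= (5 * (1 + mb) * H x)%:E)%E.
Proof.
move=> N0 Dx; have H0 := profile_ge0 hC x.
have := mean_pow8_bound m beta hB (k := id) N0 N0 (fun j => @ltnW _ _).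
set M8 := (fun w => 1 + _) => hM.
have k0 : 0 <= 5 * H x by rewrite mulr_ge0.
have [mM M80 hM'] := integral_boundZ k0 hM.
have -> : 5 * (1 + mb) * H x = 5 * H x * (1 + mb) by ring.
apply: le_trans hM'; apply: ge0_le_integral => //.
- by move=> w _; rewrite lee_fin boltzmann_ge0.
- apply/measurable_EFinP.
  exact: (jointly_measurable_section x (jointly_measurable_boltzmann m hB hC N)).
- exact/measurable_EFinP.
- move=> w _; rewrite lee_fin (_ : 5 * H x * M8 w = H x * (5 * M8 w)).
    exact: (boltzmann_le_pow8 m B hC).
  by ring.
Qed.

Let jm_trace (f : R -> R) N : measurable_fun setT f ->
  jointly_measurable (fun x w => mean f N (nd N x w) * boltz N (nd N x w)).
Proof.
move=> mf; apply: (jointly_measurable_nodes m beta hB N (M := N)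
  (f := fun y => mean f N y * boltz N y)).
apply: rnfM; first exact: (rnf_mean (k := id)).
exact: (rnf_boltzmann hC (k := id)).
Qed.

(** Dominated convergence twice: over the paths by the constant [kf], the weight being at most 1,
    then over the starting points by a multiple of the profile [H]. *)
Lemma loop_trace_cvg (f : R -> R) (kf : R) : continuous f -> (forall x, 0 <= f x) ->
  (forall x, f x <= kf) ->
  loop_trace P m beta B D V n.+1 f @[n --> \oo]
  --> br (fun x w => lta f x w * gibbs x w).
Proof.
move=> cf f0 fk; have mf := continuous_measurable_fun cf.
have kf0 : 0 <= kf := le_trans (f0 0) (fk 0).
have mean0 N y : 0 <= mean f N y by exact: mean_ge0.
have meank n y : mean f n.+1 y <= kf by exact: mean_le_cst.
have inner_cvg x : (\int[P]_w (mean f n.+1 (nd n.+1 x w)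
      * boltz n.+1 (nd n.+1 x w))%:E)%E @[n --> \oo]
    --> (\int[P]_w (lta f x w * gibbs x w)%:E)%E.
  apply: (@dominated_cvg _ _ _ P setT measurableT
    (fun n w => (mean f n.+1 (nd n.+1 x w) * boltz n.+1 (nd n.+1 x w))%:E)
    _ (EFin \o (fun=> kf))).
  - move=> n; apply/measurable_EFinP.
    exact: (jointly_measurable_section x (jm_trace n.+1 mf)).
  - move=> w _; apply: cvg_EFin; first exact: nearW.
    apply: cvgM; last exact: boltzmann_cvg.
    exact: node_cvg.
  - by [].
  - exact: finite_measure_integrable_cst.
  - move=> n w _; rewrite lee_fin ger0_norm; last exact: mulr_ge0 (mean0 _ _) (boltzmann_ge0 _ _ _ _).
    rewrite -[kf]mulr1; apply: ler_pM; [exact: mean0|exact: boltzmann_ge0|exact: meank|].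
    exact: boltzmann_le1.
have mH := measurable_profile hC; have H0 := profile_ge0 hC.
have mb0 := moment_bound_ge0 m beta.
pose g x := kf * (5 * (1 + mb)) * H x.
have c0 : 0 <= kf * (5 * (1 + mb)) by rewrite mulr_ge0// mulr_ge0// addr_ge0.
have g0 x : 0 <= g x by exact: mulr_ge0.
apply: (@dominated_cvg _ _ _ lebesgue_measure D mD
  (fun n x => \int[P]_w (mean f n.+1 (nd n.+1 x w) * boltz n.+1 (nd n.+1 x w))%:E)%E
  _ (EFin \o g)).
- move=> n; apply: measurable_inner; first exact: jm_trace.
  by move=> x w; exact: mulr_ge0 (mean0 _ _) (boltzmann_ge0 _ _ _ _).
- by move=> x _; exact: inner_cvg.
- by [].
- apply/integrableP; split.
    by apply/measurable_EFinP; apply: measurable_funTS; exact: measurable_funM.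
  apply: (@le_lt_trans _ _ (\int[lebesgue_measure]_(x in D)
      ((kf * (5 * (1 + mb)))%:E * (H x * (1 + x ^+ 2))%:E))%E).
    apply: ge0_le_integral => //.
    + apply: measurableT_comp => //; apply/measurable_EFinP.
      by apply: measurable_funTS; exact: measurable_funM.
    + apply: measurable_funeM; apply/measurable_EFinP; apply: measurable_funTS.
      apply: measurable_funM => //; apply: measurable_funD => //.
    + move=> x _; rewrite /= -EFinM lee_fin ger0_norm// /g ler_wpM2l//.
      by rewrite ler_peMr// lerDl sqr_ge0.
  rewrite ge0_integralZl//.
  + apply: lte_mul_pinfty; [by rewrite lee_fin|by []|].
    exact: le_lt_trans (profile_integral hC) (ltry _).
  + apply/measurable_EFinP; apply: measurable_funTS.
    apply: measurable_funM => //; apply: measurable_funD => //.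
  + by move=> x _; rewrite lee_fin mulr_ge0// addr_ge0// sqr_ge0.
- move=> n x Dx; rewrite gee0_abs; last first.
    by apply: integral_ge0 => w _; rewrite lee_fin; exact: mulr_ge0 (mean0 _ _) (boltzmann_ge0 _ _ _ _).
  apply: (@le_trans _ _ (\int[P]_w (kf%:E * (boltz n.+1 (nd n.+1 x w))%:E))%E).
    apply: ge0_le_integral => //.
    + by move=> w _; rewrite lee_fin; exact: mulr_ge0 (mean0 _ _) (boltzmann_ge0 _ _ _ _).
    + apply/measurable_EFinP.
      exact: (jointly_measurable_section x (jm_trace n.+1 mf)).
    + apply: measurable_funeM; apply/measurable_EFinP.
      exact: (jointly_measurable_section x (jointly_measurable_boltzmann m hB hC n.+1)).
    + by move=> w _; rewrite -EFinM lee_fin ler_wpM2r ?boltzmann_ge0.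
  rewrite ge0_integralZl//.
  + rewrite (_ : (EFin \o g) x = kf%:E * (5 * (1 + mb) * H x)%:E)%E; last first.
      by rewrite -EFinM /g /=; congr _%:E; ring.
    apply: lee_wpmul2l; first by rewrite lee_fin.
    exact: inner_boltzmann_le.
  + apply/measurable_EFinP.
    exact: (jointly_measurable_section x (jointly_measurable_boltzmann m hB hC n.+1)).
  + by move=> w _; rewrite lee_fin boltzmann_ge0.
Qed.

End trace_limit.

(** The factor 4 / 3 is the sum of the series of the 4^-k, whose first k terms add up to 4 / 3 (1 -
    4^-k). *)
Lemma geometric_telescope (R : realType) (a : nat -> R) (q l : R) :
  0 <= q -> (forall k, `|a k - a k.+1| <= q / 4 ^+ k) ->
  a k @[k --> \oo] --> l -> `|a 0%N - l| <= 4 / 3 * q.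
Proof.
move=> q0 ha al.
have hk k : `|a 0%N - a k| <= 4 / 3 * q * (1 - (4 ^+ k)^-1).
  elim: k => [|k ih]; first by rewrite subrr normr0 expr0 invr1 subrr mulr0.
  have -> : a 0%N - a k.+1 = (a 0%N - a k) + (a k - a k.+1) by ring.
  rewrite (le_trans (ler_normD _ _))// (le_trans (lerD ih (ha k)))//.
  rewrite exprS invfM; move: (4 ^+ k)^-1 => u.
  by rewrite le_eqVlt; apply/orP; left; apply/eqP; field.
have hk' k : `|a 0%N - a k| <= 4 / 3 * q.
  rewrite (le_trans (hk k))//; apply: ler_piMr.
    by apply: mulr_ge0 => //; exact: divr_ge0.
  by rewrite gerBl invr_ge0 exprn_ge0.
apply: (@cvg_le_cst R (fun k => `|a 0%N - a k|)) => //.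
by apply: cvg_norm; apply: cvgB => //; exact: cvg_cst.
Qed.

(* The multiple [k] of the denominator is added to make the numerators nonnegative. *)
Lemma ratio_error (R : realType) (c a z a' z' k z0 e1 e2 : R) :
  0 < c -> 0 < z0 -> z0 <= z -> z0 <= z' -> 0 <= k -> 0 <= a' + k * z' <= 2 * k * z' ->
  `|(a + k * z) - (a' + k * z')| <= e1 -> `|z - z'| <= e2 ->
  `|c * a / (c * z) - c * a' / (c * z')| <= (e1 + 2 * k * e2) / z0.
Proof.
move=> c0 z00 zz zz' k0 /andP[x0 x1] h1 h2.
rewrite -!mulf_div divff ?lt0r_neq0// !mul1r.
have zp : 0 < z := lt_le_trans z00 zz.
have zp' : 0 < z' := lt_le_trans z00 zz'.
set x' := a' + k * z' in x0 x1 h1; set x := a + k * z in h1.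
(* Written so that only z stays in the denominator, next to the ratio x' / z', which lies between 0
   and 2 k. *)
have -> : a / z - a' / z' = ((x - x') + x' / z' * (z' - z)) / z.
  by rewrite /x /x'; field; rewrite !lt0r_neq0.
rewrite normrM normfV (gtr0_norm zp).
have hr : 0 <= x' / z' <= 2 * k.
  by rewrite divr_ge0 ?(ltW zp')//= ler_pdivrMr.
have hn : `|(x - x') + x' / z' * (z' - z)| <= e1 + 2 * k * e2.
  rewrite (le_trans (ler_normD _ _))// lerD// normrM distrC.
  move/andP: hr => [r0 r1].
  by rewrite (ger0_norm r0) ler_pM.
rewrite ler_pM ?invr_ge0 ?(ltW zp)//.
by rewrite lef_pV2 ?posrE.
Qed.

(** * The error of the averages *)

Section average_error.
Context {R : realType} d (T : measurableType d) (P : probability T R).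
Variables (m beta : R) (B : R -> T -> R).
Hypothesis hB : standard_brownian_motion P B.
Variables (D : set R) (L G K : R) (H V : R -> R).
Hypothesis hC : confinement beta D L G K H V.
Hypothesis m0 : 0 < m.
Hypothesis beta0 : 0 < beta.
Hypothesis V0 : forall x, 0 <= V x.

Local Notation nd M x w := (node m beta B M x w).
Local Notation br := (bracket P D).
Local Notation mb := (moment_bound m beta).
Local Notation boltz := (boltzmann beta V).
Local Notation lta := (loop_time_average m beta B).
Local Notation gib := (gibbs m beta B V).
Local Notation lt := (loop_trace P m beta B D V).
Local Notation csq := (Num.sqrt (m / (2 * pi * beta))).

Let pD : period_domain D L. Proof. by case: hC. Qed.
Let mD : measurable D. Proof. by have [] := pD. Qed.
Let K0 : 0 <= K. Proof. by case: hC. Qed.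
Let beta0' : 0 <= beta := ltW beta0.

Let csq0 : 0 < csq.
Proof. by rewrite sqrtr_gt0 divr_gt0// mulr_gt0// mulr_gt0// pi_gt0. Qed.

Let jm_boltz n : jointly_measurable (fun x w => boltz n (nd n x w)).
Proof. exact: (jointly_measurable_boltzmann m hB hC). Qed.

Lemma bracket_boltzmann n :
  br (fun x w => boltz n.+1 (nd n.+1 x w)) = lt n.+1 (fun=> 1).
Proof.
congr bracket; apply/funext => x; apply/funext => w.
by rewrite mean_cst// mul1r.
Qed.

Let lt1_lty n : (lt n.+1 (fun=> 1%R) < +oo)%E.
Proof.
have fk (x : R) : (1 : R) <= 1 by [].
have f0 (x : R) : 0 <= (1 : R) by [].
have := @loop_trace_le _ _ _ P m beta B hB D L G K H V hC (fun=> 1) 1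
  (measurable_cst _) f0 fk n.+1 (ltn0Sn n).
by move=> h; apply: le_lt_trans h (ltry _).
Qed.

Lemma thermal_bracket_le (g : R -> R) (kg : R) : continuous g ->
  (forall x, 0 <= g x) -> (forall x, g x <= kg) ->
  (br (fun x w => (lta g x w * gib x w)%R) <= (kg * (5 * (G * (1 + mb))))%:E)%E.
Proof.
move=> cg g0 gk; have h := loop_trace_cvg (m := m) hB hC beta0' V0 cg g0 gk.
rewrite -(cvg_lim (@ereal_hausdorff R) h); apply: lime_le.
  by apply/cvg_ex; eexists; exact: h.
apply: nearW => n; apply: (loop_trace_le m hB hC) => //.
exact: continuous_measurable_fun.
Qed.

Lemma thermal_bracket_fin (g : R -> R) (kg : R) : continuous g ->
  (forall x, 0 <= g x) -> (forall x, g x <= kg) ->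
  br (fun x w => lta g x w * gib x w) \is a fin_num.
Proof.
move=> cg g0 gk; rewrite ge0_fin_numE; last first.
  apply: bracket_ge0 => x w; apply: mulr_ge0; last exact: gibbs_ge0.
  by have /andP[] := loop_average_bounds m beta hB x w cg g0 gk.
exact: le_lt_trans (thermal_bracket_le cg g0 gk) (ltry _).
Qed.

Lemma loop_trace_fine_cvg (g : R -> R) (kg : R) : tame K g ->
  (forall x, 0 <= g x) -> (forall x, g x <= kg) ->
  fine (lt n.+1 g) @[n --> \oo] --> fine (br (fun x w => lta g x w * gib x w)).
Proof.
move=> [cg _ _] g0 gk; apply: fine_cvg.
rewrite (fineK (thermal_bracket_fin cg g0 gk)).
exact: (loop_trace_cvg (m := m) hB hC beta0' V0 cg g0 gk).
Qed.

Lemma bracket_gibbs : br (fun x w => lta (fun=> 1) x w * gib x w) = br gib.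
Proof.
congr bracket; apply/funext => x; apply/funext => w.
have c1 : continuous (fun _ : R => 1 : R) by move=> y; exact: cvg_cst.
have := loop_average_bounds m beta hB x w c1 (fun=> lexx 1) (fun=> lexx 1).
by move=> /le_anti <-; rewrite mul1r.
Qed.

Let gibbs_lty : (br gib < +oo)%E.
Proof.
have c1 : continuous (fun _ : R => 1 : R) by move=> y; exact: cvg_cst.
rewrite -bracket_gibbs.
have h := thermal_bracket_le c1 (fun=> ler01) (fun=> lexx 1).
exact: le_lt_trans h (ltry _).
Qed.

Section observable.
Variables (f : R -> R) (kf : R).
Hypothesis tf : tame K f.
Hypothesis pf : forall x, f (x + L) = f x.
Hypothesis fk : forall x, `|f x| <= kf.

Let mf : measurable_fun setT f := tame_measurable tf.
Let cf : continuous f. Proof. by have [] := tf. Qed.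
Let kf0 : 0 <= kf. Proof. exact: le_trans (normr_ge0 (f 0)) (fk 0). Qed.

Let jm_fboltz n : jointly_measurable (fun x w => f x * boltz n (nd n x w)).
Proof. by apply: measurable_funM; [exact: (measurableT_comp mf)|exact: jm_boltz]. Qed.

Let fboltz_le n x w : `|f x * boltz n.+1 (nd n.+1 x w)| <= kf * boltz n.+1 (nd n.+1 x w).
Proof.
by rewrite normrM (ger0_norm (boltzmann_ge0 _ _ _ _)) ler_wpM2r// boltzmann_ge0.
Qed.

Lemma trotter_trace_bracket n : trotter_trace m beta D n.+1 V f
  = csq * fine (br (fun x w => f x * boltz n.+1 (nd n.+1 x w))).
Proof.
set N := n.+1; rewrite /trotter_trace -/N.
set C := (_ `^ _); set F := (fun x w => f x * boltz N (nd N x w)).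
have C0 : 0 < C.
  by rewrite powR_gt0// divr_gt0 ?mulr_gt0 ?pi_gt0 ?ltr0n.
pose e (x : R) (xs : n.-tuple R) := expR (- loop_action m beta N V (loop_node x xs)).
have inner_finite x : P.-integrable setT (EFin \o (fun w => boltz N (nd N x w))).
  apply: (@le_integrable _ _ _ P setT measurableT _ (EFin \o (fun=> 1))).
  - by apply/measurable_EFinP; exact: (jointly_measurable_section x (jm_boltz N)).
  - move=> w _; rewrite /= lee_fin normr1 ger0_norm ?boltzmann_ge0//.
    exact: (boltzmann_le1 beta0' V0).
  - exact: finite_measure_integrable_cst.
(* [trotter_inner] identifies the inner integral without the observable; the factor [f x] is pulled
   out on both sides. *)
have inner x : tuple_integral (fun xs : n.-tuple R => (f x * e x xs)%:E)
    = ((csq / C)%:E * \int[P]_w (F x w)%:E)%E.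
  rewrite (tuple_integralZl (f x) (F := e x)).
  - rewrite (_ : (\int[P]_w (F x w)%:E = (f x)%:E * \int[P]_w (boltz N (nd N x w))%:E)%E).
      have := trotter_inner hB n x m0 beta0 (tame_measurable (potential_tame hC)).
      rewrite -/N -/C => h.
      have -> : tuple_integral (fun xs : n.-tuple R => (e x xs)%:E)
          = (C^-1%:E * (csq%:E * \int[P]_w (boltz N (nd N x w))%:E))%E.
        rewrite (_ : (\int[P]_w (boltz N (nd N x w))%:E
            = \int[P]_w (expR (- (beta / N%:R * \sum_(j < N) V (nd N x w j))))%:E)%E).
          by rewrite -h muleA -EFinM mulVf ?mul1e// lt0r_neq0.
        by apply: eq_integral => w _; rewrite /boltzmann /mean mulrA.
      by rewrite !muleA -!EFinM; congr (_ * _)%E; congr _%:E; ring.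
    rewrite -(integralZl measurableT (inner_finite x)).
    by apply: eq_integral => w _; rewrite /F EFinM.
  - apply: measurable_trotter_weight; exact: (tame_measurable (potential_tame hC)).
  - by move=> xs; exact: expR_ge0.
have FN := jm_fboltz N.
have iF : lebesgue_measure.-integrable D (fun x => \int[P]_w (F x w)%:E)%E.
  have Wfin : (br (fun x w => boltz N (nd N x w)) < +oo)%E.
    by rewrite bracket_boltzmann.
  exact: (inner_integrable mD FN (jm_boltz N)
    (fun x w => boltzmann_ge0 beta V N (nd N x w))
    (fun x w => boltzmann_le1 beta0' V0 N (nd N x w)) kf0 (fboltz_le n) Wfin).
under eq_integral do rewrite inner.
have -> : (\int[lebesgue_measure]_(x in D) ((csq / C)%:E * \int[P]_w (F x w)%:E)
    = (csq / C)%:E * br F)%E by exact: integralZl.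
have fF : br F \is a fin_num by exact: integrable_fin_num.
rewrite -(fineK fF) -EFinM /= mulrA [C * _]mulrC divfK//.
exact: lt0r_neq0.
Qed.

Let fkf_ge0 x : 0 <= f x + kf.
Proof. by have := fk x; rewrite ler_norml => /andP[+ _]; rewrite -subr_ge0 opprK. Qed.

(** [loop_trace_start] is available for nonnegative observables; adding [kf] times the partition
    function brings a signed [f] within its reach. *)
Lemma trotter_trace_shift n :
  fine (br (fun x w => f x * boltz n.+1 (nd n.+1 x w))) + kf * fine (lt n.+1 (fun=> 1))
  = fine (lt n.+1 (fun x => f x + kf)).
Proof.
rewrite -(loop_trace_start m hB hC (f := fun x => f x + kf))//.
- rewrite (_ : (fun x w => (f x + kf) * boltz n.+1 (nd n.+1 x w)) = (fun x w =>
      f x * boltz n.+1 (nd n.+1 x w) + kf * boltz n.+1 (nd n.+1 x w))); last first.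
    by apply/funext => x; apply/funext => w; rewrite mulrDl.
  have Wfin : (br (fun x w => boltz n.+1 (nd n.+1 x w)) < +oo)%E.
    by rewrite bracket_boltzmann.
  have -> := fine_bracketD mD (jm_fboltz n.+1) (jm_boltz n.+1)
    (fun x w => boltzmann_ge0 beta V n.+1 (nd n.+1 x w))
    (fun x w => boltzmann_le1 beta0' V0 n.+1 (nd n.+1 x w)) kf0 (fboltz_le n) Wfin.
  by rewrite bracket_boltzmann.
- exact: measurable_funD.
- by move=> x; rewrite pf.
Qed.

Lemma thermal_trace_bracket : thermal_trace P B m beta D V f
  = csq * fine (br (fun x w => lta f x w * gib x w)).
Proof.
rewrite /thermal_trace; congr (_ * fine _).
by apply: eq_integral => x _; rewrite unlock.
Qed.

Lemma thermal_trace_shift :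
  fine (br (fun x w => lta f x w * gib x w)) + kf * fine (br gib)
  = fine (br (fun x w => lta (fun x => f x + kf) x w * gib x w)).
Proof.
have mg := jointly_measurable_gibbs m hB hC.
have mF : jointly_measurable (fun x w => lta f x w * gib x w).
  apply: measurable_funM; last exact: mg.
  exact: (jointly_measurable_loop_average m beta hB cf).
have FW x w : `|lta f x w * gib x w| <= kf * gib x w.
  rewrite normrM (ger0_norm (gibbs_ge0 _ _ _ _ _ _)) ler_wpM2r ?gibbs_ge0//.
  rewrite ler_norml; apply: (loop_average_bounds m beta hB _ _ cf).
    by move=> y; have := fk y; rewrite ler_norml => /andP[].
  by move=> y; have := fk y; rewrite ler_norml => /andP[].
rewrite -(fine_bracketD mD mF mg (gibbs_ge0 m beta B V)
  (gibbs_le1 m hB hC beta0' V0) kf0 FW (gibbs_lty)).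
congr (fine _); congr bracket; apply/funext => x; apply/funext => w.
by rewrite (loop_average_addr m beta hB)// mulrDl.
Qed.

End observable.

Section nonnegative_observable.
Variables (g : R -> R) (kg : R).
Hypothesis tg : tame K g.
Hypothesis pg : forall x, g (x + L) = g x.
Hypothesis g0 : forall x, 0 <= g x.
Hypothesis gk : forall x, g x <= kg.

Lemma loop_trace_error N : (0 < N)%N ->
  `|fine (lt N g) - fine (br (fun x w => lta g x w * gib x w))|
  <= 4 / 3 * (doubling_const m beta G K kg / N%:R ^+ 2).
Proof.
move=> N0; have N0' : N%:R != 0 :> R by rewrite pnatr_eq0 -lt0n.
have p0 k : (0 < N * 2 ^ k)%N by rewrite muln_gt0 N0 expn_gt0.
have hd k (k0 : (0 < k)%N) :=
  loop_trace_double m hB hC (tame_measurable tg) g0 gk pg tg k0.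
have q0 : 0 <= doubling_const m beta G K kg / N%:R ^+ 2.
  exact: le_trans (normr_ge0 _) (hd N N0).
have := @geometric_telescope R (fun k => fine (lt (N * 2 ^ k) g)) _
  (fine (br (fun x w => lta g x w * gib x w))) q0.
rewrite expn0 muln1; apply.
- move=> k; have := hd _ (p0 k).
  rewrite expnS mulnCA mul2n => /le_trans; apply.
  rewrite natrM natrX exprMn -exprM mulnC exprM -[2 ^+ 2]natrX invfM mulrA.
  by [].
(* The limit is known along [n.+1], so the subsequence N 2^k is reached at the indices N 2^k - 1. *)
- have hk : (fun k => (N * 2 ^ k).-1) @ \oo --> \oo.
    move=> A [n0 _ hA]; exists n0 => // k /= n0k; apply: hA => /=.
    rewrite -ltnS (prednK (p0 k)) (leq_ltn_trans n0k)//.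
    by rewrite (leq_trans (ltn_expl k (ltnSn 1)))// leq_pmull.
  rewrite (_ : (fun k => fine (lt (N * 2 ^ k) g))
    = (fun n => fine (lt n.+1 g)) \o (fun k => (N * 2 ^ k).-1)); last first.
    by apply/funext => k /=; rewrite (prednK (p0 k)).
  apply: (cvg_comp _ _ hk); exact: (loop_trace_fine_cvg tg g0 gk).
Qed.

End nonnegative_observable.

Section lower_bound.
Variables (K1 l : R).
Hypothesis K10 : 0 <= K1.
Hypothesis VK : forall y, V y <= K1 * (1 + y ^+ 2).
Hypothesis l0 : 0 < l.
Hypothesis l1 : l <= 1.
Hypothesis lD : `[0, l] `<=` D.

(** For x in [0, 1], 1 + (x + c)^2 <= 3 + 2 c^2 <= 5 + 2 c^8. Averaging over the nodes, taking the
    expectation and multiplying by beta K1 gives this bound on the mean action. *)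
Definition mean_action_bound : R := beta * (K1 * (5 + 2 * mb)).

Let potential_le x c : 0 <= x <= 1 -> V (x + c) <= K1 * (5 + 2 * c ^+ 8).
Proof.
move=> /andP[x0 x1]; apply: le_trans (VK _) _; apply: ler_wpM2l => //.
have h := sqrD_le x c.
have x2 : x ^+ 2 <= 1 by rewrite expr_le1.
have c8 : c ^+ 2 <= 1 + c ^+ 8.
  have -> : c ^+ 8 = (c ^+ 2) ^+ 4 by rewrite -exprM.
  move: (c ^+ 2) => t; have -> : t ^+ 4 = (t ^+ 2) ^+ 2 by rewrite -exprM.
  by have := sqr_ge0 (t ^+ 2 - 2^-1); have := sqr_ge0 (t - 2^-1); lra.
lra.
Qed.

(* Jensen's inequality, from the tangent of the exponential at the mean action. *)
Lemma inner_boltzmann_ge n x : 0 <= x <= 1 ->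
  ((expR (- mean_action_bound))%:E <= \int[P]_w (boltz n.+1 (nd n.+1 x w))%:E)%E.
Proof.
move=> x01; set N := n.+1; set a := mean_action_bound.
have := mean_pow8_bound m beta hB (k := id) (ltn0Sn n) (ltn0Sn n) (fun j => @ltnW _ _).
rewrite -/N; set M8 := (fun w => 1 + _) => hM.
have c30 : 0 <= 3 :> R by [].
have bK0 : 0 <= beta * K1 by exact: mulr_ge0.
have := integral_boundZ bK0
  (integral_boundD (integral_bound_cst P c30) (integral_boundZ (ler0n R 2) hM)).
set u := (fun t => _) => hu.
have e0 : 0 <= expR (- a) by exact: expR_ge0.
have [mu u0 iu] := integral_boundZ e0 hu.
have su w : beta * mean V N (nd N x w) <= u w.
  rewrite /u -[beta * K1 * _]mulrA; apply: ler_wpM2l => //.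
  have -> : K1 * (3 + 2 * M8 w) = mean (fun c => K1 * (5 + 2 * c ^+ 8)) N
      (fun j => node m beta B N 0 w j).
    by rewrite meanZ meanD mean_cst// meanZ /M8; congr (_ * _); ring.
  rewrite /mean ler_wpM2l ?invr_ge0//; apply: ler_sum => j _.
  by rewrite nodeD potential_le.
(* The tangent inequality at the mean action bound [a], with the linear term moved to the right so
   that every integrand is nonnegative. *)
have ptw w : expR (- a) * (1 + a) <= boltz N (nd N x w) + expR (- a) * u w.
  rewrite /boltzmann; move: (beta * _) (su w) => s sw.
  have -> : expR (- s) = expR (- a) * expR (a - s) by rewrite -expRD addKr.
  rewrite -mulrDr ler_wpM2l//.
  by have := expR_ge1Dx (a - s); lra.
have mb' : measurable_fun setT (fun w => (boltz N (nd N x w))%:E).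
  by apply/measurable_EFinP; exact: (jointly_measurable_section x (jm_boltz N)).
have h : ((expR (- a) * (1 + a))%:E
    <= \int[P]_w (boltz N (nd N x w))%:E + (expR (- a) * a)%:E)%E.
  apply: (@le_trans _ _ (\int[P]_w ((boltz N (nd N x w))%:E + (expR (- a) * u w)%:E))%E).
    rewrite -[leLHS]mule1 -(@probability_setT _ _ _ P) -integral_cst//.
    apply: ge0_le_integral => //.
    - move=> w _; rewrite lee_fin mulr_ge0// addr_ge0// /a /mean_action_bound.
      by rewrite mulr_ge0// mulr_ge0// addr_ge0// mulr_ge0// moment_bound_ge0.
    - by apply: emeasurable_funD => //; exact/measurable_EFinP.
    - by move=> w _; rewrite -EFinD lee_fin.
  rewrite ge0_integralD//.
  - apply: leeD => //; apply: le_trans iu _; rewrite lee_fin ler_wpM2l//.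
    by rewrite /a /mean_action_bound; lra.
  - by move=> w _; rewrite lee_fin boltzmann_ge0.
  - by move=> w _; rewrite lee_fin.
  - exact/measurable_EFinP.
have -> : (expR (- a))%:E = ((expR (- a) * (1 + a))%:E - (expR (- a) * a)%:E)%E.
  by rewrite -EFinB; congr _%:E; ring.
by rewrite leeBlDr.
Qed.

(** Only starting points in [0, l] are kept. They lie in D and in [0, 1], where the lower bound of
    [inner_boltzmann_ge] is uniform. *)
Lemma partition_function_ge n :
  l * expR (- mean_action_bound) <= fine (lt n.+1 (fun=> 1)).
Proof.
rewrite -bracket_boltzmann -lee_fin fineK; last first.
  rewrite bracket_boltzmann ge0_fin_numE ?lt1_lty//.
  by apply: loop_trace_ge0 => ?.
apply: (@le_trans _ _ (\int[lebesgue_measure]_(x in `[0%R, l])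
    \int[P]_w (boltz n.+1 (nd n.+1 x w))%:E)%E); last first.
  apply: ge0_subset_integral => //.
  - by apply: measurable_inner => //; move=> x w; exact: boltzmann_ge0.
  - by move=> x _; apply: integral_ge0 => w _; rewrite lee_fin boltzmann_ge0.
apply: (@le_trans _ _ (\int[lebesgue_measure]_(x in `[0%R, l])
    (expR (- mean_action_bound))%:E)%E).
  rewrite integral_cst//= lebesgue_measure_itv/= lte_fin l0 oppr0 adde0.
  by rewrite -EFinM mulrC.
apply: ge0_le_integral => //.
- by apply: measurable_inner => // x w; exact: boltzmann_ge0.
- move=> x /=; rewrite in_itv/= => /andP[x0 xl]; apply: inner_boltzmann_ge.
  by rewrite x0 (le_trans xl l1).
Qed.

Variables (f : R -> R) (kf : R).
Hypothesis tf : tame K f.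
Hypothesis pf : forall x, f (x + L) = f x.
Hypothesis fk : forall x, `|f x| <= kf.

(** The shifted observable f + kf takes values in [0, 2 kf], and the observable 1 is bounded by 1.
    Each trace has an error of 4 / 3 of its doubling constant over N^2, and [ratio_error] with k =
    kf combines the two. *)
Definition error_const : R :=
  (4 / 3 * doubling_const m beta G K (2 * kf)
   + 2 * kf * (4 / 3 * doubling_const m beta G K 1))
  / (l * expR (- mean_action_bound)).

Theorem average_error N : (1 <= N)%N ->
  `|trotter_average m beta D N V f - thermal_average P B m beta D V f|
  <= error_const / N%:R ^+ 2.
Proof.
case: N => // n _; rewrite /trotter_average /thermal_average.
have t1 : tame K (fun=> 1 : R) by exact: tame_cst.
have p1 (x : R) : (fun=> 1 : R) (x + L) = 1 by [].
have k1 (x : R) : `|(fun=> 1 : R) x| <= 1 by rewrite normr1.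
have kf0 : 0 <= kf by exact: le_trans (normr_ge0 (f 0)) (fk 0).
have cf : continuous f by have [] := tf.
have tg : tame K (fun x => f x + kf) by exact: tameD_cst.
have pg x : f (x + L) + kf = f x + kf by rewrite pf.
have g0 x : 0 <= f x + kf.
  by have := fk x; rewrite ler_norml => /andP[+ _]; rewrite -subr_ge0 opprK.
have gk x : f x + kf <= 2 * kf.
  by rewrite mulr2n mulrDl mul1r lerD2r (le_trans (ler_norm _)).
rewrite (trotter_trace_bracket tf fk) (trotter_trace_bracket t1 k1).
rewrite (thermal_trace_bracket f) (thermal_trace_bracket (fun=> 1)).
rewrite (_ : br (fun x w => 1 * boltz n.+1 (nd n.+1 x w)) = lt n.+1 (fun=> 1)); last first.
  by rewrite -bracket_boltzmann; congr bracket; apply/funext => x; apply/funext => w; rewrite mul1r.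
rewrite bracket_gibbs.
have z00 : 0 < l * expR (- mean_action_bound) by rewrite mulr_gt0// expR_gt0.
have hZ := partition_function_ge.
have cZ := loop_trace_fine_cvg t1 (fun=> ler01) (fun=> lexx 1).
rewrite bracket_gibbs in cZ.
have hZ' : l * expR (- mean_action_bound) <= fine (br gib) by exact: (cvg_ge_cst cZ).
have e1 := loop_trace_error tg pg g0 gk (ltn0Sn n).
have e2 := loop_trace_error t1 p1 (fun=> ler01) (fun=> lexx 1) (ltn0Sn n).
rewrite bracket_gibbs in e2.
have e1' : `|(fine (br (fun x w => f x * boltz n.+1 (nd n.+1 x w)))
      + kf * fine (lt n.+1 (fun=> 1)))
    - (fine (br (fun x w => lta f x w * gib x w)) + kf * fine (br gib))|
    <= 4 / 3 * (doubling_const m beta G K (2 * kf) / n.+1%:R ^+ 2).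
  apply: le_trans e1; rewrite le_eqVlt; apply/orP; left; apply/eqP.
  congr (`|_ - _|); first exact: (trotter_trace_shift tf pf fk n).
  exact: (thermal_trace_shift tf fk).
have fg : br gib \is a fin_num.
  rewrite ge0_fin_numE ?gibbs_lty//.
  by apply: bracket_ge0 => x w; exact: gibbs_ge0.
have hX : 0 <= fine (br (fun x w => lta f x w * gib x w)) + kf * fine (br gib)
    <= 2 * kf * fine (br gib).
  rewrite (thermal_trace_shift tf fk).
  have cg : continuous (fun x => f x + kf) by have [] := tg.
  have lb x w := loop_average_bounds m beta hB x w cg g0 gk.
  have X0 x w : 0 <= lta (fun x => f x + kf) x w * gib x w.
    by apply: mulr_ge0; [have /andP[] := lb x w|exact: gibbs_ge0].
  rewrite fine_ge0 ?bracket_ge0//= -lee_fin.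
  rewrite (fineK (thermal_bracket_fin cg g0 gk)) EFinM (fineK fg).
  have mg := jointly_measurable_gibbs m hB hC.
  rewrite -(bracketZ P mD _ mg (gibbs_ge0 m beta B V)) ?mulr_ge0//.
  apply: (le_bracket P mD _ _ X0).
  - apply: measurable_funM; last exact: mg.
    exact: (jointly_measurable_loop_average m beta hB cg).
  - exact: jointly_measurableZ.
  - by move=> x w; rewrite mulr_ge0 ?gibbs_ge0// mulr_ge0.
  - by move=> x w _; apply: ler_wpM2r; [exact: gibbs_ge0|have /andP[] := lb x w].
have := ratio_error csq0 z00 (hZ n) hZ' kf0 hX e1' e2.
move=> /le_trans; apply; rewrite /error_const le_eqVlt; apply/orP; left; apply/eqP.
by move: (doubling_const _ _ _ _ _) (doubling_const _ _ _ _ 1) (n.+1%:R ^+ 2)^-1 (l * _)^-1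
  => c1 c2 c3 c4; ring.
Qed.

End lower_bound.

End average_error.

(** * Periodic and confining potentials *)

Section periodic_functions.
Context {R : realType}.
Implicit Types (f : R -> R) (L : R).

Lemma derive1_periodic f L : (forall x, f (x + L) = f x) ->
  forall x, derive1 f (x + L) = derive1 f x.
Proof.
move=> pf x; rewrite /derive1 /=.
rewrite (_ : (fun h => h^-1 *: (f (h + (x + L)) - f (x + L)))
  = (fun h => h^-1 *: (f (h + x) - f x)))//.
by apply/funext => h; rewrite addrA !pf.
Qed.

Lemma periodic_le f L k : 0 < L -> (forall x, f (x + L) = f x) ->
  (forall x, 0 <= x <= L -> `|f x| <= k) -> forall x, `|f x| <= k.
Proof.
move=> L0 pf fk x; set q := Num.floor (x / L).
rewrite -(periodic_intz (- q) pf); apply: fk.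
have /andP[h1 h2] := floor_itv (x / L); rewrite -/q in h1 h2.
rewrite ler_pdivlMr// in h1; rewrite ltr_pdivrMr// intrD mulrDl mul1r in h2.
by rewrite intrN mulNr subr_ge0 h1/= lerBlDl ltW.
Qed.

End periodic_functions.

Section periodic_case.
Context {R : realType} (beta L K : R) (V : R -> R).
Hypotheses (beta0 : 0 < beta) (L0 : 0 < L) (K0 : 0 < K).

Lemma periodic_bound_tame f : C2 f -> (forall x, f (x + L) = f x) ->
  (forall x, 0 <= x <= L -> `|f x| + `|f^`() x| + `|f^`(2) x| <= K) ->
  tame K f /\ forall x, `|f x| <= K.
Proof.
move=> c2 pf fK.
have p1 := derive1_periodic pf; have p2 := derive1_periodic p1.
have h (u v w k : R) : `|u| + `|v| + `|w| <= k -> [/\ `|u| <= k, `|v| <= k & `|w| <= k].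
  by have := normr_ge0 u; have := normr_ge0 v; have := normr_ge0 w; split; lra.
have f0 : forall x, `|f x| <= K.
  by apply: (periodic_le L0 pf) => x /fK /h[].
split=> //; apply: tame_C2 => //; first exact: ltW.
  move=> x; apply: (@le_trans _ _ K); last by rewrite -[leLHS]mulr1 ler_wpM2l ?(ltW K0)// lerDl.
  by apply: (periodic_le L0 p1) => y /fK /h[].
by apply: (periodic_le L0 p2) => y /fK /h[].
Qed.

(** V >= 0 bounds the weight by 1, so a constant profile works; 1 + x^2 <= 1 + L^2 on [0, L] gives
    the integral bound. *)
Lemma periodic_confinement : tame K V -> (forall x, V (x + L) = V x) ->
  (forall x, 0 <= V x) ->
  confinement beta `[0, L] L ((1 + L ^+ 2) * L) K (fun=> 1) V.
Proof.
move=> tV pV V0; split=> //.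
- exact: period_domain_itv.
- apply: (@le_trans _ _ (\int[lebesgue_measure]_(x in `[0%R, L]) (1 + L ^+ 2)%:E)%E).
    apply: ge0_le_integral => //.
    + by move=> x _; rewrite lee_fin mul1r addr_ge0// sqr_ge0.
    + apply/measurable_EFinP; apply: measurable_funTS; apply: measurable_funM => //.
      by apply: measurable_funD => //.
    + move=> x /=; rewrite in_itv/= => /andP[x0 xL].
      by rewrite lee_fin mul1r lerD2l ler_sqr ?nnegrE// ltW.
  rewrite integral_cst//= lebesgue_measure_itv/= lte_fin L0 oppr0 adde0.
  by rewrite -EFinM.
- exact: ltW.
- move=> x b _; rewrite mul1r; apply: (@le_trans _ _ 1).
    by rewrite -expR0 ler_expR oppr_le0 mulr_ge0// ltW.
  by rewrite expr_ge1// ?lerDl ?sqr_ge0// addr_ge0// sqr_ge0.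
Qed.

End periodic_case.

Section confining_case.
Context {R : realType}.
Implicit Type V : R -> R.

Lemma integral_oneDsqrV :
  (\int[lebesgue_measure]_(x in [set: R]) ((1 + x ^+ 2)^-1)%:E = pi%:E)%E.
Proof.
have h := @ge0_symfun_integralT R (fun x => (1 + x ^+ 2)^-1).
rewrite h.
- have := integral0y_oneDsqr R; rewrite /oneDsqr set_itvcy => ->.
  by rewrite -EFinM; congr _%:E; field.
- by move=> x; rewrite invr_ge0 addr_ge0// sqr_ge0.
- exact: continuous_oneDsqrV.
- by move=> x /=; rewrite sqrrN.
Qed.

(** Half of the exponent already gives exp(c y^2 / 2) >= 1 + c y^2 / 2 >= s (1 + y^2), by the two
    upper bounds on s; squaring yields the decay. *)
Lemma gaussian_le_rational (s c y : R) : 0 < s -> s <= 1 -> 2 * s <= c ->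
  expR (- (c * y ^+ 2)) <= (s * (1 + y ^+ 2)) ^- 2.
Proof.
move=> s0 s1 sc; rewrite expRN.
have y0 := sqr_ge0 y.
have p0 : 0 < s * (1 + y ^+ 2) by rewrite mulr_gt0// ltr_pwDl.
rewrite lef_pV2 ?posrE ?expR_gt0 ?exprn_gt0//.
have -> : expR (c * y ^+ 2) = expR (c * y ^+ 2 / 2) ^+ 2.
  by rewrite -expRM_natl; congr expR; field.
rewrite ler_sqr ?nnegrE ?expR_ge0 ?(ltW p0)//.
apply: le_trans (expR_ge1Dx _).
have := mulr_ge0 (_ : 0 <= c - 2 * s) y0; rewrite subr_ge0 => /(_ sc); lra.
Qed.

(** The Gaussian decay in y = x + b is weakened to a rational one, because a power of 1 + y^2 can be
    transferred to x at the price of a power of 1 + b^2. The decay (1 + x^2)^-2 is kept because,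
    multiplied by 1 + x^2, it integrates to pi. *)
Lemma confining_confinement (beta a s K : R) V : 0 < beta -> 0 < s -> s <= 1 ->
  2 * s <= beta * (a / 2) -> 0 <= K -> tame K V ->
  (forall x, a / 2 * x ^+ 2 <= V x) ->
  confinement beta [set: R] 0 (4 / s ^+ 2 * pi) K
    (fun x => 4 / s ^+ 2 * (1 + x ^+ 2) ^- 2) V.
Proof.
move=> beta0 s0 s1 sa K0 tV aV.
have k0 : 0 <= 4 / s ^+ 2 by rewrite divr_ge0// sqr_ge0.
have d0 (x : R) : 0 < 1 + x ^+ 2 by rewrite ltr_pwDl// sqr_ge0.
have mH n : measurable_fun setT (fun x : R => (1 + x ^+ 2) ^- n).
  rewrite (_ : (fun x : R => _) = (fun x => (1 + x ^+ 2)^-1 ^+ n)); last first.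
    by apply/funext => x; rewrite exprVn.
  by apply: measurable_funX; exact: continuous_measurable_fun (@continuous_oneDsqrV R).
split=> //.
- exact: period_domain_setT.
- exact: measurable_funM.
- by move=> x; rewrite mulr_ge0// invr_ge0 exprn_ge0// ltW.
- rewrite (_ : (fun x : R => _) = (fun x => (4 / s ^+ 2)%:E * ((1 + x ^+ 2)^-1)%:E)%E); last first.
    apply/funext => x; rewrite -EFinM; congr _%:E.
    by move: (4 / s ^+ 2) (1 + x ^+ 2) (lt0r_neq0 (d0 x)) => u v v0; field.
  rewrite ge0_integralZl//.
  + by rewrite integral_oneDsqrV EFinM.
  + by apply/measurable_EFinP; exact: (mH 1%N).
  + by move=> x _; rewrite lee_fin invr_ge0 ltW.
- by move=> x; rewrite addr0.
- move=> x b _; set y := x + b.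
  apply: (@le_trans _ _ (expR (- (beta * (a / 2) * y ^+ 2)))).
    by rewrite ler_expR lerN2 -mulrA ler_wpM2l// ltW.
  apply: (le_trans (gaussian_le_rational y s0 s1 sa)).
  (* A form of Peetre's inequality, which performs the transfer from y to x. *)
  have hxy : 1 + x ^+ 2 <= 2 * (1 + y ^+ 2) * (1 + b ^+ 2).
    have -> : x = y - b by rewrite /y; ring.
    have := sqr_ge0 (y + b); have := mulr_ge0 (sqr_ge0 y) (sqr_ge0 b); nra.
  have hxy2 : (1 + x ^+ 2) ^+ 2 <= 4 * (1 + y ^+ 2) ^+ 2 * (1 + b ^+ 2) ^+ 2.
    have -> : 4 * (1 + y ^+ 2) ^+ 2 * (1 + b ^+ 2) ^+ 2
      = (2 * (1 + y ^+ 2) * (1 + b ^+ 2)) ^+ 2 by ring.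
    by rewrite ler_sqr ?nnegrE ?(ltW (d0 x))// !mulr_ge0// ltW.
  rewrite exprMn invfM -mulrA [leRHS](_ : _ = (s ^+ 2)^-1
      * (4 * (1 + b ^+ 2) ^+ 2 / (1 + x ^+ 2) ^+ 2)); last by ring.
  apply: ler_wpM2l; first by rewrite invr_ge0 sqr_ge0.
  rewrite ler_pdivlMr ?exprn_gt0// mulrC ler_pdivrMr ?exprn_gt0//.
  by rewrite -mulrA [_ * (1 + y ^+ 2) ^+ 2]mulrC mulrA.
Qed.

(** The Lipschitz bound between 0 and y grows quadratically. This is the upper bound on V behind the
    lower bound of the partition function. *)
Lemma tame_quadratic_le (K : R) V : 0 <= K -> tame K V -> `|V 0| <= K ->
  forall y, V y <= 2 * K * (1 + y ^+ 2).
Proof.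
move=> K0 [_ tV _] V0 y; have := tV 0 y.
rewrite normr0 addr0 subr0 => h.
have h1 : V y <= `|V 0| + `|V y - V 0|.
  by have := ler_norm (V 0); have := ler_norm (V y - V 0); lra.
have h2 : (1 + `|y|) * `|y| <= 2^-1 + 3 / 2 * y ^+ 2.
  have -> : y ^+ 2 = `|y| ^+ 2 by rewrite real_normK// num_real.
  by have := sqr_ge0 (`|y| - 1); lra.
have := ler_wpM2l K0 h2; have := mulr_ge0 K0 (sqr_ge0 y); lra.
Qed.

End confining_case.

Lemma le_summands (R : realFieldType) (u1 u2 u3 u4 u5 u6 k : R) :
  0 <= u1 -> 0 <= u2 -> 0 <= u3 -> 0 <= u4 -> 0 <= u5 -> 0 <= u6 ->
  1 + u1 + u2 + u3 + u4 + u5 + u6 <= k ->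
  [/\ u1 <= k, u2 <= k, u3 <= k, u4 <= k & u5 <= k /\ u6 <= k].
Proof. by move=> *; split; try split; lra. Qed.

Lemma le_halves (R : realFieldType) (u1 u2 u3 u4 u5 u6 k : R) :
  0 <= u1 -> 0 <= u2 -> 0 <= u3 -> 0 <= u4 -> 0 <= u5 -> 0 <= u6 ->
  1 + u1 + u2 + u3 + u4 + u5 + u6 <= k ->
  u1 + u2 + u3 <= k /\ u4 + u5 + u6 <= k.
Proof. by move=> *; split; lra. Qed.

(** Both constants come from [error_const], whose arguments involve m, beta and the assumption
    constants alone; [C] can therefore be chosen before the functions and the Brownian motion. *)
Theorem mainTheorem3 (R : realType) (m beta : R)
    (hm : 0 < m) (hbeta : 0 < beta) :
  (forall L K : R, 0 < L -> 0 < K ->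
    exists C : R, 0 < C /\
      forall V O : R -> R,
        C2 V -> C2 O -> periodic V L -> periodic O L ->
        (forall x, 0 <= V x) ->
        (forall x, 0 <= x <= L ->
          1 + `|V x| + `|V^`() x| + `|V^`(2) x|
            + `|O x| + `|O^`() x| + `|O^`(2) x| <= K) ->
        forall (d : measure_display) (T : measurableType d)
          (P : probability T R) (B : R -> T -> R),
          standard_brownian_motion P B ->
          forall N : nat, (1 <= N)%N ->
            `|trotter_average m beta `[0, L] N V O
              - thermal_average P B m beta `[0, L] V O| <= C / N%:R ^+ 2)
  /\
  (forall a K : R, 0 < a -> 0 < K ->
    exists C : R, 0 < C /\
      forall V O : R -> R,
        C2 V -> C2 O ->
        (forall x, a / 2 * x ^+ 2 <= V x) ->
        (forall x,
          1 + `|V 0| + `|V^`() x| / (`|x| + 1) + `|V^`(2) x|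
            + `|O x| + `|O^`() x| + `|O^`(2) x| <= K) ->
        forall (d : measure_display) (T : measurableType d)
          (P : probability T R) (B : R -> T -> R),
          standard_brownian_motion P B ->
          forall N : nat, (1 <= N)%N ->
            `|trotter_average m beta [set: R] N V O
              - thermal_average P B m beta [set: R] V O|
            <= C * (ln N%:R + 1) `^ (3 / 2) / N%:R ^+ 2).
Proof.
split=> [L K L0 K0|a K a0 K0].
  (* The partition function is bounded below on [0, l], which must lie inside both [0, L] and
     [0, 1]. *)
  pose l := Num.min 1 L.
  pose c := error_const m beta ((1 + L ^+ 2) * L) K K l K.
  exists (`|c| + 1); split; first by rewrite ltr_wpDl.
  move=> V O cV cO pV pO V0 hK d T P B hB N N1.
  have hVO x : 0 <= x <= L -> `|V x| + `|V^`() x| + `|V^`(2) x| <= K /\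
      `|O x| + `|O^`() x| + `|O^`(2) x| <= K.
    move=> /hK h; exact: (le_halves (normr_ge0 _) (normr_ge0 _) (normr_ge0 _)
      (normr_ge0 _) (normr_ge0 _) (normr_ge0 _) h).
  have [tV VK] := periodic_bound_tame L0 K0 cV pV (fun x hx => (hVO x hx).1).
  have [tO OK] := periodic_bound_tame L0 K0 cO pO (fun x hx => (hVO x hx).2).
  have hC := periodic_confinement hbeta L0 K0 tV pV V0.
  have VK' y : V y <= K * (1 + y ^+ 2).
    rewrite (le_trans (ler_norm _))// (le_trans (VK y))//.
    by rewrite -[leLHS]mulr1 ler_wpM2l ?(ltW K0)// lerDl sqr_ge0.
  have l0 : 0 < l by rewrite lt_min ltr01.
  have l1 : l <= 1 by rewrite ge_min lexx.
  have lD : `[0, l] `<=` `[0, L].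
    move=> x /=; rewrite !in_itv/= => /andP[-> xl].
    by rewrite (le_trans xl)// ge_min lexx orbT.
  apply: (le_trans (average_error hB hC hm hbeta V0 (ltW K0) VK' l0 l1 lD tO pO OK N1)).
  rewrite ler_wpM2r ?invr_ge0 ?exprn_ge0// -/c.
  by rewrite (le_trans (ler_norm _))// lerDl.
pose s := Num.min 1 (beta * (a / 2) / 2).
pose c := error_const m beta (4 / s ^+ 2 * pi) K (2 * K) 1 K.
exists (`|c| + 1); split; first by rewrite ltr_wpDl.
move=> V O cV cO aV hK d T P B hB N N1.
have hx x : [/\ `|V 0| <= K, `|V^`() x| <= K * (1 + `|x|), `|V^`(2) x| <= K,
    `|O x| <= K & `|O^`() x| <= K /\ `|O^`(2) x| <= K].
  have x1 : 0 < `|x| + 1 by rewrite ltr_wpDl.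
  have [h1 h2 h3 h4 h5] := le_summands (normr_ge0 (V 0))
    (divr_ge0 (normr_ge0 (derive1 V x)) (ltW x1)) (normr_ge0 _) (normr_ge0 _)
    (normr_ge0 _) (normr_ge0 _) (hK x).
  by split => //; rewrite [1 + _]addrC -ler_pdivrMr.
have tV : tame K V.
  by apply: tame_C2 => //; [exact: ltW|move=> x; have [] := hx x|move=> x; have [] := hx x].
have tO : tame K O.
  apply: tame_C2 => //; [exact: ltW|move=> x|move=> x; have [_ _ _ _ []//] := hx x].
  have [_ _ _ _ [h _]] := hx x; rewrite (le_trans h)//.
  by rewrite -[leLHS]mulr1 ler_wpM2l ?(ltW K0)// lerDl.
have OK x : `|O x| <= K by have [] := hx x.
have s0 : 0 < s by rewrite lt_min ltr01 !divr_gt0// mulr_gt0// divr_gt0.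
have s1 : s <= 1 by rewrite ge_min lexx.
have s2 : 2 * s <= beta * (a / 2).
  by rewrite mulrC -ler_pdivlMr// ge_min lexx orbT.
have V0 x : 0 <= V x.
  by apply: le_trans (aV x); rewrite mulr_ge0 ?sqr_ge0// divr_ge0// ltW.
have hC := confining_confinement hbeta s0 s1 s2 (ltW K0) tV aV.
have VK : `|V 0| <= K by have [] := hx 0.
have VK' := tame_quadratic_le (ltW K0) tV VK.
have pO x : O (x + 0) = O x by rewrite addr0.
have K20 : 0 <= 2 * K by rewrite mulr_ge0// ltW.
have sub : `[0, 1] `<=` [set: R] by [].
apply: (le_trans (average_error hB hC hm hbeta V0 K20 VK' ltr01 (lexx 1) sub tO pO OK N1)).
rewrite ler_wpM2r ?invr_ge0 ?exprn_ge0// -/c.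
(* The error is already at most a constant over N^2, and the logarithmic factor is at least 1
   because ln N >= 0. *)
apply: (@le_trans _ _ (`|c| + 1)); first by rewrite (le_trans (ler_norm _))// lerDl.
rewrite ler_peMr ?addr_ge0//.
have ln0 : 0 <= ln (N%:R : R) by rewrite ln_ge0// ler1n.
rewrite -[X in X <= _](_ : 1 `^ (3 / 2) = 1); last by rewrite powR1.
by rewrite ge0_ler_powR ?nnegrE ?divr_ge0 ?addr_ge0// lerDr.
Qed.
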